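(* There is an isomorphism between the lattice of two-sided ideals of $\operatorname{U}(\mathfrak o(\infty))$ and the lattice of two-sided ideals of $\operatorname{U}(\mathfrak{sp}(\infty))$.
   Context: $\mathbb F$ is an algebraically closed field of characteristic $0$ and all Lie algebras are over $\mathbb F$. $\mathfrak o(\infty)$ is the union $\bigcup_n\mathfrak o(n)$ and $\mathfrak{sp}(\infty)$ is the union $\bigcup_n\mathfrak{sp}(2n)$ under the standard inclusions, for which the natural representation of the larger algebra restricts to the natural representation of the smaller one plus a trivial representation (of dimension 1 for $\mathfrak o$, of dimension 2 for $\mathfrak{sp}$). $\operatorname{U}(\cdot)$ is the universal enveloping algebra. The set of two-sided ideals is a lattice under inclusion. *)

(* Defs.v *)
From HB Require Import structures.
From mathcomp Require Import all_boot all_order all_algebra finmap.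
From mathcomp Require Import boolp classical_sets functions cardinality fsbigop.
From mathcomp.multinomials Require Import monalg.
From mathcomp Require Import ring zify.

Set Implicit Arguments.
Unset Strict Implicit.
Unset Printing Implicit Defensive.

Import Order.TTheory GRing.Theory.
Local Open Scope ring_scope.

(* Over a ring with 1, closure under subtraction follows from closure under
   multiplication by -1.  The improper ideal [setT] is included. *)
Definition two_sided (A : nzRingType) (I : set A) : Prop :=
  [/\ I 0, forall x y, I x -> I y -> I (x + y),
      forall a x, I x -> I (a * x) & forall a x, I x -> I (x * a)].

Record ideal2 (A : nzRingType) := Ideal2 {
  ideal2_set :> set A;
  ideal2P : two_sided ideal2_set
}.

HB.instance Definition _ (A : nzRingType) := gen_eqMixin (ideal2 A).
HB.instance Definition _ (A : nzRingType) := gen_choiceMixin (ideal2 A).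

Section Ideal2Lattice.
Variable A : nzRingType.
Implicit Types I J K : ideal2 A.

Lemma ideal2_inj I J : ideal2_set I = ideal2_set J -> I = J.
Proof.
case: I J => [I hI] [J hJ] /= E; case: J / E hJ => hJ.
by rewrite (Prop_irrelevance hI hJ).
Qed.

Definition ideal2_le I J : bool := `[< (I `<=` J)%classic >].

Lemma ideal2_leP I J : reflect (I `<=` J)%classic (ideal2_le I J).
Proof. exact: asboolP. Qed.

Lemma ideal2_le_refl : reflexive ideal2_le.
Proof. by move=> I; apply/ideal2_leP. Qed.

Lemma ideal2_le_anti : antisymmetric ideal2_le.
Proof.
by move=> I J /andP[/ideal2_leP IJ /ideal2_leP JI]; apply/ideal2_inj/seteqP.
Qed.

Lemma ideal2_le_trans : transitive ideal2_le.
Proof.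
move=> J I K /ideal2_leP IJ /ideal2_leP JK; apply/ideal2_leP.
exact: subset_trans IJ JK.
Qed.

Lemma ideal2_display : Order.disp_t. Proof. exact: (Order.Disp tt tt). Qed.

HB.instance Definition _ := Order.Le_isPOrder.Build ideal2_display (ideal2 A)
  ideal2_le_refl ideal2_le_anti ideal2_le_trans.

Lemma ideal2_meet_subproof I J : two_sided (I `&` J)%classic.
Proof.
case: (ideal2P I) (ideal2P J) => [I0 ID Il Ir] [J0 JD Jl Jr]; split => //.
- by move=> x y [? ?] [? ?]; split; [exact: ID|exact: JD].
- by move=> a x [? ?]; split; [exact: Il|exact: Jl].
- by move=> a x [? ?]; split; [exact: Ir|exact: Jr].
Qed.

Definition ideal2_meet I J := Ideal2 (ideal2_meet_subproof I J).

Lemma ideal2_join_subproof I J :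
  two_sided [set z | exists x y, [/\ ideal2_set I x, ideal2_set J y & z = x + y]]%classic.
Proof.
case: (ideal2P I) (ideal2P J) => [I0 ID Il Ir] [J0 JD Jl Jr]; split => /=.
- by exists 0, 0; rewrite addr0.
- move=> _ _ [x [y [Ix Jy ->]]] [x' [y' [Ix' Jy' ->]]].
  by exists (x + x'), (y + y'); split; [exact: ID|exact: JD|rewrite addrACA].
- move=> a _ [x [y [Ix Jy ->]]].
  by exists (a * x), (a * y); split; [exact: Il|exact: Jl|rewrite mulrDr].
- move=> a _ [x [y [Ix Jy ->]]].
  by exists (x * a), (y * a); split; [exact: Ir|exact: Jr|rewrite mulrDl].
Qed.

Definition ideal2_join I J := Ideal2 (ideal2_join_subproof I J).

Lemma ideal2_meetP I J K :
  (I <= ideal2_meet J K)%O = (I <= J)%O && (I <= K)%O.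
Proof.
apply/ideal2_leP/andP => [h|[/ideal2_leP IJ /ideal2_leP IK] x Ix].
  by split; apply/ideal2_leP => x /h[].
by split; [exact: IJ|exact: IK].
Qed.

Lemma ideal2_joinP I J K :
  (ideal2_join I J <= K)%O = (I <= K)%O && (J <= K)%O.
Proof.
apply/ideal2_leP/andP => [h|[/ideal2_leP IK /ideal2_leP JK] _ [x [y [Ix Jy ->]]]].
  case: (ideal2P I) (ideal2P J) => [I0 _ _ _] [J0 _ _ _].
  split; apply/ideal2_leP => x Ix; apply: h.
    by exists x, 0; rewrite addr0.
  by exists 0, x; rewrite add0r.
by case: (ideal2P K) => _ KD _ _; apply: KD; [exact: IK|exact: JK].
Qed.

HB.instance Definition _ :=
  Order.POrder_MeetJoin_isLattice.Build ideal2_display (ideal2 A)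
    ideal2_meetP ideal2_joinP.

End Ideal2Lattice.

HB.mixin Record Lmodule_isLie (R : comNzRingType) L of GRing.Lmodule R L := {
  lie : L -> L -> L;
  lie_linearl : forall z, linear (lie^~ z);
  lie_linearr : forall z, linear (lie z);
  liexx : forall x, lie x x = 0;
  lie_jacobi : forall x y z,
    lie x (lie y z) + lie y (lie z x) + lie z (lie x y) = 0
}.

#[short(type="lieAlgType")]
HB.structure Definition LieAlgebra (R : comNzRingType) :=
  {L of GRing.Lmodule R L & Lmodule_isLie R L}.

Definition lie_hom (R : comNzRingType) (L : lieAlgType R) (A : algType R)
    (f : L -> A) : Prop :=
  forall x y, f (lie x y) = f x * f y - f y * f x.

(* Keeps unification from unfolding products of the free algebra. *)
#[local] Opaque fgmul fgadd fgopp fgscale mkmalgU mmap msupp.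

Section FreeAlgebra.
Variables (F : comNzRingType) (L : choiceType).

Lemma freealg_scalerAr (k : F) (x y : {malg F[{fmonom L}]}) :
  k *: (x * y) = x * (k *: y).
Proof.
rewrite [in LHS]malgME scaler_sumr [RHS](malgMEw (fsubset_refl _) (msuppZ_le _ _)).
apply: eq_bigr => i _; rewrite scaler_sumr; apply: eq_bigr => j _.
apply/malgP => m; rewrite [LHS]mcoeffZ [in LHS]mcoeffU [RHS]mcoeffU.
by rewrite mcoeffZ mulrnAr mulrCA.
Qed.

Definition gen (x : L) : {malg F[{fmonom L}]} := << fmu x >>.

End FreeAlgebra.

Lemma two_sided_lker (A B : nzRingType) (g : {rmorphism A -> B}) : two_sided [set x | g x = 0]%classic.
Proof.
split => /= [|x y gx gy|a x gx|a x gx]; first exact: raddf0.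
- by rewrite raddfD /= gx gy addr0.
- by rewrite rmorphM /= gx mulr0.
- by rewrite rmorphM /= gx mul0r.
Qed.

Section FreeExtension.
Variables (F : comNzRingType) (L : choiceType) (A : algType F) (f : L -> A).
Local Notation T := {malg F[{fmonom L}]}.

Definition word_prod (m : {fmonom L}) : A := \prod_(x <- fmonom_val m) f x.

Lemma word_prod_mmorphism : mmorphism word_prod.
Proof.
split => [m1 m2|]; first by rewrite /word_prod [mmul _ _]fmmulE big_cat.
by rewrite /word_prod [mone]fmoneE big_nil.
Qed.

HB.instance Definition _ :=
  isMultiplicative.Build {fmonom L} A word_prod word_prod_mmorphism.

Definition free_ext : T -> A := mmap (in_alg A) word_prod.

Lemma free_ext_zmod_morphism : zmod_morphism free_ext.
Proof. exact: raddfB. Qed.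

HB.instance Definition _ :=
  GRing.isZmodMorphism.Build T A free_ext free_ext_zmod_morphism.

Lemma free_ext_monoid_morphism : monoid_morphism free_ext.
Proof.
have C : forall (g : T) (m m' : {fmonom L}),
    GRing.comm (in_alg A g@_m) (word_prod m').
  by move=> g m m'; rewrite /GRing.comm /= mulr_algl mulr_algr.
by have [gM g1] := commr_mmap_is_multiplicative C.
Qed.

HB.instance Definition _ :=
  GRing.isMonoidMorphism.Build T A free_ext free_ext_monoid_morphism.

Lemma free_ext_scalable : scalable free_ext.
Proof. by move=> c x; rewrite /free_ext mmapZ /= mulr_algl. Qed.

HB.instance Definition _ :=
  GRing.isScalable.Build F T A *:%R free_ext free_ext_scalable.

Lemma free_extB x y : free_ext (x - y) = free_ext x - free_ext y.
Proof. exact: free_ext_zmod_morphism. Qed.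

Lemma free_extD x y : free_ext (x + y) = free_ext x + free_ext y.
Proof. exact: raddfD. Qed.

Lemma free_extM x y : free_ext (x * y) = free_ext x * free_ext y.
Proof. exact: (free_ext_monoid_morphism.2 x y). Qed.

Lemma free_ext_gen x : free_ext (gen F x) = f x.
Proof.
by rewrite /free_ext mmapU /= /word_prod fmuE big_seq1 scale1r mul1r.
Qed.

Lemma free_ext_linear_rel (a : F) x y z :
  free_ext (gen F z - (a *: gen F x + gen F y)) = f z - (a *: f x + f y).
Proof.
by rewrite free_extB free_extD free_ext_scalable !free_ext_gen.
Qed.

Lemma free_ext_commutator p q r :
  free_ext (p * q - q * p - r)
  = free_ext p * free_ext q - free_ext q * free_ext p - free_ext r.
Proof.
rewrite free_extB; congr (_ - _); rewrite free_extB.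
by congr (_ - _); exact: free_extM.
Qed.

Lemma free_ext_commutator_rel x y z :
  free_ext (gen F x * gen F y - gen F y * gen F x - gen F z)
  = f x * f y - f y * f x - f z.
Proof. by rewrite free_ext_commutator !free_ext_gen. Qed.

Lemma malg_word (m : {fmonom L}) :
  << m >> = \prod_(x <- fmonom_val m) gen F x :> T.
Proof.
case: m => s /=; elim: s => [|x s IH]; first by rewrite big_nil -fmoneE.
rewrite big_cons -IH [RHS]malgM_def fgmulUU mulr1; congr << _ >>.
by rewrite [mmul _ _]fmmulE fmuE.
Qed.

Lemma free_ext_unique (g h : {lrmorphism T -> A}) :
  (forall x, g (gen F x) = h (gen F x)) -> g =1 h.
Proof.
move=> gh p; rewrite (monalgE p) !raddf_sum; apply: eq_bigr => m _ /=.
have -> : << p@_m *g m >> = p@_m *: \prod_(x <- fmonom_val m) gen F x.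
  rewrite -malg_word; apply/malgP => k.
  by rewrite [RHS]mcoeffZ [in RHS]mcoeffU [LHS]mcoeffU mulr_natr.
rewrite !linearZ !rmorph_prod /=; congr (_ *: _).
by apply: eq_bigr => x _; exact: gh.
Qed.

End FreeExtension.

#[local] Opaque free_ext gen.

Section Enveloping.
Variables (F : fieldType) (L : lieAlgType F).
Local Notation T := {malg F[{fmonom L}]}.

(* The first family of relations turns the free algebra on the set L into the
   tensor algebra of the vector space L. *)
Definition env_rel : set T := [set r | 
     (exists (a : F) (x y : L),
        r = gen F (a *: x + y) - (a *: gen F x + gen F y))
  \/ (exists x y : L,
        r = gen F x * gen F y - gen F y * gen F x - gen F (lie x y))]%classic.

Definition env_ideal : {pred T} :=
  fun r => `[< forall I : ideal2 T, (env_rel `<=` I)%classic ->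
                 ideal2_set I r >].

Lemma env_idealP : two_sided [set r | env_ideal r]%classic.
Proof.
split=> /= [|x y /asboolP Ix /asboolP Iy|a x /asboolP Ix|a x /asboolP Ix];
  apply/asboolP => I h; have [I0 ID Il Ir] := ideal2P I => //.
- by apply: ID; [exact: Ix|exact: Iy].
- by apply: Il; exact: Ix.
- by apply: Ir; exact: Ix.
Qed.

Lemma env_ideal_zmod_closed : zmod_closed env_ideal.
Proof.
have [I0 ID Il _] := env_idealP; split => // x y Ix Iy.
by apply: ID => //; rewrite -mulN1r; exact: Il.
Qed.

HB.instance Definition _ :=
  GRing.isZmodClosed.Build T env_ideal env_ideal_zmod_closed.

Lemma env_ideal_rel r : env_rel r -> env_ideal r.
Proof. by move=> h; apply/asboolP => I; exact. Qed.

Section Kills.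
Variables (A : algType F) (f : {linear L -> A}).
Hypothesis f_lie : lie_hom f.

Lemma free_ext_env r : env_ideal r -> free_ext f r = 0.
Proof.
move=> /asboolP /(_ (Ideal2 (@two_sided_lker T A (free_ext f)))); apply => /=.
move=> _ [[a [x [y ->]]]|[x [y ->]]] /=.
  by apply: etrans (free_ext_linear_rel _ _ _ _ _) _; rewrite linearP subrr.
by apply: etrans (free_ext_commutator_rel _ _ _ _) _; rewrite f_lie subrr.
Qed.

End Kills.

Definition Uenv : Type := Quotient.quot (env_ideal : zmodClosed T).
HB.instance Definition _ := GRing.Zmodule.on Uenv.
HB.instance Definition _ := EqQuotient.on Uenv.

Definition Upi : T -> Uenv := \pi_Uenv%qT.

Lemma Upi_eq (x y : T) : Upi x = Upi y <-> env_ideal (x - y).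
Proof.
have -> : env_ideal (x - y) = (Upi x == Upi y) := Quotient.idealrBE _ x y.
by split=> [->|/eqP].
Qed.

Lemma UpiB : zmod_morphism Upi.
Proof. exact: raddfB. Qed.

Lemma Upi_surj (u : Uenv) : exists x, u = Upi x.
Proof. by exists (repr u); rewrite /Upi reprK. Qed.

Lemma Upi_repr (x : T) : env_ideal (repr (Upi x) - x).
Proof. by apply/Upi_eq; rewrite /Upi reprK. Qed.

Definition Uone : Uenv := Upi 1.
Definition Umul (u v : Uenv) : Uenv := Upi (repr u * repr v).
Definition Uscale (a : F) (u : Uenv) : Uenv := Upi (a *: repr u).

Lemma Upi_mul x y : Umul (Upi x) (Upi y) = Upi (x * y).
Proof.
have [_ ID Il Ir] := env_idealP; apply/Upi_eq.
have -> : forall a b c d : T, a * b - c * d = a * (b - d) + (a - c) * d.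
  by move=> a b c d; rewrite mulrBr mulrBl addrA subrK.
by apply: ID; [exact/Il/Upi_repr|exact/Ir/Upi_repr].
Qed.

Lemma Upi_scale a x : Uscale a (Upi x) = Upi (a *: x).
Proof.
have [_ _ Il _] := env_idealP; apply/Upi_eq.
by rewrite -scalerBr -mul_malgC; exact/Il/Upi_repr.
Qed.

HB.instance Definition _ := GRing.isZmodMorphism.Build T Uenv Upi UpiB.

Lemma UmulA : associative Umul.
Proof.
move=> u v w; have [x ->] := Upi_surj u; have [y ->] := Upi_surj v.
by have [z ->] := Upi_surj w; rewrite !Upi_mul mulrA.
Qed.

Lemma Umul1u : left_id Uone Umul.
Proof. by move=> u; have [x ->] := Upi_surj u; rewrite Upi_mul mul1r. Qed.

Lemma Umulu1 : right_id Uone Umul.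
Proof. by move=> u; have [x ->] := Upi_surj u; rewrite Upi_mul mulr1. Qed.

Lemma UmulDl : left_distributive Umul +%R.
Proof.
move=> u v w; have [x ->] := Upi_surj u; have [y ->] := Upi_surj v.
by have [z ->] := Upi_surj w; rewrite -raddfD !Upi_mul -raddfD mulrDl.
Qed.

Lemma UmulDr : right_distributive Umul +%R.
Proof.
move=> u v w; have [x ->] := Upi_surj u; have [y ->] := Upi_surj v.
by have [z ->] := Upi_surj w; rewrite -raddfD !Upi_mul -raddfD mulrDr.
Qed.

(* The zero map L -> F extends to the augmentation, so U(L) is nonzero. *)
Lemma Uone_neq0 : Uone != 0.
Proof.
apply/negP => /eqP; rewrite -(raddf0 Upi) => /Upi_eq; rewrite subr0 => I1.
have zlie : lie_hom (\0 : {linear L -> F^o}).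
  by move=> x y; rewrite /= !mul0r subrr.
have := free_ext_env zlie I1; rewrite rmorph1 => /eqP.
by rewrite oner_eq0.
Qed.

HB.instance Definition _ := GRing.Zmodule_isNzRing.Build Uenv
  UmulA Umul1u Umulu1 UmulDl UmulDr Uone_neq0.

Lemma UscaleA a b u : Uscale a (Uscale b u) = Uscale (a * b) u.
Proof. by have [x ->] := Upi_surj u; rewrite !Upi_scale scalerA. Qed.

Lemma Uscale1u : left_id 1 Uscale.
Proof. by move=> u; have [x ->] := Upi_surj u; rewrite Upi_scale scale1r. Qed.

Lemma UscaleDr : right_distributive Uscale +%R.
Proof.
move=> a u v; have [x ->] := Upi_surj u; have [y ->] := Upi_surj v.
by rewrite -raddfD !Upi_scale -raddfD scalerDr.
Qed.

Lemma UscaleDl u : {morph Uscale^~ u : a b / a + b}.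
Proof.
move=> a b; have [x ->] := Upi_surj u.
by rewrite /= !Upi_scale -raddfD scalerDl.
Qed.

HB.instance Definition _ := GRing.Zmodule_isLmodule.Build F Uenv
  UscaleA Uscale1u UscaleDr UscaleDl.

Lemma UscaleAl (a : F) (u v : Uenv) : a *: (u * v) = (a *: u) * v.
Proof.
have [x ->] := Upi_surj u; have [y ->] := Upi_surj v.
rewrite [Upi x * _]Upi_mul [a *: Upi x]Upi_scale [LHS]Upi_scale [RHS]Upi_mul.
by rewrite scalerAl.
Qed.

HB.instance Definition _ := GRing.Lmodule_isLalgebra.Build F Uenv UscaleAl.

Lemma UscaleAr (a : F) (u v : Uenv) : a *: (u * v) = u * (a *: v).
Proof.
have [x ->] := Upi_surj u; have [y ->] := Upi_surj v.
rewrite [Upi x * _]Upi_mul [a *: Upi y]Upi_scale [LHS]Upi_scale [RHS]Upi_mul.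
by rewrite freealg_scalerAr.
Qed.

HB.instance Definition _ := GRing.Lalgebra_isAlgebra.Build F Uenv UscaleAr.

Lemma Upi_monoid_morphism : monoid_morphism Upi.
Proof. split; [exact: erefl | move=> x y; exact: esym (Upi_mul x y)]. Qed.

HB.instance Definition _ :=
  GRing.isMonoidMorphism.Build T Uenv Upi Upi_monoid_morphism.

Lemma Upi_scalable : scalable Upi.
Proof. move=> a x; exact: esym (Upi_scale a x). Qed.

HB.instance Definition _ :=
  GRing.isScalable.Build F T Uenv *:%R Upi Upi_scalable.

Definition Uinj (x : L) : Uenv := Upi (gen F x).

Lemma Uinj_linear : linear Uinj.
Proof.
move=> a x y; rewrite /Uinj -Upi_scalable -raddfD; apply/Upi_eq.
by apply: env_ideal_rel; left; exists a, x, y.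
Qed.

HB.instance Definition _ := GRing.isLinear.Build F L Uenv *:%R Uinj Uinj_linear.

Lemma Uinj_lie : lie_hom Uinj.
Proof.
move=> x y; rewrite /Uinj -!rmorphM -raddfB; apply/esym/Upi_eq.
by apply: env_ideal_rel; right; exists x, y.
Qed.

Theorem Uenv_universal (A : algType F) (f : {linear L -> A}) : lie_hom f ->
  exists g : {lrmorphism Uenv -> A},
    (forall x, g (Uinj x) = f x) /\
    (forall h : {lrmorphism Uenv -> A}, (forall x, h (Uinj x) = f x) -> h =1 g).
Proof.
move=> f_lie.
pose g (u : Uenv) : A := free_ext f (repr u).
have gE x : g (Upi x) = free_ext f x.
  apply/eqP; rewrite -subr_eq0 -free_ext_zmod_morphism.
  by apply/eqP/(free_ext_env f_lie)/Upi_repr.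
have gB : zmod_morphism g.
  move=> u v; have [x ->] := Upi_surj u; have [y ->] := Upi_surj v.
  by rewrite -raddfB !gE raddfB.
have gM : monoid_morphism g.
  split=> [|u v]; first by rewrite [LHS]gE rmorph1.
  have [x ->] := Upi_surj u; have [y ->] := Upi_surj v.
  by rewrite -rmorphM !gE rmorphM.
have gZ : scalable g.
  move=> a u; have [x ->] := Upi_surj u.
  by rewrite -Upi_scalable !gE free_ext_scalable.
pose g0 := GRing.isZmodMorphism.Build Uenv A g gB.
pose g1 := GRing.isMonoidMorphism.Build Uenv A g gM.
pose g2 := GRing.isScalable.Build F Uenv A *:%R g gZ.
pose G : {lrmorphism Uenv -> A} := HB.pack g g0 g1 g2.
have GE x : G (Uinj x) = f x by rewrite [LHS]gE free_ext_gen.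
exists G; split => // h hE u; have [x ->] := Upi_surj u.
pose hT : {lrmorphism T -> A} := h \o Upi.
pose GT : {lrmorphism T -> A} := G \o Upi.
by apply: (@free_ext_unique _ _ _ hT GT) => y; rewrite [LHS]hE [RHS]GE.
Qed.

End Enveloping.

#[global] Opaque Umul Uscale Uone Upi Uinj.

(* [F^o] is F as a module over itself, so that infinite matrices form an
   [lmodType F]. *)
Definition imx (F : fieldType) := nat -> nat -> F^o.
HB.instance Definition _ (F : fieldType) := GRing.Lmodule.on (imx F).

Section InfiniteMatrices.
Variable F : fieldType.

(* Extension by zero: M sits in the upper left corner. *)
Definition ext_mx n (M : 'M[F]_n) : imx F := fun i j =>
  if (insub i : option 'I_n, insub j : option 'I_n) is (Some i', Some j')
  then M i' j' else 0.

(* For m <= n this is the standard inclusion gl(m) -> gl(n); otherwise it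
   truncates. *)
Definition corner m n (M : 'M[F]_m) : 'M[F]_n := \matrix_(i, j) ext_mx M i j.

(* The sum over k has finite support as soon as A or B is some [ext_mx M]. *)
Definition imul (A B : imx F) : imx F := fun i j =>
  \sum_(k \in [set: nat]%classic) A i k * B k j.

Lemma ext_mxE n (M : 'M[F]_n) (i j : 'I_n) : ext_mx M i j = M i j.
Proof. by rewrite /ext_mx !valK. Qed.

Lemma ext_mx_outl n (M : 'M[F]_n) i j : (n <= i)%N -> ext_mx M i j = 0.
Proof. by move=> ni; rewrite /ext_mx insubF // ltnNge ni. Qed.

Lemma ext_mx_outr n (M : 'M[F]_n) i j : (n <= j)%N -> ext_mx M i j = 0.
Proof.
by move=> nj; rewrite /ext_mx (insubF _ (x := j)) ?ltnNge ?nj//; case: insub.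
Qed.

Lemma ext_mxP n (M : 'M[F]_n) (A : imx F) :
  (forall i j : 'I_n, M i j = A i j) ->
  (forall i j, (n <= i)%N -> A i j = 0) -> (forall i j, (n <= j)%N -> A i j = 0) ->
  ext_mx M = A.
Proof.
move=> MA A0l A0r; apply/funext => i; apply/funext => j.
have [ni|lti] := leqP n i; first by rewrite ext_mx_outl // A0l.
have [nj|ltj] := leqP n j; first by rewrite ext_mx_outr // A0r.
by rewrite -[i]/(val (Ordinal lti)) -[j]/(val (Ordinal ltj)) ext_mxE MA.
Qed.

Lemma ext_mx_inj n : injective (@ext_mx n).
Proof. by move=> M N E; apply/matrixP => i j; rewrite -!ext_mxE E. Qed.

Lemma ext_mx_linear n : linear (@ext_mx n).
Proof.
move=> a M N; apply: ext_mxP => i j; first by rewrite !mxE -!ext_mxE.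
  by move=> ni; rewrite !fctE /= !ext_mx_outl // scaler0 addr0.
by move=> nj; rewrite !fctE /= !ext_mx_outr // scaler0 addr0.
Qed.

HB.instance Definition _ n :=
  GRing.isLinear.Build F 'M[F]_n (imx F) *:%R (@ext_mx n) (@ext_mx_linear n).

Lemma ext_mx_corner m n (M : 'M[F]_m) : (m <= n)%N ->
  ext_mx (corner n M) = ext_mx M.
Proof.
move=> mn; apply: ext_mxP => i j; first by rewrite mxE.
  by move=> ni; rewrite ext_mx_outl // (leq_trans mn).
by move=> nj; rewrite ext_mx_outr // (leq_trans mn).
Qed.

Lemma sum_nat_widen m n (f : nat -> F) : (m <= n)%N ->
  (forall k, (m <= k)%N -> f k = 0) -> \sum_(k < n) f k = \sum_(k < m) f k.
Proof.
move=> mn f0; rewrite -!(big_mkord xpredT f) (big_cat_nat _ _ (n := m)) //=.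
rewrite [X in _ + X]big_nat_cond [X in _ + X]big1 ?addr0 //.
by move=> k /andP[/andP[mk _] _]; exact: f0.
Qed.

Lemma imul_ext n (M N : 'M[F]_n) :
  imul (ext_mx M) (ext_mx N) = ext_mx (M *m N).
Proof.
apply/esym/ext_mxP => i j => [|ni|nj]; last first.
- by rewrite /imul fsbig1 // => k _; rewrite (ext_mx_outr N) // mulr0.
- by rewrite /imul fsbig1 // => k _; rewrite ext_mx_outl // mul0r.
rewrite /imul -(fsbig_widen [set k | (k < n)%N]%classic) //=; last first.
  by move=> k [_ /= /negP]; rewrite -leqNgt => nk; rewrite ext_mx_outr // mul0r.
rewrite -fsbig_ord mxE /=; apply: eq_bigr => k _.
by rewrite !ext_mxE.
Qed.

End InfiniteMatrices.

Record mx_chain (F : fieldType) := MxChain {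
  chain_dim : nat -> nat;
  chain_set : forall n, {pred 'M[F]_(chain_dim n)};
  chain_dim_mono : forall m n, (m <= n)%N -> (chain_dim m <= chain_dim n)%N;
  chain_submod : forall n, submod_closed (@chain_set n);
  chain_lie : forall n, {in @chain_set n &, forall M N,
    M *m N - N *m M \in @chain_set n};
  chain_corner : forall m n, (m <= n)%N ->
    {in @chain_set m, forall M, corner (chain_dim n) M \in @chain_set n}
}.
Arguments chain_set {F} m n : rename.

Section ChainUnion.
Variables (F : fieldType) (C : mx_chain F).

Definition in_chain_union : {pred imx F} := fun A =>
  `[< exists n (M : 'M[F]_(chain_dim C n)), M \in chain_set C n /\ A = ext_mx M >].

Lemma chain_union_corner m n (M : 'M[F]_(chain_dim C m)) : (m <= n)%N ->
  M \in chain_set C m -> exists2 N, N \in chain_set C n & ext_mx M = ext_mx N.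
Proof.
move=> mn CM; exists (corner (chain_dim C n) M); first exact: chain_corner.
by rewrite ext_mx_corner // chain_dim_mono.
Qed.

Lemma chain_union2 A B : A \in in_chain_union -> B \in in_chain_union ->
  exists n (M N : 'M[F]_(chain_dim C n)),
    [/\ M \in chain_set C n, N \in chain_set C n, A = ext_mx M & B = ext_mx N].
Proof.
move=> /asboolP[m [M [CM ->]]] /asboolP[n [N [CN ->]]].
have [M' CM' ->] := chain_union_corner (leq_maxl m n) CM.
have [N' CN' ->] := chain_union_corner (leq_maxr m n) CN.
by exists (maxn m n), M', N'.
Qed.

Lemma chain_union_submod : submod_closed in_chain_union.
Proof.
split=> [|a A B /chain_union2 h /h [n [M [N [CM CN -> ->]]]]].
  apply/asboolP; exists 0%N, 0; split; last by rewrite raddf0.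
  by have [] := chain_submod C 0.
apply/asboolP; exists n, (a *: M + N); rewrite linearP; split => //.
by have [_] := chain_submod C n; exact.
Qed.

Record chain_union := ChainUnion {
  chain_union_val : imx F;
  _ : in_chain_union chain_union_val
}.

HB.instance Definition _ := [isSub for chain_union_val].
HB.instance Definition _ := [Choice of chain_union by <:].
HB.instance Definition _ :=
  GRing.SubChoice_isSubLmodule.Build F (imx F) in_chain_union chain_union
    (GRing.submod_closed_semi chain_union_submod).

Definition imx_comm (A B : imx F) : imx F := imul A B - imul B A.

Lemma imx_comm_ext n (M N : 'M[F]_n) :
  imx_comm (ext_mx M) (ext_mx N) = ext_mx (M *m N - N *m M).
Proof. by rewrite /imx_comm !imul_ext raddfB. Qed.

Lemma chain_union_comm (A B : chain_union) :
  in_chain_union (imx_comm (val A) (val B)).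
Proof.
have [n [M [N [CM CN -> ->]]]] := chain_union2 (valP A) (valP B).
apply/asboolP; exists n, (M *m N - N *m M).
by rewrite imx_comm_ext; split => //; exact: chain_lie.
Qed.

Definition chain_union_lie (A B : chain_union) : chain_union :=
  ChainUnion (chain_union_comm A B).

Lemma val_lie A B : val (chain_union_lie A B) = imx_comm (val A) (val B).
Proof. by []. Qed.

Lemma valP_linear a (A B : chain_union) : val (a *: A + B) = a *: val A + val B.
Proof. by []. Qed.

Lemma chain_union3 (A B D : chain_union) :
  exists n (M N P : 'M[F]_(chain_dim C n)),
    [/\ val A = ext_mx M, val B = ext_mx N & val D = ext_mx P].
Proof.
have [m [M [N [CM CN -> ->]]]] := chain_union2 (valP A) (valP B).
have /asboolP[n [P [CP ->]]] := valP D.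
have [M' _ ->] := chain_union_corner (leq_maxl m n) CM.
have [N' _ ->] := chain_union_corner (leq_maxl m n) CN.
have [P' _ ->] := chain_union_corner (leq_maxr m n) CP.
by exists (maxn m n), M', N', P'.
Qed.

Lemma chain_union_lie_linearl D : linear (chain_union_lie^~ D).
Proof.
move=> a A B; apply: val_inj; have [n [M [N [P [EA EB ED]]]]] := chain_union3 A B D.
rewrite valP_linear !val_lie valP_linear EA EB ED.
rewrite -ext_mx_linear !imx_comm_ext -ext_mx_linear.
congr ext_mx; rewrite mulmxDl mulmxDr -scalemxAl -scalemxAr scalerBr opprD.
by rewrite addrACA.
Qed.

Lemma chain_union_liexx A : chain_union_lie A A = 0.
Proof. by apply: val_inj; rewrite /= /imx_comm subrr. Qed.

Lemma chain_union_lieC A B : chain_union_lie A B = - chain_union_lie B A.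
Proof. apply: val_inj.
change (imx_comm (val A) (val B) = - imx_comm (val B) (val A)).
by rewrite /imx_comm opprB. Qed.

Lemma chain_union_lie_linearr D : linear (chain_union_lie D).
Proof.
move=> a A B; rewrite chain_union_lieC chain_union_lie_linearl opprD -scalerN.
by rewrite -!(chain_union_lieC D).
Qed.

Lemma chain_union_jacobi A B D :
  chain_union_lie A (chain_union_lie B D)
  + chain_union_lie B (chain_union_lie D A)
  + chain_union_lie D (chain_union_lie A B) = 0.
Proof.
apply: val_inj; have [n [M [N [P [EA EB ED]]]]] := chain_union3 A B D.
change (imx_comm (val A) (imx_comm (val B) (val D))
  + imx_comm (val B) (imx_comm (val D) (val A))
  + imx_comm (val D) (imx_comm (val A) (val B)) = 0).
rewrite EA EB ED !imx_comm_ext -!raddfD -(raddf0 (ext_mx (n := chain_dim C n))).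
congr ext_mx; rewrite !mulmxBl !mulmxBr !mulmxA.
apply/matrixP => i j.
have DE (X Y : 'M[F]_(chain_dim C n)) : (X + Y) i j = X i j + Y i j.
  by rewrite mxE.
have NE (X : 'M[F]_(chain_dim C n)) : (- X) i j = - X i j by rewrite mxE.
by rewrite !(DE, NE) [RHS]mxE; ring.
Qed.

HB.instance Definition _ := Lmodule_isLie.Build F chain_union
  chain_union_lie_linearl chain_union_lie_linearr chain_union_liexx
  chain_union_jacobi.

End ChainUnion.

Section Classical.
Variable F : fieldType.

(* The Lie algebra of the bilinear form with Gram matrix B. *)
Definition form_lie n (B : 'M[F]_n) : {pred 'M[F]_n} :=
  [pred M | M^T *m B + B *m M == 0].

Lemma form_lie_submod n (B : 'M[F]_n) : submod_closed (form_lie B).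
Proof.
split=> [|a M N]; rewrite !inE; first by rewrite trmx0 mul0mx mulmx0 addr0.
move=> /eqP hM /eqP hN; rewrite linearP /= mulmxDl mulmxDr.
by rewrite -scalemxAl -scalemxAr addrACA -scalerDr hM hN scaler0 addr0.
Qed.

Lemma form_lie_lie n (B : 'M[F]_n) :
  {in form_lie B &, forall M N, M *m N - N *m M \in form_lie B}.
Proof.
move=> M N; rewrite !inE !addr_eq0 => /eqP hM /eqP hN.
rewrite raddfB /= !trmx_mul mulmxBl mulmxBr -!mulmxA hM hN !mulmxN.
by rewrite !mulmxA hM hN !mulNmx !opprK opprB -!mulmxA.
Qed.

Lemma form_lie_corner (b : nat -> nat -> F) m n : (m <= n)%N ->
  (forall i j, (i < m)%N -> (m <= j)%N -> b i j = 0 /\ b j i = 0) ->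
  {in form_lie (\matrix_(i < m, j < m) b i j),
    forall M, corner n M \in form_lie (\matrix_(i < n, j < n) b i j)}.
Proof.
move=> mn b0 M; rewrite !inE => /eqP/matrixP hM.
have E : forall i j : nat, \sum_(k < m) ext_mx M k i * b k j
     + \sum_(k < m) b i k * ext_mx M k j = 0.
  move=> i j; have [mi|im] := leqP m i.
    rewrite big1 ?add0r => [|k _]; last by rewrite ext_mx_outr // mul0r.
    by apply: big1 => k _; have [_ ->] := b0 k i (ltn_ord k) mi; rewrite mul0r.
  have [mj|jm] := leqP m j.
    rewrite addrC big1 ?add0r => [|k _]; last by rewrite ext_mx_outr // mulr0.
    by apply: big1 => k _; have [-> _] := b0 k j (ltn_ord k) mj; rewrite mulr0.
  have := hM (Ordinal im) (Ordinal jm); rewrite !mxE => H; rewrite -[RHS]H.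
  congr (_ + _); apply: eq_bigr => k _; rewrite !mxE -?ext_mxE //.
apply/eqP/matrixP => i j; rewrite !mxE -[RHS](E i j); congr (_ + _).
  rewrite -(sum_nat_widen (f := fun k => ext_mx M k i * b k j) mn).
    by apply: eq_bigr => k _; rewrite !mxE.
  by move=> k mk; rewrite ext_mx_outl // mul0r.
rewrite -(sum_nat_widen (f := fun k => b i k * ext_mx M k j) mn).
  by apply: eq_bigr => k _; rewrite !mxE.
by move=> k mk; rewrite ext_mx_outl // mulr0.
Qed.

Definition orth n : {pred 'M[F]_n} := form_lie 1%:M.

(* Block-diagonal Gram matrix with n diagonal blocks [[0, 1], [-1, 0]]. *)
Definition symp_entry (i j : nat) : F :=
  if ~~ odd i && (j == i.+1) then 1
  else if ~~ odd j && (i == j.+1) then - 1 else 0.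

Definition symp_form n : 'M[F]_n.*2 := \matrix_(i, j) symp_entry i j.

Definition symp n : {pred 'M[F]_n.*2} := form_lie (symp_form n).

Lemma orth_corner m n : (m <= n)%N ->
  {in @orth m, forall M, corner n M \in @orth n}.
Proof.
have E k : 1%:M = \matrix_(i < k, j < k) ((i == j :> nat)%:R : F).
  by apply/matrixP => i j; rewrite !mxE.
move=> mn; rewrite /orth !E.
apply: (@form_lie_corner (fun i j => (i == j)%:R)) => // i j im mj.
have ij : (i < j)%N by exact: leq_trans im mj.
by rewrite [j == i]eq_sym (ltn_eqF ij).
Qed.

Lemma symp_corner m n : (m <= n)%N ->
  {in @symp m, forall M, corner n.*2 M \in @symp n}.
Proof.
move=> mn; apply: (@form_lie_corner symp_entry); first by rewrite leq_double.
move=> i j im mj; rewrite /symp_entry.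
have -> : (~~ odd i && (j == i.+1)) = false by lia.
by have -> : (~~ odd j && (i == j.+1)) = false by lia.
Qed.

Definition orth_chain : mx_chain F := @MxChain F id orth (fun _ _ => id)
  (fun n => form_lie_submod _) (fun n => @form_lie_lie n _) orth_corner.

Lemma leq_double_mono m n : (m <= n)%N -> (m.*2 <= n.*2)%N.
Proof. by rewrite leq_double. Qed.

Definition symp_chain : mx_chain F := @MxChain F double symp leq_double_mono
  (fun n => form_lie_submod _) (fun n => @form_lie_lie _ _) symp_corner.

Definition o_inf : lieAlgType F := chain_union orth_chain.
Definition sp_inf : lieAlgType F := chain_union symp_chain.

End Classical.

(* Main.v *)
(* In a hyperbolic basis both Lie algebras are spanned by elements E_ab, where a
   and b run over the basis vectors (letters), with E_ab = - e E_ba and e = 1 for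
   o, e = -1 for sp.  Through a b c d ... |-> E_ab E_cd ... an ideal of the
   enveloping algebra becomes a subspace W of the free algebra on the letters
   that is stable under the Lie algebra.

   By the first fundamental theorem, an invariant of tensors is a combination of
   contractions along perfect matchings of the positions, and because infinitely
   many letters are available it is determined by its values on words without
   repeated letters.  On such a word the contractions for the two forms differ
   only by the sign of a permutation and by a sign depending on the matching.

   A stable subspace W is determined by its contractions: w is in W as soon as,
   for each word y, the contraction of y w is a contraction of some combination
   of words y' w' with |y'| = |y| and w' in W.  Indeed the positions of y can be
   filled by acting on w with E_xa for fresh letters x, and the old letters that
   remain are removed in pairs by Casimir-type operators, which are scalars
   modulo W by induction; dividing by these scalars uses characteristic 0.

   So W can be transferred from one form to the other through its contractions,
   twisted by the sign of the matching.  The defining relations of U(g) are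
   checked on words without repeated letters, hence ideals go to ideals, and the
   transfer back is inverse to this. *)

Require Import Defs.
From HB Require Import structures.
From mathcomp Require Import all_boot all_order all_algebra finmap.
From mathcomp Require Import boolp classical_sets fsbigop.
From mathcomp.multinomials Require Import monalg.
From mathcomp Require Import ring zify.

Set Implicit Arguments.
Unset Strict Implicit.
Unset Printing Implicit Defensive.

Import Order.TTheory GRing.Theory.
Local Open Scope ring_scope.

#[local] Opaque fgmul fgadd fgopp fgscale mkmalgU mmap msupp.

(** The obstacle is words with repeated letters, where the sign of a permutation makes no sense.
    This is why W is only seen through contractions against test words of a fixed length: such
    conditions are statements about invariants, so they may be checked on words without repetitions.
    The sign attached to a matching is (-1) to the number of its crossings. The index recorded for
    an arc counts the remaining positions that it encloses, and this has the parity of the number of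
    remaining arcs that cross it. So the sum of the indices has the parity of the number of
    crossings, and [tw] multiplies by this sign. The two inclusions behind the involution have
    different reasons. One is the recovery of W from its contractions, with the two twists
    cancelling. The other needs enough elements of the transferred space. They come from [theta],
    which multiplies a word without repetitions by its sign; this is compatible with the action only
    on combinations in which the number of letters from each hyperbolic pair has a fixed parity. The
    averages used to recover an element have this form, since their words consist of fixed fresh
    letters and of whole fresh pairs. *)

(** * Words *)

(* The free algebra on the letters [nat], packed with what is used of it.  An
   inhabitant is produced opaquely, so that conversion never unfolds [malg]. *)
Record words_alg (F : fieldType) := WordsAlg {
  wa_sort : algType F;
  wa_wd : seq nat -> wa_sort;
  wa_nil : wa_wd [::] = 1;
  wa_cat : forall u v, wa_wd (u ++ v) = wa_wd u * wa_wd v;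
  wa_combo : forall t, exists s : seq (F * seq nat), t = \sum_(x <- s) x.1 *: wa_wd x.2;
  wa_lext : forall (M : lmodType F) (f : seq nat -> M), {g : {linear wa_sort -> M} | forall u, g (wa_wd u) = f u};
  wa_coef : seq nat -> {scalar wa_sort};
  wa_coefP : forall t u, (forall v, wa_coef v t = wa_coef v u) -> t = u
}.

Lemma words_alg_witness (F : fieldType) : words_alg F.
Proof.
pose T0 := {malg F[{fmonom nat}]}.
pose T1 : algType F := HB.pack T0 (GRing.Lalgebra_isAlgebra.Build F T0 (@freealg_scalerAr F nat)).
have coefl v : scalar (fun t : T0 => t@_(FMonom v)).
  by move=> a x y; rewrite mcoeffD mcoeffZ.
pose coef v : {scalar T1} :=
  HB.pack (fun t : T0 => t@_(FMonom v)) (GRing.isLinear.Build F T0 F _ _ (coefl v)).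
apply: (@WordsAlg F T1 (fun u => << FMonom u >> : T0) _ _ _ _ coef).
- by rewrite -fmoneE.
- move=> u v; rewrite -[RHS]/((<< FMonom u >> : T0) * << FMonom v >>).
  rewrite malgM_def fgmulUU mulr1; congr << _ >>.
  by rewrite [mmul _ _]fmmulE.
- move=> t; exists [seq ((t : T0)@_k, fmonom_val k) | k <- msupp (t : T0)].
  rewrite big_map [LHS](monalgE t); apply: eq_bigr => k _ /=.
  rewrite fmK; apply/malgP => m.
  by rewrite [RHS]mcoeffZ [in RHS]mcoeffU [LHS]mcoeffU mulr_natr.
- move=> M f.
  pose g (t : T0) := \sum_(k <- msupp t) t@_k *: f (fmonom_val k).
  have gE (t : T0) d : fsubset (msupp t) d ->
      g t = \sum_(k <- d) t@_k *: f (fmonom_val k).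
    move=> le; rewrite [LHS](big_fset_incl _ le) => //= x xd /mcoeff_outdom ->.
    by rewrite scale0r.
  have gl : linear g.
    move=> a t u.
    set d := fsetU (msupp (a *: t + u)) (fsetU (msupp t) (msupp u)).
    rewrite !(gE _ d) /d ?fsubsetUl ?fsubsetUr //; last first.
    - by apply/fsubsetP => x xu; rewrite !inE xu !orbT.
    - by apply/fsubsetP => x xu; rewrite !inE xu !orbT.
    rewrite scaler_sumr -big_split /=; apply: eq_bigr => k _.
    by rewrite scalerA -scalerDl mcoeffD mcoeffZ.
  pose G : {linear T1 -> M} := HB.pack g (GRing.isLinear.Build F T0 M _ _ gl).
  exists G => u.
  by rewrite [LHS](gE _ _ msuppU_le) big_seq_fset1 mcoeffUU scale1r.
- by move=> t u h; apply/malgP => -[v]; apply: h.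
Qed.

Section Words.
Variable F : fieldType.

Definition tens : algType F := wa_sort (words_alg_witness F).
Definition wd (u : seq nat) : tens := wa_wd _ u.
Definition coefw v : {scalar tens} := wa_coef _ v.
Definition lext (M : lmodType F) (f : seq nat -> M) : {linear tens -> M} :=
  sval (wa_lext _ f).

Lemma wd_nil : wd [::] = 1. Proof. exact: wa_nil. Qed.
Lemma wd_cat u v : wd (u ++ v) = wd u * wd v. Proof. exact: wa_cat. Qed.
Lemma lext_wd (M : lmodType F) (f : seq nat -> M) u : lext f (wd u) = f u.
Proof. by rewrite /lext; case: wa_lext => g /= ->. Qed.

Lemma lextD (M : lmodType F) (f : seq nat -> M) x y : lext f (x + y) = lext f x + lext f y.
Proof. exact: linearD. Qed.
Lemma lextN (M : lmodType F) (f : seq nat -> M) x : lext f (- x) = - lext f x.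
Proof. exact: linearN. Qed.
Lemma lextZ (M : lmodType F) (f : seq nat -> M) a x : lext f (a *: x) = a *: lext f x.
Proof. exact: linearZ_LR. Qed.
Definition lextE := (lextD, lextN, lextZ, lext_wd).

Lemma coefw0 v : coefw v 0 = 0. Proof. exact: raddf0. Qed.
Lemma coefwD v x y : coefw v (x + y) = coefw v x + coefw v y.
Proof. exact: raddfD. Qed.
Lemma coefwN v x : coefw v (- x) = - coefw v x. Proof. exact: raddfN. Qed.
Lemma coefwZ v a x : coefw v (a *: x) = a * coefw v x.
Proof. exact: linearZ_LR. Qed.
Definition coefwE := (coefwD, coefwN, coefwZ).

(** Turns a linear identity of tensors into one scalar identity for each word, which [ring] or
    [field] can close. *)
Lemma tens_eqP (t u : tens) : (forall v, coefw v t = coefw v u) -> t = u.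
Proof. exact: wa_coefP. Qed.

Definition subsp (M : lmodType F) (S : M -> Prop) : Prop :=
  S 0 /\ forall a x y, S x -> S y -> S (a *: x + y).

Definition combo (P : seq nat -> Prop) (t : tens) : Prop :=
  exists s : seq (F * seq nat),
    (forall x, x \in s -> P x.2) /\ t = \sum_(x <- s) x.1 *: wd x.2.

Lemma combo_all t : combo (fun=> True) t.
Proof.
by have [s E] := wa_combo t; exists s.
Qed.

Lemma subsp0 (M : lmodType F) (S : M -> Prop) : subsp S -> S 0. Proof. by case. Qed.
Lemma subspD (M : lmodType F) (S : M -> Prop) : subsp S -> forall x y, S x -> S y -> S (x + y).
Proof. by move=> [_ h] x y Sx Sy; rewrite -[x]scale1r; apply: h. Qed.
Lemma subspZ (M : lmodType F) (S : M -> Prop) : subsp S -> forall a x, S x -> S (a *: x).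
Proof. by move=> [h0 h] a x Sx; rewrite -[_ *: _]addr0; apply: h. Qed.
Lemma subspN (M : lmodType F) (S : M -> Prop) : subsp S -> forall x, S x -> S (- x).
Proof. by move=> hS x Sx; rewrite -scaleN1r; apply: subspZ. Qed.
Lemma subspB (M : lmodType F) (S : M -> Prop) : subsp S -> forall x y, S x -> S y -> S (x - y).
Proof. by move=> hS x y Sx Sy; apply: subspD => //; apply: subspN. Qed.
Lemma subsp_sum (M : lmodType F) (S : M -> Prop) : subsp S -> forall (I : eqType) (r : seq I) (f : I -> M),
  (forall i, i \in r -> S (f i)) -> S (\sum_(i <- r) f i).
Proof.
move=> hS I r f; elim: r => [|i r IH] h; first by rewrite big_nil; apply: subsp0.
rewrite big_cons; apply: subspD => //; first by apply: h; rewrite mem_head.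
by apply: IH => j jr; apply: h; rewrite inE jr orbT.
Qed.

Lemma combo_subsp P : subsp (combo P).
Proof.
split; first by exists [::]; rewrite big_nil.
move=> a _ _ [s [hs ->]] [s' [hs' ->]].
exists ([seq (a * x.1, x.2) | x <- s] ++ s'); split.
  by move=> x; rewrite mem_cat => /orP[/mapP[y /hs ? ->] //|/hs'].
rewrite big_cat big_map scaler_sumr; congr (_ + _).
by apply: eq_bigr => x _; rewrite scalerA.
Qed.

Lemma combo_wd (P : seq nat -> Prop) u : P u -> combo P (wd u).
Proof.
move=> h; exists [:: (1, u)]; split; first by move=> x; rewrite inE => /eqP->.
by rewrite big_seq1 scale1r.
Qed.

Lemma combo_ind (P : seq nat -> Prop) (S : tens -> Prop) : subsp S ->
  (forall u, P u -> S (wd u)) -> forall t, combo P t -> S t.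
Proof.
move=> hS h _ [s [hs ->]]; apply: subsp_sum => // x xs.
by apply: subspZ => //; apply: h; apply: hs.
Qed.

Lemma tens_ind (S : tens -> Prop) : subsp S ->
  (forall u, S (wd u)) -> forall t, S t.
Proof. by move=> hS h t; apply: (combo_ind hS) (combo_all t) => u _; apply: h. Qed.

Lemma combo_sub (P Q : seq nat -> Prop) t : (forall u, P u -> Q u) -> combo P t -> combo Q t.
Proof. by move=> h [s [hs ->]]; exists s; split=> // x /hs /h. Qed.

Lemma combo_false t : combo (fun=> False) t -> t = 0.
Proof.
move=> [[|x s] [hs ->]]; first by rewrite big_nil.
by have := hs x (mem_head _ _).
Qed.

Lemma subsp_pre (M N : lmodType F) (f : M -> N) (S : N -> Prop) :
  linear f -> subsp S -> subsp (fun x => S (f x)).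
Proof.
move=> fl hS; split; last by move=> a x y Sx Sy; rewrite fl; apply: hS.2.
by have := fl (-1) 0 0; rewrite scaler0 addr0 => ->; rewrite scaleN1r addNr; apply: subsp0.
Qed.

Lemma combo_lin (M : lmodType F) (P : seq nat -> Prop) (f : tens -> M) (S : M -> Prop) :
  linear f -> subsp S -> (forall u, P u -> S (f (wd u))) ->
  forall t, combo P t -> S (f t).
Proof. by move=> fl hS; apply: (combo_ind (S := fun x => S (f x))); apply: subsp_pre. Qed.

Lemma subsp_zero (M : lmodType F) : subsp (fun x : M => x = 0).
Proof. by split=> // a x y -> ->; rewrite scaler0 addr0. Qed.

Lemma subsp_eq (M N : lmodType F) (f g : M -> N) :
  linear f -> linear g -> subsp (fun x => f x = g x).
Proof.
move=> fl gl.
split; last by move=> a x y Sx Sy; rewrite fl gl Sx Sy.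
have h (k : M -> N) : linear k -> k 0 = 0.
  by move=> kl; have := kl (-1) 0 0; rewrite scaler0 addr0 => ->; rewrite scaleN1r addNr.
by rewrite !h.
Qed.

End Words.

#[global] Arguments wd {F}.
#[global] Opaque tens wd coefw lext combo.

#[global] Arguments combo_subsp {F P}.
#[global] Arguments combo_all {F} t.
#[global] Arguments combo_wd {F P u} _.
#[global] Arguments tens_ind {F} S _ _ t.
#[global] Arguments combo_ind {F P} S _ _ t _.
#[global] Arguments combo_lin {F M P} f S _ _ _ t _.

(** * The two Lie algebras acting on words *)

(* The letters 2j and 2j+1 form a hyperbolic pair for [om e], which is symmetric
   for e = 1 and alternating for e = -1. *)
Definition prt (a : nat) : nat := if odd a then a.-1 else a.+1.

Lemma prtK : involutive prt.
Proof. move=> a; rewrite /prt; case: (boolP (odd a)) => h; case: ifP; lia. Qed.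
Lemma prt_inj : injective prt. Proof. exact: can_inj prtK. Qed.
Lemma odd_prt a : odd (prt a) = ~~ odd a. Proof. rewrite /prt; case: ifP; lia. Qed.
Lemma prt_lt K a : ~~ odd K -> (a < K)%N -> (prt a < K)%N.
Proof. rewrite /prt; case: ifP; lia. Qed.

Section Form.
Variables (F : fieldType) (e : F).
Hypothesis ee : e * e = 1.
Local Notation tens := (tens F).
Local Notation lt a := (@wd F [:: a]).

Definition om (a b : nat) : F := if b == prt a then (if odd a then e else 1) else 0.

Lemma om_sym a b : om a b = e * om b a.
Proof.
rewrite /om -[b == prt a](can2_eq prtK prtK) [a == _]eq_sym.
case: eqP => [<-|_]; last by rewrite mulr0.
by rewrite odd_prt; case: (odd b); rewrite ?mulr1 ?ee.
Qed.

Lemma om_neq0 a b : b != prt a -> om a b = 0. Proof. by rewrite /om => /negbTE->. Qed.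

(* The rank two endomorphisms [act a b] span o (e = 1) or sp (e = -1). *)
Definition act (a b z : nat) : tens := om b z *: lt a - (e * om a z) *: lt b.

Fixpoint Dw (a b : nat) (u : seq nat) : tens :=
  if u is z :: u' then act a b z * wd u' + lt z * Dw a b u' else 0.

Definition D (a b : nat) : {linear tens -> tens} := lext (Dw a b).

Lemma wd_cons z u : wd (z :: u) = lt z * wd u. Proof. exact: (wd_cat F [:: z]). Qed.

Lemma D_wd a b u : D a b (wd u) = Dw a b u. Proof. exact: lext_wd. Qed.
Lemma D_nil a b : D a b (wd [::]) = 0. Proof. exact: lext_wd. Qed.
Lemma D_lt a b z : D a b (lt z) = act a b z.
Proof. by rewrite D_wd /= wd_nil mulr1 mulr0 addr0. Qed.

Lemma mull_linear (A : algType F) (x : A) : linear (fun y => x * y).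
Proof. by move=> a y z; rewrite mulrDr scalerAr. Qed.
Lemma mulr_linear (A : algType F) (x : A) : linear (fun y => y * x).
Proof. by move=> a y z; rewrite mulrDl scalerAl. Qed.
Lemma lin_comp (M N P : lmodType F) (f : N -> P) (g : M -> N) :
  linear f -> linear g -> linear (fun x => f (g x)).
Proof. by move=> fl gl a x y; rewrite gl fl. Qed.
Lemma lin_add (M N : lmodType F) (f g : M -> N) :
  linear f -> linear g -> linear (fun x => f x + g x).
Proof. by move=> fl gl a x y; rewrite gl fl scalerDr addrACA. Qed.

Lemma D_mul a b s t : D a b (s * t) = D a b s * t + s * D a b t.
Proof.
revert s t; refine (@tens_ind F _ _ _).
  split; first by move=> t; rewrite !(mul0r, raddf0) addr0.
  move=> c x y hx hy t; rewrite mulrDl !linearD /= -scalerAl !linearZ /= hx hy.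
  by rewrite !mulrDl -!scalerAl scalerDr addrACA.
move=> u; refine (@tens_ind F _ _ _).
  apply: (@subsp_eq _ _ _ (fun t => D a b (wd u * t))).
    by apply: (lin_comp (f := D a b)); [exact: linearP|exact: mull_linear].
  apply: lin_add; first exact: mull_linear.
  apply: (lin_comp (g := D a b)); [exact: mull_linear|exact: linearP].
move=> v; rewrite -wd_cat; elim: u => [|z u IH] /=.
  by rewrite D_nil wd_nil mul0r add0r mul1r.
rewrite !D_wd /= -!D_wd IH wd_cat [wd (z :: u)]wd_cons.
by rewrite [in RHS]mulrDl mulrDr !mulrA addrA.
Qed.

Lemma D_cons a b z t : D a b (lt z * t) = act a b z * t + lt z * D a b t.
Proof. by rewrite D_mul D_lt. Qed.

Lemma actE a b z : act a b z = om b z *: lt a - (e * om a z) *: lt b.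
Proof. by []. Qed.
Lemma DZ a b k t : D a b (k *: t) = k *: D a b t. Proof. exact: linearZ_LR. Qed.
Lemma DD a b s t : D a b (s + t) = D a b s + D a b t. Proof. exact: linearD. Qed.
Lemma DN a b t : D a b (- t) = - D a b t. Proof. exact: linearN. Qed.
Lemma DB a b s t : D a b (s - t) = D a b s - D a b t. Proof. exact: linearB. Qed.
#[local] Opaque act.

Fixpoint Rw (c i : nat) (u : seq nat) : tens :=
  match u, i with
  | [::], _ => 0
  | x :: u', 0 => om c x *: wd u'
  | x :: u', i'.+1 => lt x * Rw c i' u'
  end.
Definition R c i : {linear tens -> tens} := lext (Rw c i).

Lemma R_nil c i : R c i (wd [::]) = 0. Proof. by rewrite /R lext_wd; case: i. Qed.

Lemma R0_cons c x t : R c 0 (lt x * t) = om c x *: t.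
Proof.
revert t; refine (@tens_ind F _ _ _) => [|u].
  apply: (@subsp_eq _ _ _ (fun t => R c 0 (lt x * t))).
    by apply: (lin_comp (f := R c 0)); [exact: linearP|exact: mull_linear].
  by move=> a y z; rewrite scalerDr !scalerA mulrC.
by rewrite -wd_cons /R lext_wd.
Qed.

Lemma RS_cons c i x t : R c i.+1 (lt x * t) = lt x * R c i t.
Proof.
revert t; refine (@tens_ind F _ _ _) => [|u].
  apply: (@subsp_eq _ _ _ (fun t => R c i.+1 (lt x * t)) (fun t => lt x * R c i t)).
    by apply: (lin_comp (f := R c i.+1)); [exact: linearP|exact: mull_linear].
  by apply: (lin_comp (g := R c i)); [exact: mull_linear|exact: linearP].
by rewrite -wd_cons /R !lext_wd.
Qed.

(* The contraction with c anticommutes with the action up to acting on c. *)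
Lemma R_D a b c i t :
  R c i (D a b t) = D a b (R c i t) - (om b c *: R a i t - (e * om a c) *: R b i t).
Proof.
revert t; refine (@tens_ind F _ _ _) => [|u].
  apply: (@subsp_eq _ _ _ (fun t => R c i (D a b t))).
    by apply: (lin_comp (f := R c i)); exact: linearP.
  move=> k x y; rewrite !linearP /=; apply: tens_eqP => w.
  by rewrite !coefwE; ring.
elim: u i => [|x u IH] i.
  by rewrite D_nil !R_nil !linear0 addr0 subr0.
rewrite wd_cons D_cons; case: i => [|i].
  rewrite raddfD /= actE mulrBl -!scalerAl raddfB /= !linearZ /= !R0_cons !linearZ /=.
  apply: tens_eqP => w.
  by rewrite !coefwE (om_sym c b) (om_sym c a); ring: ee.
rewrite raddfD /= actE mulrBl -!scalerAl raddfB /= !linearZ /= !RS_cons IH D_cons actE.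
rewrite mulrBl !mulrBr -!scalerAl -!scalerAr.
apply: tens_eqP => w.
by rewrite !coefwE; ring.
Qed.

Lemma D_act a b c d z :
  D a b (act c d z) = om d z *: act a b c - (e * om c z) *: act a b d.
Proof. by rewrite actE DB !DZ !D_lt. Qed.

(** Both sides are derivations of the free algebra, so letters decide. The right-hand side is [D] at
    the bracket of E_ab and E_cd, which makes [D] a representation. *)
Lemma D_comm a b c d t : D a b (D c d t) - D c d (D a b t) =
  om b c *: D a d t - (e * om a c) *: D b d t
  + (om b d *: D c a t - (e * om a d) *: D c b t).
Proof.
revert t; refine (@tens_ind F _ _ _) => [|u].
  apply: (@subsp_eq _ _ _ (fun t => D a b (D c d t) - D c d (D a b t))) => k x y.
    by rewrite !linearP /=; apply: tens_eqP => w; rewrite !coefwE; ring.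
  by rewrite !linearP /=; apply: tens_eqP => w; rewrite !coefwE; ring.
elim: u => [|z u IH]; first by rewrite !(D_nil, linear0) ?(addr0, subr0).
rewrite wd_cons !D_cons ![D _ _ (_ + _)]linearD /= !D_cons !D_mul !D_act.
set x := D a b (wd u); set y := D c d (wd u).
have -> : D a b y = D c d x + (om b c *: D a d (wd u) - (e * om a c) *: D b d (wd u)
  + (om b d *: D c a (wd u) - (e * om a d) *: D c b (wd u))).
  by rewrite -IH addrC subrK.
rewrite !mulrDr !mulrN actE !mulrBl -!scalerAl -!scalerAr !mulrBl -!scalerAl.
apply: tens_eqP => w; rewrite !coefwE.
have := (om_sym c b, om_sym d b, om_sym c a, om_sym d a) => -[[[-> ->] ->] ->].
by ring: ee.
Qed.

End Form.
#[global] Opaque act D R.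

(** * Contractions and invariants *)

Section Eval.
Variables (F : fieldType) (e : F).
Hypothesis ee : e * e = 1.
Local Notation tens := (tens F).
Local Notation lt a := (@wd F [:: (a : nat)]).
Local Notation om := (om e).
Local Notation D := (D e).
Local Notation R := (R e).

(** The words v that can occur in [D a b (wd u)], without their coefficients ([D_combo]); this is
    enough wherever letters are only counted. *)
Definition Dspec a b (u v : seq nat) : Prop := exists u1 u2 z, u = u1 ++ z :: u2 /\
  ((z = prt b /\ v = u1 ++ a :: u2) \/ (z = prt a /\ v = u1 ++ b :: u2)).

Lemma combo_mull z (P Q : seq nat -> Prop) t : (forall u, P u -> Q (z :: u)) ->
  combo P t -> combo Q (lt z * t).
Proof.
move=> h; apply: (combo_lin (fun x => lt z * x) (combo Q) (mull_linear _) combo_subsp) => u Pu.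
by rewrite -wd_cons; apply: combo_wd; apply: h.
Qed.

Lemma om_case a b : om a b = 0 \/ b = prt a.
Proof. by rewrite /om; case: eqP; [right|left]. Qed.

Lemma D_combo a b u : combo (Dspec a b u) (D a b (wd u)).
Proof.
have hS P := @combo_subsp F P.
elim: u => [|z u IH]; first by rewrite D_nil; apply: subsp0.
rewrite wd_cons D_cons; apply: subspD => //.
  rewrite actE mulrBl -!scalerAl -!wd_cons; apply: subspB => //.
    have [->|zE] := om_case b z; first by rewrite scale0r; apply: subsp0.
    apply: subspZ => //; apply: combo_wd.
    by exists [::], u, z; split=> //; left.
  have [->|zE] := om_case a z; first by rewrite mulr0 scale0r; apply: subsp0.
  apply: subspZ => //; apply: combo_wd.
  by exists [::], u, z; split=> //; right.
apply: combo_mull IH => v [u1 [u2 [y [-> h]]]].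
by exists (z :: u1), u2, y; split=> //; case: h => -[-> ->]; [left|right].
Qed.

Lemma Dspec_size a b u v : Dspec a b u v -> size v = size u.
Proof. by move=> [u1 [u2 [z [-> [[_ ->]|[_ ->]]]]]]; rewrite !size_cat. Qed.

Definition rmn i (u : seq nat) := take i u ++ drop i.+1 u.
#[global] Arguments rmn : simpl never.

Lemma size_rmn i u : (i < size u)%N -> size (rmn i u) = (size u).-1.
Proof. by move=> iu; rewrite size_cat size_take iu size_drop; lia. Qed.

Lemma R_wd c i u : R c i (wd u) =
  if (i < size u)%N then om c (nth 0%N u i) *: wd (rmn i u) else 0.
Proof.
elim: u i => [|x u IH] [|i]; rewrite ?R_nil // wd_cons ?R0_cons ?RS_cons ?IH //=.
  by rewrite /rmn /= drop0.
rewrite ltnS; case: ifP => _; last by rewrite mulr0.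
by rewrite -scalerAr -wd_cons.
Qed.

(* [ev u] is the sum over the perfect matchings of the positions of [u] of the
   product of the values of [om] on matched letters.  A matching is recorded as
   a word too: the first position is matched with the [i]-th of the remaining
   ones, [i] is put down, both are removed, and so on.  The argument [n] is fuel. *)
Fixpoint evr n (u : seq nat) : tens :=
  match u, n with
  | [::], _ => 1
  | a :: v, n'.+1 => \sum_(i < size v) lt i * (om a (nth 0%N v i) *: evr n' (rmn i v))
  | _, _ => 0
  end.

Definition ev : {linear tens -> tens} := lext (fun u => evr (size u) u).

Lemma evr_size n u : (size u <= n)%N -> evr n u = ev (wd u).
Proof.
move=> un; rewrite /ev lext_wd; have := leqnn (size u); move: {-1}(size u) => m.
move: un; elim: m n u => [|m IH] [|n] [|a u] //= un um.
apply: eq_bigr => i _; congr (_ * (_ *: _)); apply: IH; rewrite size_rmn //; lia.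
Qed.

Lemma ev_nil : ev (wd [::]) = 1. Proof. by rewrite /ev lext_wd. Qed.

Lemma ev_cons0 a u : ev (lt a * wd u) = \sum_(i < size u) lt i * ev (R a i (wd u)).
Proof.
rewrite -wd_cons -[LHS](@evr_size (size u).+1) //=.
apply: eq_bigr => i _; rewrite R_wd ltn_ord linearZ /=; congr (_ * (_ *: _)).
by apply: evr_size; rewrite size_rmn // leq_pred.
Qed.

Lemma ev_cons n a t : combo (fun u => (size u <= n)%N) t ->
  ev (lt a * t) = \sum_(i < n) lt i * ev (R a i t).
Proof.
apply: (combo_ind (fun t => ev (lt a * t) = \sum_(i < n) lt i * ev (R a i t))).
  apply: (subsp_eq (f := fun t => ev (lt a * t))); first by apply: (lin_comp (f := ev)); [exact: linearP|exact: mull_linear].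
  move=> k x y; rewrite scaler_sumr -big_split; apply: eq_bigr => i _.
  by rewrite !linearP /= mulrDr scalerAr.
move=> u un; rewrite ev_cons0.
rewrite (big_ord_widen n (fun i => lt i * ev (R a i (wd u))) un) big_mkcond /=.
by apply: eq_bigr => i _; case: ifP => // ui; rewrite R_wd ui linear0 mulr0.
Qed.

Lemma D_size n a b t : combo (fun u => (size u <= n)%N) t ->
  combo (fun u => (size u <= n)%N) (D a b t).
Proof.
apply: (combo_lin (D a b) (combo _)); [exact: linearP|exact: combo_subsp|] => u un.
by apply: combo_sub (D_combo a b u) => v /Dspec_size ->.
Qed.

(** Expanding along the first letter c, [R_D] moves the action past the contraction: what acts on
    the contracted word vanishes by induction, and the correction terms cancel the action on c. *)
Lemma ev_D a b t : ev (D a b t) = 0.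
Proof.
revert t; refine (@tens_ind F _ _ _) => [|u].
  apply: (subsp_pre (S := fun x => x = 0) (f := fun x => ev (D a b x))).
    by apply: lin_comp; exact: linearP.
  exact: subsp_zero.
have [n un] := ubnP (size u); elim: n u un => // n IH [|c u] un.
  by rewrite D_nil linear0.
rewrite wd_cons D_cons linearD /= actE mulrBl -!scalerAl.
have uc : combo (fun v => (size v <= size u)%N) (@wd F u).
  by apply: combo_wd.
rewrite linearB /= !linearZ /= !(ev_cons _ uc) (ev_cons _ (D_size _ _ uc)).
rewrite scalerN !scaler_sumr -sumrB -big_split big1 //= => i _.
rewrite R_D // linearB /= linearB /= !linearZ /=.
have -> : ev (D a b (R c i (wd u))) = 0.
  rewrite R_wd ltn_ord !linearZ /= IH ?scaler0 // size_rmn //; have := ltn_ord i.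
  by move: un => /=; lia.
by rewrite sub0r !scalerN mulrN mulrBr -!scalerAr subrr.
Qed.

Lemma ev_Dmul a b s t : ev (s * D a b t) = - ev (D a b s * t).
Proof.
by apply/eqP; rewrite -addr_eq0 addrC -linearD -D_mul ev_D.
Qed.

End Eval.
#[global] Opaque ev.

Section Fresh.
Variables (F : fieldType) (e : F).
Hypothesis ee : e * e = 1.
Local Notation tens := (tens F).
Local Notation lt a := (@wd F [:: (a : nat)]).
Local Notation om := (om e).
Local Notation D := (D e).
Local Notation act := (act e).
Local Notation ev := (ev e).

Definition ins i (y : nat) (v : seq nat) := take i v ++ y :: drop i v.
#[global] Arguments ins : simpl never.

Definition below (K : nat) (u : seq nat) : bool := all (fun z => z < K)%N u.

Lemma sub_below K L u : (K <= L)%N -> below K u -> below L u.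
Proof. by move=> KL; apply: sub_all => z /leq_trans; apply. Qed.

Lemma below_rmn K i u : below K u -> below K (rmn i u).
Proof.
move=> h; rewrite /below all_cat; apply/andP; split.
  by apply/allP => z /mem_take; apply: (allP h).
by apply/allP => z /mem_drop; apply: (allP h).
Qed.

Lemma below_ins K i y u : (y < K)%N -> below K u -> below K (ins i y u).
Proof.
move=> yK h; rewrite /below all_cat /= yK /=; apply/andP; split.
  by apply/allP => z /mem_take; apply: (allP h).
by apply/allP => z /mem_drop; apply: (allP h).
Qed.

Lemma size_ins i y u : size (ins i y u) = (size u).+1.
Proof. by rewrite size_cat /= addnS -size_cat cat_take_drop. Qed.

Lemma uniq_ins i y u : uniq (ins i y u) = (y \notin u) && uniq u.
Proof.
by rewrite /ins -(cat1s y) uniq_catCA cat_take_drop cat1s.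
Qed.

Lemma mem_ins i y u z : (z \in ins i y u) = (z == y) || (z \in u).
Proof. by rewrite /ins mem_cat inE orbCA -mem_cat cat_take_drop. Qed.

Lemma mem_below K u z : below K u -> (K <= z)%N -> z \notin u.
Proof. by move=> h Kz; apply/negP => /(allP h); rewrite ltnNge Kz. Qed.

Lemma act_prt a b z : om b z = 0 -> om a z = 0 -> act a b z = 0.
Proof. by rewrite actE => -> ->; rewrite mulr0 !scale0r subrr. Qed.

Lemma D_fresh a y u : prt y \notin u ->
  D a y (wd u) = - (e *: \sum_(i < size u) om a (nth 0%N u i) *: wd (ins i y (rmn i u))).
Proof.
elim: u => [|x u IH]; first by rewrite D_nil big_ord0 scaler0 oppr0.
rewrite inE negb_or => /andP[xy yu].
rewrite wd_cons D_cons IH // big_ord_recl /= actE (@om_neq0 _ _ y x) 1?eq_sym //.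
rewrite scale0r sub0r mulNr -scalerAl -wd_cons mulrN -opprD; congr (- _).
rewrite scalerDr scalerA; congr (_ *: _ + _).
  by rewrite /rmn /ins /= take0 drop0 drop0.
rewrite -scalerAr mulr_sumr; congr (_ *: _); apply: eq_bigr => i _.
by rewrite -scalerAr -wd_cons.
Qed.

(** [D a Y.+1] applied to Y u gives e a u from the letter Y, and otherwise replaces a partner of a
    in u by Y.+1. So modulo the image of the action, a and a letter contracted with it are traded
    for the hyperbolic pair Y, Y.+1. *)
Lemma fresh_step a Y u : ~~ odd Y -> Y \notin u -> a != Y.+1 ->
  wd (a :: u) = e *: D a Y.+1 (wd (Y :: u)) +
    \sum_(i < size u) om a (nth 0%N u i) *: wd (Y :: ins i Y.+1 (rmn i u)).
Proof.
move=> oY Yu aY; have pY : prt Y.+1 = Y by rewrite /prt /= oY.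
have pY' : prt Y = Y.+1 by rewrite /prt (negbTE oY).
rewrite (wd_cons F Y) D_cons D_fresh ?pY // actE (@om_neq0 _ _ a Y); last first.
  by apply: contra_neq aY => E; rewrite -pY' E prtK.
rewrite mulr0 scale0r subr0 /om pY eqxx /= oY -scalerAl -wd_cons.
rewrite mulrN -scalerAr scalerBr !scalerA ee !scale1r mulr_sumr.
rewrite -addrA; rewrite addrC -sumrN -big_split big1 ?add0r //= => i _.
by rewrite -scalerAr -wd_cons addNr.
Qed.

Definition insY Y i : {linear tens -> tens} := lext (fun v => wd (Y :: ins i Y.+1 v)).

Lemma insY_wd Y i v : insY Y i (wd v) = wd (Y :: ins i Y.+1 v).
Proof. exact: lext_wd. Qed.

Lemma insY_mul Y i s t : combo (fun u => size u = i) s ->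
  insY Y i (s * t) = lt Y * (s * (lt Y.+1 * t)).
Proof.
move=> hs; revert t; refine (@tens_ind F _ _ _) => [|u].
  apply: (@subsp_eq _ _ _ (fun t => insY Y i (s * t))).
    by apply: (lin_comp (f := insY Y i)); [exact: linearP|exact: mull_linear].
  apply: lin_comp; first exact: mull_linear.
  by apply: lin_comp; exact: mull_linear.
move: s hs; apply: (combo_ind (fun s => insY Y i (s * wd u) = _)).
  apply: (@subsp_eq _ _ _ (fun s => insY Y i (s * wd u))).
    by apply: (lin_comp (f := insY Y i)); [exact: linearP|exact: mulr_linear].
  apply: (lin_comp (g := fun s => s * _)); first exact: mull_linear.
  exact: mulr_linear.
move=> v <-; rewrite -wd_cat insY_wd /ins take_size_cat // drop_size_cat //.
by rewrite wd_cons wd_cat [wd (_ :: u)]wd_cons.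
Qed.

Lemma D_size_eq n a b t : combo (fun u => size u = n) t ->
  combo (fun u => size u = n) (D a b t).
Proof.
apply: (combo_lin (D a b) (combo _)); [exact: linearP|exact: combo_subsp|] => u un.
by apply: combo_sub (D_combo e a b u) => v /Dspec_size ->.
Qed.

Lemma act_far a b K z : ~~ odd K -> (a < K)%N -> (b < K)%N -> (K <= z)%N -> act a b z = 0.
Proof.
move=> oK aK bK Kz; apply: act_prt; apply: om_neq0; apply/eqP => zE.
  by have := prt_lt oK bK; lia.
by have := prt_lt oK aK; lia.
Qed.

Lemma D_insY Y i a b v : ~~ odd Y -> (a < Y)%N -> (b < Y)%N -> (i <= size v)%N ->
  insY Y i (D a b (wd v)) = D a b (wd (Y :: ins i Y.+1 v)).
Proof.
move=> oY aY bY iv; rewrite wd_cons D_cons (act_far oY aY bY (leqnn _)) mul0r add0r.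
rewrite /ins wd_cat D_mul [wd (Y.+1 :: _)]wd_cons D_cons (act_far oY aY bY (leqnSn _)).
rewrite mul0r add0r -[in LHS](cat_take_drop i v) wd_cat D_mul raddfD /= mulrDr.
have st : combo (fun u => size u = i) (@wd F (take i v)).
  by apply: combo_wd; rewrite size_take_min (minn_idPl iv).
by rewrite !insY_mul //; apply: D_size_eq.
Qed.

Section Invariant.
Variable M : lmodType F.
Implicit Type G : tens -> M.

(** [fresh_step] trades the first letter and its partner for a fresh pair; the induction goes on
    with the remaining letters, for the functional that first inserts this pair. By [D_insY] this
    functional still satisfies the hypothesis on the action of the letters below the pair. The bound
    on K provides enough pairs above the letters of u. *)
Lemma invariant_uniq (S : M -> Prop) G n K k : subsp S -> linear G ->
  ~~ odd K -> (k + n.*2 <= K)%N ->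
  (forall a b u, (a < K)%N -> (b < K)%N -> below K u -> size u = n -> S (G (D a b (wd u)))) ->
  (forall u, below K u -> uniq u -> size u = n -> S (G (wd u))) ->
  forall u, below k u -> size u = n -> S (G (wd u)).
Proof.
move=> hS; elim/ltn_ind: n G K => n IH G K Gl oK kK GD Gu [|a u] /= hu un.
  by apply: Gu.
case: n un kK GD Gu IH => // n [un] kK GD Gu IH.
have [ak uk] := andP hu.
(* K is even, so K-2 and K-1 form a hyperbolic pair; it is used up here, and the induction continues
   below it. *)
have [Y KY] : {Y | K = Y.+2} by exists K.-2; lia.
have oY : ~~ odd Y by move: oK; rewrite KY /= negbK.
have kY : (k + n.*2 <= Y)%N by lia.
have Gsum I (r : seq I) f : G (\sum_(i <- r) f i) = \sum_(i <- r) G (f i).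
  have G0 : G 0 = 0 by have := Gl (-1) 0 0; rewrite scaler0 addr0 => ->; rewrite scaleN1r addNr.
  apply: (big_morph G) => // x y; by rewrite -[x]scale1r Gl !scale1r.
have GZ c x : G (c *: x) = c *: G x.
  have G0 : G 0 = 0 by have := Gl (-1) 0 0; rewrite scaler0 addr0 => ->; rewrite scaleN1r addNr.
  by rewrite -[c *: x]addr0 Gl G0 addr0.
rewrite (@fresh_step a Y u oY) ?(mem_below uk) //; try lia.
rewrite Gl; apply: hS.2.
  apply: GD; rewrite ?KY //=; try lia.
  rewrite leqnSn /=; apply: sub_below uk; lia.
rewrite Gsum; apply: subsp_sum => // i _; rewrite GZ; apply: subspZ => //.
have iu : (i < n)%N by rewrite -un ltn_ord.
rewrite -insY_wd; apply: (IH n.-1 _ (fun t => G (insY Y i t)) Y) => //; try lia.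
- by apply: lin_comp => //; exact: linearP.
- move=> a' b' v a'Y b'Y vY vn; rewrite D_insY //; last by move: iu; rewrite vn; case: (n).
  apply: GD; rewrite /= ?size_ins ?KY; try lia.
  by rewrite leqnSn /=; apply: below_ins => //; apply: sub_below vY; lia.
- move=> v vY uv vn; rewrite insY_wd; apply: Gu; last by rewrite /= size_ins; lia.
    by rewrite /= KY leqnSn /=; apply: below_ins => //; apply: sub_below vY; lia.
  rewrite /= uniq_ins uv andbT mem_ins negb_or neq_ltn ltnSn /=.
  by rewrite !(mem_below vY).
- exact: below_rmn.
- by rewrite size_rmn ?un.
Qed.

(** The value of G on the multilinear word in which the positions matched by m carry the hyperbolic
    pairs K-2, K-1, then K-4, K-3, and so on. *)
Fixpoint code_val K G (m : seq nat) : M :=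
  if m is i :: m' then code_val K.-2 (fun t => G (insY K.-2 i t)) m' else G 1.

Lemma code_val_cons Y G i t :
  lext (code_val Y.+2 G) (lt i * t) = lext (code_val Y (fun t => G (insY Y i t))) t.
Proof.
revert t; refine (@tens_ind F _ _ _) => [|u]; last by rewrite -wd_cons !lext_wd.
apply: (@subsp_eq _ _ _ (fun t => lext _ (lt i * t))); last exact: linearP.
by apply: (lin_comp (f := lext _)); [exact: linearP|exact: mull_linear].
Qed.

(* First fundamental theorem: away from the letters it uses up, an invariant
   functional factors through [ev]. *)
Lemma invariant_ev G n K k : linear G -> ~~ odd K -> (k + n.*2 <= K)%N ->
  (forall a b u, (a < K)%N -> (b < K)%N -> below K u -> size u = n -> G (D a b (wd u)) = 0) ->
  forall u, below k u -> size u = n -> G (wd u) = lext (code_val K G) (ev (wd u)).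
Proof.
elim/ltn_ind: n G K => n IH G K Gl oK kK GD [|a u] /= hu un.
  by rewrite ev_nil -wd_nil lext_wd /= wd_nil.
case: n un kK GD IH => // n [un] kK GD IH.
have [ak uk] := andP hu.
have [Y KY] : {Y | K = Y.+2} by exists K.-2; lia.
have oY : ~~ odd Y by move: oK; rewrite KY /= negbK.
have kY : (k + n.*2 <= Y)%N by lia.
have G0 : G 0 = 0.
  by have := Gl (-1) 0 0; rewrite scaler0 addr0 => ->; rewrite scaleN1r addNr.
have Gsum I (r : seq I) f : G (\sum_(i <- r) f i) = \sum_(i <- r) G (f i).
  by apply: (big_morph G) => // x y; rewrite -[x]scale1r Gl !scale1r.
have GZ c x : G (c *: x) = c *: G x by rewrite -[c *: x]addr0 Gl G0 addr0.
rewrite [in LHS](@fresh_step a Y u oY) ?(mem_below uk) //; try lia.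
rewrite Gl GD ?KY ?scaler0 ?add0r; try lia; first last.
- by rewrite /= un.
- rewrite /= leqnSn /=; apply: sub_below uk; lia.
rewrite Gsum [wd (a :: u)]wd_cons ev_cons0 // raddf_sum; apply: eq_bigr => i _.
have iu : (i < n)%N by rewrite -un ltn_ord.
rewrite GZ /= code_val_cons R_wd ltn_ord !linearZ /=; congr (_ *: _).
rewrite -insY_wd; apply: (IH n.-1 _ (fun t => G (insY Y i t)) Y) => //; try lia.
- by apply: lin_comp => //; exact: linearP.
- move=> a' b' v a'Y b'Y vY vn.
  rewrite D_insY //; last by move: iu; rewrite vn; case: (n).
  apply: GD; rewrite /= ?size_ins ?KY; try lia.
  by rewrite leqnSn /=; apply: below_ins => //; apply: sub_below vY; lia.
- exact: below_rmn.
- by rewrite size_rmn ?un.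
Qed.

End Invariant.
End Fresh.

(** * Comparing the two forms on multilinear words *)

Section Inversions.

Definition nbelow (a : nat) (u : seq nat) := count (fun z => z < a)%N u.

#[global] Arguments nbelow : simpl never.

Fixpoint ninv (u : seq nat) : nat := if u is a :: v then (nbelow a v + ninv v)%N else 0%N.

Lemma nbelow_cat a u v : nbelow a (u ++ v) = (nbelow a u + nbelow a v)%N.
Proof. exact: count_cat. Qed.

Lemma nbelow_cons a x u : nbelow a (x :: u) = ((x < a) + nbelow a u)%N. Proof. by []. Qed.

(** The letters of u above b number |u| less those below b, so modulo 2 the inversions of b against
    u and against v add up to |u| + [nbelow b (u ++ v)]. *)
Lemma ninv_mid u b v : b \notin u ->
  odd (ninv (u ++ b :: v)) = odd (size u + nbelow b (u ++ v) + ninv (u ++ v)).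
Proof.
elim: u => [|c u IH] /=; first by rewrite add0n.
rewrite inE negb_or => /andP[bc bu].
rewrite !nbelow_cat !nbelow_cons !oddD IH // !oddD !nbelow_cat !oddD !oddb.
have -> : (b < c)%N = ~~ (c < b)%N by lia.
case: (odd (nbelow c u)); case: (odd (nbelow c v)); case: (odd (nbelow b u));
case: (odd (nbelow b v)); case: (odd (size u)); case: (odd (ninv _)); by case: (c < b)%N.
Qed.

Lemma ninv_cat y u : odd (ninv (y ++ u)) =
  odd (ninv y + ninv u + sumn [seq nbelow b u | b <- y]).
Proof.
elim: y => [|c y IH] /=; first by rewrite add0n addn0.
rewrite nbelow_cat !oddD IH !oddD.
by case: (odd (nbelow c y)); case: (odd (nbelow c u)); case: (odd (ninv y));
  case: (odd (ninv u)); case: (odd (sumn _)).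
Qed.

Lemma nbelow_prt a u : a \notin u -> prt a \notin u -> nbelow (prt a) u = nbelow a u.
Proof.
move=> au pu; apply: eq_in_count => z zu.
have za : z != a by apply: contraNneq au => <-.
have zp : z != prt a by apply: contraNneq pu => <-.
by move: za zp; rewrite /prt; case: ifP; lia.
Qed.

Lemma rmn_cat i u : (i < size u)%N -> take i u ++ nth 0%N u i :: drop i.+1 u = u.
Proof. by move=> iu; rewrite -drop_nth // cat_take_drop. Qed.

Lemma uniq_mid (T : eqType) (u v : seq T) b : uniq (u ++ b :: v) = (b \notin u ++ v) && uniq (u ++ v).
Proof. by rewrite -(cat1s b) uniq_catCA. Qed.

End Inversions.

Section Twist.
Variables (F : fieldType).
Local Notation tens := (tens F).
Local Notation lt a := (@wd F [:: (a : nat)]).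

Definition sgn (u : seq nat) : F := (-1) ^+ ninv u.
(* [tw] is applied to matchings, [theta] to words of letters. *)
Definition tw : {linear tens -> tens} := lext (fun m => (-1) ^+ sumn m *: wd m).
Definition theta : {linear tens -> tens} := lext (fun u => sgn u *: wd u).

Lemma sign_eq m n : odd m = odd n -> (-1) ^+ m = (-1) ^+ n :> F.
Proof. by move=> h; rewrite -signr_odd h signr_odd. Qed.

Lemma sgnK u : sgn u * sgn u = 1.
Proof. by rewrite -expr2 sqrr_sign. Qed.

Lemma tw_cons i t : tw (lt i * t) = (-1) ^+ i *: (lt i * tw t).
Proof.
revert t; refine (@tens_ind F _ _ _) => [|u].
  apply: (@subsp_eq _ _ _ (fun t => tw (lt i * t))).
    by apply: (lin_comp (f := tw)); [exact: linearP|exact: mull_linear].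
  move=> a x y; rewrite linearP /= mulrDr scalerDr; congr (_ + _).
  by rewrite -scalerAr !scalerA mulrC.
rewrite -wd_cons !lext_wd /= exprD -scalerA; congr (_ *: _).
by rewrite -scalerAr -wd_cons.
Qed.

Lemma twK t : tw (tw t) = t.
Proof.
revert t; refine (@tens_ind F _ _ _) => [|u].
  by apply: subsp_eq; last by []; apply: (lin_comp (f := tw)); exact: linearP.
by rewrite lext_wd linearZ /= lext_wd scalerA -expr2 sqrr_sign scale1r.
Qed.

Lemma theta_wd u : theta (wd u) = sgn u *: wd u. Proof. exact: lext_wd. Qed.

Variable e : F.
Hypothesis ee : e * e = 1.

Lemma om_opp a b : om (- e) a b = (-1) ^+ odd a * om e a b.
Proof.
by rewrite /om; case: ifP => _; rewrite ?mulr0 //; case: (odd a); rewrite ?mulN1r ?mul1r.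
Qed.

Lemma ee' : - e * - e = 1. Proof. by rewrite mulrNN. Qed.

(** Partners are consecutive numbers, so any other letter is below both or above both: it forms one
    inversion with the pair if it lies between them, and none or two otherwise. The pair itself is
    inverted when a is odd. The first factor is the sign of the index recorded in the matching, the
    second is the ratio of the two forms ([om_opp]). *)
Lemma sgn_contract a u v : uniq (a :: u ++ prt a :: v) ->
  sgn (a :: u ++ prt a :: v) = (-1) ^+ size u * (-1) ^+ odd a * sgn (u ++ v).
Proof.
rewrite /= mem_cat inE uniq_mid orbCA -mem_cat => /and3P[/norP[_ ar] br _].
rewrite /sgn -!exprD; apply: sign_eq; rewrite /= oddD ninv_mid; last first.
  by move: br; rewrite mem_cat => /norP[].
rewrite nbelow_prt // nbelow_cat nbelow_cons addnCA -nbelow_cat.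
have -> : (prt a < a)%N = odd a by rewrite /prt; case: ifP; lia.
rewrite !(oddD _ (nbelow _ _)) !oddD.
by case: (odd (odd a)); case: (odd (size u)); case: (odd (nbelow _ _)); case: (odd (ninv _)).
Qed.

(* The sign of a permutation compares the two forms on multilinear words. *)
Lemma tw_ev u : uniq u -> tw (ev (- e) (wd u)) = sgn u *: ev e (wd u).
Proof.
have [n un] := ubnP (size u); elim: n u un => // n IH [|a v] /= un.
  move=> _; rewrite !ev_nil /sgn /= scale1r -wd_nil /tw lext_wd /= scale1r //.
move=> /andP[av uv]; rewrite wd_cons !ev_cons0 raddf_sum scaler_sumr.
apply: eq_bigr => i _ /=; rewrite tw_cons !R_wd ltn_ord !linearZ /= om_opp.
have [iv E] : (i < size v)%N /\ v = take i v ++ nth 0%N v i :: drop i.+1 v by rewrite rmn_cat.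
rewrite -!scalerAr !scalerA IH; first last.
- by move: uv; rewrite {1}E uniq_mid => /andP[].
- rewrite size_rmn //; apply: leq_ltn_trans (leq_pred _) _; exact: un.
rewrite -scalerAr scalerA; congr (_ *: _).
have [->|bE] := om_case e a (nth 0%N v i); first by rewrite !(mulr0, mul0r).
have -> : sgn (a :: v) = (-1) ^+ i * (-1) ^+ odd a * sgn (rmn i v).
  rewrite {1}E bE sgn_contract; first by rewrite size_take iv.
  by rewrite -bE -E /= av.
by ring.
Qed.

End Twist.

(** * Reduction of equivariant identities to multilinear words *)

Section Equivariant.
Variables (F : fieldType) (e : F).
Hypothesis ee : e * e = 1.
Local Notation tens := (tens F).
Local Notation D := (D e).

Lemma ex_below u : exists K, below K u.
Proof.
elim: u => [|a u [K h]]; first by exists 0%N.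
exists (maxn a.+1 K); rewrite /= leq_maxl /=; apply: sub_below h; exact: leq_maxr.
Qed.

(* Invariant functionals of words with a slot filled by the equivariant map
   [rho] are determined by their values on multilinear words. *)
Lemma equivariant_uniq (M : lmodType F) (S : M -> Prop) (f : tens -> M)
    (rho : seq nat -> tens) l k m : subsp S -> linear f ->
  (forall a b t, f (D a b t) = 0) ->
  (forall a b s, size s = k -> lext rho (D a b (wd s)) = D a b (rho s)) ->
  (forall y s z, uniq (y ++ s ++ z) -> size y = l -> size s = k -> size z = m ->
     S (f (wd y * (rho s * wd z)))) ->
  forall y s z, size y = l -> size s = k -> size z = m -> S (f (wd y * (rho s * wd z))).
Proof.
move=> hS fl fD rD fu y0 s0 z0 y0l s0k z0m.
(* [gam] cuts a word after l and after l + k letters and applies [rho] to the middle piece. It is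
   equivariant on words of length l + k + m, so f after [gam] is an invariant functional of
   words. *)
pose gam (u : seq nat) : tens := wd (take l u) * (rho (take k (drop l u)) * wd (drop k (drop l u))).
have gamE y s z : size y = l -> size s = k -> gam (y ++ s ++ z) = wd y * (rho s * wd z).
  by move=> yl sk; rewrite /gam take_size_cat // drop_size_cat // take_size_cat // drop_size_cat.
have gamM p q r : combo (fun u => size u = l) p -> combo (fun u => size u = k) q ->
    lext gam (p * (q * r)) = p * (lext rho q * r).
  move=> hp hq; revert r; refine (@tens_ind F _ _ _) => [|z].
    apply: (@subsp_eq _ _ _ (fun r => lext gam (p * (q * r)))).
      apply: (lin_comp (f := lext gam)); first exact: linearP.
      by apply: lin_comp; exact: mull_linear.
    by apply: lin_comp; exact: mull_linear.
  move: q hq; apply: (combo_ind (fun q => lext gam (p * (q * _)) = p * (lext rho q * _))).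
    apply: (@subsp_eq _ _ _ (fun q => lext gam (p * (q * _)))).
      apply: (lin_comp (f := lext gam)); first exact: linearP.
      by apply: lin_comp; [exact: mull_linear|exact: mulr_linear].
    apply: (lin_comp (f := fun x => p * x)); first exact: mull_linear.
    by apply: (lin_comp (f := fun x => x * _)); [exact: mulr_linear|exact: linearP].
  move=> s sk; move: p hp; apply: (combo_ind (fun p => lext gam (p * _) = p * _)).
    apply: (@subsp_eq _ _ _ (fun p => lext gam (p * _))); last exact: mulr_linear.
    by apply: (lin_comp (f := lext gam)); [exact: linearP|exact: mulr_linear].
  by move=> y yl; rewrite -!wd_cat !lext_wd gamE.
have gamD a b u : size u = (l + (k + m))%N -> lext gam (D a b (wd u)) = D a b (gam u).
  move=> us; rewrite -[in LHS](cat_take_drop l u) -[in LHS](cat_take_drop k (drop l u)).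
  rewrite !wd_cat !D_mul.
  have hy : combo (fun u => size u = l) (@wd F (take l u)).
    by apply: combo_wd; rewrite size_take_min; apply/minn_idPl; lia.
  have ks : size (take k (drop l u)) = k.
    by rewrite size_take_min size_drop; apply/minn_idPl; lia.
  have hs : combo (fun u => size u = k) (@wd F (take k (drop l u))) by apply: combo_wd.
  rewrite raddfD /= mulrDr raddfD /= !gamM //; try exact: D_size_eq.
  by rewrite !(lext_wd rho) rD // mulrDr.
have [k0 h0] := ex_below (y0 ++ s0 ++ z0).
set n := (l + (k + m))%N.
rewrite -gamE // -(lext_wd gam).
apply: (@invariant_uniq _ _ ee _ S (fun t => f (lext gam t)) n (k0.*2 + n.*2) k0) => //.
- by apply: lin_comp => //; exact: linearP.
- by rewrite oddD !odd_double.
- by rewrite leq_add2r -addnn leq_addr.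
- by move=> a b u _ _ _ un; rewrite gamD // fD; apply: subsp0.
- move=> u _ uu un; rewrite lext_wd -(cat_take_drop l u) -(cat_take_drop k (drop l u)).
  have yl : size (take l u) = l by rewrite size_take_min; apply/minn_idPl; lia.
  have sk : size (take k (drop l u)) = k.
    by rewrite size_take_min size_drop; apply/minn_idPl; lia.
  rewrite gamE //; apply: fu => //; first by rewrite !cat_take_drop.
  by rewrite !size_drop un /n !addKn.
- by rewrite !size_cat y0l s0k z0m.
Qed.

(* The commutation relation of U(g) in terms of words: ad(ab) is [D a b]. *)
Definition rel2 (s : seq nat) : tens :=
  if s is [:: a; b; c; d] then wd [:: a; b; c; d] - wd [:: c; d; a; b] - D a b (wd [:: c; d])
  else 0.
Definition rel1 (s : seq nat) : tens :=
  if s is [:: a; b] then wd [:: a; b] + e *: wd [:: b; a] else 0.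

Lemma D2 a b c d : D a b (wd [:: c; d]) = om e b c *: wd [:: a; d] - (e * om e a c) *: wd [:: b; d]
   + (om e b d *: wd [:: c; a] - (e * om e a d) *: wd [:: c; b]).
Proof.
rewrite (wd_cons F c) D_cons D_lt !actE mulrBl mulrBr -!scalerAl -!scalerAr.
by rewrite -!wd_cat.
Qed.

Lemma D4 a b c d f g : D a b (wd [:: c; d; f; g]) =
   om e b c *: wd [:: a; d; f; g] - (e * om e a c) *: wd [:: b; d; f; g]
   + (om e b d *: wd [:: c; a; f; g] - (e * om e a d) *: wd [:: c; b; f; g])
   + (om e b f *: wd [:: c; d; a; g] - (e * om e a f) *: wd [:: c; d; b; g])
   + (om e b g *: wd [:: c; d; f; a] - (e * om e a g) *: wd [:: c; d; f; b]).
Proof.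
rewrite -[[:: c; d; f; g]]/([:: c; d] ++ [:: f; g]) wd_cat D_mul !D2.
by rewrite !mulrDl !mulrDr !mulNr !mulrN -!scalerAl -!scalerAr -!wd_cat !addrA.
Qed.

Lemma rel1_D a b s : size s = 2%N -> lext rel1 (D a b (wd s)) = D a b (rel1 s).
Proof.
case: s => [|c [|d []]] // _; rewrite /= raddfD /= DZ !D2.
rewrite !lextE /=.
by apply: tens_eqP => w; rewrite !coefwE; ring.
Qed.

Lemma rel2_D x y s : size s = 4%N -> lext rel2 (D x y (wd s)) = D x y (rel2 s).
Proof.
case: s => [|a [|b [|c [|d []]]]] // _; rewrite [in RHS]/rel2 !DB.
have -> : D x y (D a b (wd [:: c; d])) = D a b (D x y (wd [:: c; d])) +
  (om e y a *: D x b (wd [:: c; d]) - (e * om e x a) *: D y b (wd [:: c; d])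
  + (om e y b *: D a x (wd [:: c; d]) - (e * om e x b) *: D a y (wd [:: c; d]))).
  by rewrite -D_comm // addrC subrK.
rewrite !D4 !D2 !(DD, DN, DZ).
rewrite !D2.
rewrite !lextE /=.
rewrite !D2. 
apply: tens_eqP => w. rewrite !coefwE.  ring.
Qed.

End Equivariant.

(** * The transfer of a subspace to the other form *)

Section Transfer.
Variables (F : fieldType).
Local Notation tens := (tens F).

(* The pullbacks of the two-sided ideals of U(g) along the map that sends a word
   a b c d ... to E_ab E_cd ..., and words of odd length to 0. *)
Record good (e : F) (W : tens -> Prop) : Prop := Good {
  good_sub : subsp W;
  good_left : forall a b t, W t -> W (wd [:: a; b] * t);
  good_D : forall a b t, W t -> W (D e a b t);
  good_odd : forall u, odd (size u) -> W (wd u);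
  good_rel1 : forall s z, size s = 2%N -> W (rel1 e s * wd z);
  good_rel2 : forall s z, size s = 4%N -> W (rel2 e s * wd z)
}.

(* The span of the products y w with y a word of length l and w in W. *)
Definition ctx (W : tens -> Prop) l (k : tens) : Prop :=
  exists s : seq (seq nat * tens),
    (forall x, x \in s -> size x.1 = l /\ W x.2) /\ k = \sum_(x <- s) wd x.1 * x.2.

Lemma ctx_subsp W l : subsp W -> subsp (ctx W l).
Proof.
move=> hW; split; first by exists [::]; rewrite big_nil.
move=> a _ _ [s [hs ->]] [s' [hs' ->]].
exists ([seq (x.1, a *: x.2) | x <- s] ++ s'); split.
  move=> x; rewrite mem_cat => /orP[/mapP[y /hs [? ?] ->] /=|/hs'] //.
  by split=> //; apply: subspZ.
rewrite big_cat big_map scaler_sumr; congr (_ + _).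
by apply: eq_bigr => x _; rewrite scalerAr.
Qed.

Lemma ctx_gen W y w : W w -> ctx W (size y) (wd y * w).
Proof.
move=> Ww; exists [:: (y, w)]; split; last by rewrite big_seq1.
by move=> x; rewrite inE => /eqP ->.
Qed.

Lemma ctx_ind (W : tens -> Prop) l (S : tens -> Prop) : subsp S ->
  (forall y w, size y = l -> W w -> S (wd y * w)) -> forall k, ctx W l k -> S k.
Proof.
move=> hS h _ [s [hs ->]]; apply: subsp_sum => // x /hs [sx Wx]; exact: h.
Qed.

Definition evctx e W l (t : tens) := exists2 k, ctx W l k & t = ev e k.

Lemma evctx_subsp e W l : subsp W -> subsp (evctx e W l).
Proof.
move=> hW; have [h0 h] := ctx_subsp l hW.
split; first by exists 0; rewrite ?linear0.
move=> a _ _ [k ck ->] [k' ck' ->]; exists (a *: k + k'); last by rewrite linearP.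
exact: h.
Qed.

Lemma evctx_gen e W y w : W w -> evctx e W (size y) (ev e (wd y * w)).
Proof. by move=> Ww; exists (wd y * w) => //; apply: ctx_gen. Qed.

Lemma ev_ctx_sub e (W : tens -> Prop) l (S : tens -> Prop) : subsp S ->
  (forall y w, size y = l -> W w -> S (ev e (wd y * w))) -> forall t, evctx e W l t -> S t.
Proof.
move=> hS h _ [k ck ->]; move: k ck; apply: (ctx_ind (S := fun k => S (ev e k))) => //.
by apply: subsp_pre => //; exact: linearP.
Qed.

(* By [double_commutant], W consists of the w all of whose contractions
   [ev e (y w)] lie in [evctx e W (size y)]; [Psi e W] is cut out by the same
   spaces for the other form. *)
Definition Psi e (W : tens -> Prop) (w : tens) : Prop :=
  forall y, evctx e W (size y) (tw F (ev (- e) (wd y * w))).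

Lemma twev_linear e y : linear (fun w => tw F (ev e (wd y * w))).
Proof.
apply: (lin_comp (f := tw F)); first exact: linearP.
by apply: (lin_comp (f := ev e)); [exact: linearP|exact: mull_linear].
Qed.

Lemma sgn_cat_swap (y z : seq nat) a b : a != b ->
  sgn F (y ++ a :: b :: z) = - sgn F (y ++ b :: a :: z).
Proof.
move=> ab; rewrite /sgn -[- (_ ^+ _)]mulN1r -exprS; apply: sign_eq.
elim: y => [|c y IH] /=.
  rewrite !nbelow_cons !oddD !oddb.
  have -> : (a < b)%N = ~~ (b < a)%N by move/eqP: ab; lia.
  by case: (b < a)%N; case: (odd (nbelow a z)); case: (odd (nbelow b z)); case: (odd (ninv z)).
rewrite oddD IH /= !nbelow_cat !nbelow_cons !oddD !oddb.
by case: (odd (ninv _)); case: (a < c)%N; case: (b < c)%N; case: (odd (nbelow c y)); case: (odd (nbelow c z)).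
Qed.

Lemma sgn_cat_prt (y z : seq nat) b : b \notin y ++ z -> prt b \notin y ++ z ->
  sgn F (y ++ b :: prt b :: z) = (-1) ^+ odd b * sgn F (y ++ z).
Proof.
rewrite !mem_cat => /norP[by_ bz] /norP[py pz].
rewrite /sgn -!exprD; apply: sign_eq; elim: y by_ py => [|c y IH] /=.
  move=> _ _; rewrite !nbelow_cons nbelow_prt //.
  have -> : (prt b < b)%N = odd b by rewrite /prt; case: ifP; lia.
  by rewrite !oddD !oddb; case: (odd b); case: (odd (nbelow b z)); case: (odd (ninv z)).
rewrite !inE => /norP[bc by_] /norP[pc py].
rewrite oddD IH // !oddD !nbelow_cat !nbelow_cons !oddD !oddb.
have -> : (prt b < c)%N = (b < c)%N by move: bc pc; rewrite /prt; case: ifP; lia.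
by case: (b < c)%N; case: (odd (nbelow c y)); case: (odd (nbelow c z)); case: (odd b); case: (odd (ninv _)).
Qed.

Lemma uniq_midp (y z s s' : seq nat) : perm_eq s s' ->
  uniq (y ++ s ++ z) = uniq (y ++ s' ++ z).
Proof. by move=> p; apply: perm_uniq; rewrite perm_cat2l perm_cat2r. Qed.

Lemma uniq_del2 (y z s : seq nat) b c : uniq (y ++ [:: b, c & s] ++ z) -> uniq (y ++ s ++ z).
Proof. by rewrite /= !uniq_mid => /and3P[]. Qed.

(** The contracted terms of the commutation relation have two letters fewer. Removing adjacent
    partners b, c changes the sign of the word by [(-1) ^+ odd b] ([sgn_cat_prt]), which is also the
    ratio of the two forms on b, c. *)
Lemma om_sgn e (y z : seq nat) a b c d : uniq (y ++ [:: a, b, c, d & z]) ->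
  om (- e) b c * sgn F (y ++ [:: a, d & z]) = om e b c * sgn F (y ++ [:: a, b, c, d & z]).
Proof.
move=> u; rewrite om_opp; have [->|E] := om_case e b c; first by rewrite mulr0 !mul0r.
move: u; rewrite E -[a :: b :: _]cat1s -[a :: d :: _]cat1s !catA => u.
rewrite sgn_cat_prt; [ring| |].
  move: u; rewrite uniq_mid => /andP[+ _]; apply: contra.
  by rewrite !(mem_cat, inE) => /orP[/orP[->|->]|/orP[->|->]]; rewrite ?orbT.
move: u; rewrite -cat_rcons uniq_mid => /andP[+ _]; apply: contra.
by rewrite !(mem_cat, mem_rcons, inE) => /orP[/orP[->|->]|/orP[->|->]]; rewrite ?orbT.
Qed.

Variable e : F.
Hypothesis ee : e * e = 1.
Let ee' := ee' ee.

Lemma Psi_subsp W : subsp W -> subsp (Psi e W).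
Proof.
move=> hW; split.
  by move=> y; rewrite mulr0 !linear0; apply: subsp0; apply: evctx_subsp.
by move=> a w w' Pw Pw' y; rewrite (twev_linear (- e) y); apply: (evctx_subsp _ _ hW).2.
Qed.

(** Integration by parts ([ev_Dmul]) moves the action from w to the test word, whose length it
    keeps. *)
Lemma Psi_D W a b w : subsp W -> Psi e W w -> Psi e W (D (- e) a b w).
Proof.
move=> hW Pw y; rewrite ev_Dmul // raddfN /=; apply: subspN; first exact: evctx_subsp.
have : combo (fun u => size u = size y) (D (- e) a b (@wd F y)).
  by apply: D_size_eq; apply: combo_wd.
apply: (combo_lin (fun t => tw F (ev (- e) (t * w))) (evctx e W (size y))).
- apply: (lin_comp (f := tw F)); first exact: linearP.
  by apply: (lin_comp (f := ev (- e))); [exact: linearP|exact: mulr_linear].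
- exact: evctx_subsp.
- by move=> u <-; apply: Pw.
Qed.

(** The last two letters of a context are absorbed into w by left stability of W. *)
Lemma evctx2 W l t : good e W -> evctx e W l.+2 t -> evctx e W l t.
Proof.
move=> gW; apply: ev_ctx_sub; first by apply: evctx_subsp; exact: good_sub gW.
move=> y w yl Ww.
have yE : y = take l y ++ [:: nth 0%N y l; nth 0%N y l.+1].
  rewrite -[LHS](cat_take_drop l); congr (_ ++ _).
  have : size (drop l y) = 2%N by rewrite size_drop yl; lia.
  have := nth_drop l 0%N y 0; have := nth_drop l 0%N y 1; rewrite addn0 addn1.
  by case: (drop l y) => [|a [|b []]] //= -> ->.
rewrite yE wd_cat -mulrA.
have := evctx_gen e (take l y) (good_left gW (nth 0%N y l) (nth 0%N y l.+1) Ww).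
by have -> : size (take l y) = l by rewrite size_take_min yl; apply/minn_idPl; lia.
Qed.

(** Each family of relations is an equivariant slot, so [equivariant_uniq] leaves only multilinear
    words. There [tw_ev] turns the twisted contraction of a relation for -e into a sign times the
    contraction of the same relation for e: exchanging two letters changes the sign of the word and
    thereby the sign in [rel1], and in [rel2] the contracted terms match by [om_sgn]. *)
Lemma Psi_good W : good e W -> good (- e) (Psi e W).
Proof.
move=> gW; have hW := good_sub gW.
have hS l := evctx_subsp e l hW.
have twl y : linear (fun t => tw F (ev (- e) (wd y * t))) by exact: twev_linear.
have twl0 : linear (fun t => tw F (ev (- e) t)).
  by apply: (lin_comp (f := tw F)); exact: linearP.
have twD a b t : tw F (ev (- e) (D (- e) a b t)) = 0 by rewrite ev_D // linear0.
have tE u : uniq u -> tw F (ev (- e) (wd u)) = sgn F u *: ev e (wd u) by apply: tw_ev.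
split.
- exact: Psi_subsp.
- move=> a b w Pw y; rewrite mulrA -wd_cat; apply: evctx2 => //.
  by have := Pw (y ++ [:: a; b]); rewrite size_cat addn2.
- by move=> a b w Pw; apply: Psi_D.
- move=> u ou y.
  have := @equivariant_uniq _ _ ee' _ _ (fun t => tw F (ev (- e) t)) (fun _ => wd [::])
    (size y) 0 (size u) (hS (size y)) twl0 twD; move/(_ _ _ y [::] u erefl erefl erefl).
  rewrite wd_nil mul1r; apply.
  + by move=> a b [|? ?] // _; rewrite -wd_nil !D_nil linear0.
  + move=> y' [] // z uyz <- _ zu; rewrite mul1r -wd_cat tE //.
    apply: subspZ => //; rewrite wd_cat; apply: evctx_gen.
    by apply: (good_odd gW); rewrite zu.
- move=> s z s2 y.
  apply: (@equivariant_uniq _ _ ee' _ _ (fun t => tw F (ev (- e) t)) (rel1 (- e))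
    (size y) 2 (size z) (hS (size y)) twl0 twD) => //.
  + by move=> a b s' s'2; rewrite rel1_D.
  + move=> y' [|a [|b []]] // z' uyz <- _ _.
    suff -> : tw F (ev (- e) (wd y' * (rel1 (- e) [:: a; b] * wd z'))) =
        sgn F (y' ++ [:: a, b & z']) *: ev e (wd y' * (rel1 e [:: a; b] * wd z')).
      by apply: subspZ => //; apply: evctx_gen; apply: (good_rel1 gW).
    have ab : a != b by move: uyz; rewrite cat_uniq => /and3P[_ _ /= /andP[]]; rewrite inE => /norP[].
    rewrite /rel1 !mulrDl !mulrDr -!scalerAl -!scalerAr -!wd_cat /=.
    rewrite !linearD /= !linearZ /= !tE //; last first.
      have -> // : uniq (y' ++ [:: b; a] ++ z') = uniq (y' ++ [:: a; b] ++ z').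
      by apply: uniq_midp; apply/permP => p /=; lia.
    rewrite (sgn_cat_swap y' z' ab); apply: tens_eqP => w; rewrite !coefwE; ring.
- move=> s z s4 y.
  apply: (@equivariant_uniq _ _ ee' _ _ (fun t => tw F (ev (- e) t)) (rel2 (- e))
    (size y) 4 (size z) (hS (size y)) twl0 twD) => //.
  + by move=> a b s' s'4; rewrite rel2_D.
  + move=> y' [|a [|b [|c [|d []]]]] // z' uyz <- _ _.
    suff -> : tw F (ev (- e) (wd y' * (rel2 (- e) [:: a; b; c; d] * wd z'))) =
        sgn F (y' ++ [:: a, b, c, d & z']) *: ev e (wd y' * (rel2 e [:: a; b; c; d] * wd z')).
      by apply: subspZ => //; apply: evctx_gen; apply: (good_rel2 gW).
    have pu s' : perm_eq s' [:: a; b; c; d] -> uniq (y' ++ s' ++ z').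
      by move=> /uniq_midp ->.
    have ut1 : uniq (y' ++ [:: c; d; a; b] ++ z') by apply: pu; apply/permP => p /=; lia.
    have ut2 : uniq (y' ++ [:: a; d] ++ z').
      by apply: (@uniq_del2 _ _ _ b c); apply: pu; apply/permP => p /=; lia.
    have ut3 : uniq (y' ++ [:: b; d] ++ z').
      by apply: (@uniq_del2 _ _ _ a c); apply: pu; apply/permP => p /=; lia.
    have ut4 : uniq (y' ++ [:: c; a] ++ z').
      by apply: (@uniq_del2 _ _ _ b d); apply: pu; apply/permP => p /=; lia.
    have ut5 : uniq (y' ++ [:: c; b] ++ z').
      by apply: (@uniq_del2 _ _ _ a d); apply: pu; apply/permP => p /=; lia.
    have ub s' : perm_eq s' [:: a; b; c; d] -> uniq s'.
      by move=> /pu; rewrite uniq_catC -catA cat_uniq => /and3P[].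
    have [ab [ac [ad [bc [bd cd]]]]] : a != b /\ (a != c /\ (a != d /\ (b != c /\ (b != d /\ c != d)))).
      have := ub _ (perm_refl _); rewrite /= !inE !negb_or.
      by move=> /and4P[/and3P[-> -> ->] /andP[-> ->] -> _].
    have w a1 a2 a3 a4 : perm_eq [:: a1; a2; a3; a4] [:: a; b; c; d] -> om (- e) a2 a3 * sgn F (y' ++ [:: a1, a4 & z']) = om e a2 a3 * sgn F (y' ++ [:: a1, a2, a3, a4 & z']).
      by move=> /pu; apply: om_sgn.
    set sg := sgn F (y' ++ [:: a, b, c, d & z']).
    have sw x1 x2 x3 x4 : x2 != x3 -> sgn F (y' ++ [:: x1, x2, x3, x4 & z']) = - sgn F (y' ++ [:: x1, x3, x2, x4 & z']).
      by move=> h; have := sgn_cat_swap (rcons y' x1) (x4 :: z') h; rewrite !cat_rcons.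
    have sw' x1 x2 x3 x4 : x3 != x4 -> sgn F (y' ++ [:: x1, x2, x3, x4 & z']) = - sgn F (y' ++ [:: x1, x2, x4, x3 & z']).
      by move=> h; have := sgn_cat_swap (rcons (rcons y' x1) x2) z' h; rewrite !cat_rcons.
    rewrite /rel2 !D2 !(mulrDl, mulNr) !(mulrDr, mulrN) -!scalerAl -!scalerAr -!wd_cat.
    rewrite !(linearD, linearN, linearZ) /= !tE //.
    (* Moving the letters c, d past a, b is an even permutation. *)
    have E0 : sgn F (y' ++ [:: c, d, a, b & z']) = sg.
      have h := sgn_cat_swap.
      rewrite sw 1?eq_sym // (h y' (d :: b :: z') c a) 1?eq_sym // sw' 1?eq_sym //.
      by rewrite sw 1?eq_sym // !opprK.
    have E1 : om (- e) b c * sgn F (y' ++ [:: a, d & z']) = om e b c * sg by apply: w.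
    have E2 : om (- e) a c * sgn F (y' ++ [:: b, d & z']) = - (om e a c * sg).
      rewrite w; last by apply/permP => p /=; lia.
      by rewrite (sgn_cat_swap y' (c :: d :: z')) 1?eq_sym // mulrN.
    have E3 : om (- e) b d * sgn F (y' ++ [:: c, a & z']) = om e b d * sg.
      rewrite (sgn_cat_swap y' z') 1?eq_sym // mulrN w; last by apply/permP => p /=; lia.
      by rewrite sw' 1?eq_sym // mulrN opprK.
    have E4 : om (- e) a d * sgn F (y' ++ [:: c, b & z']) = - (om e a d * sg).
      rewrite (sgn_cat_swap y' z') 1?eq_sym // mulrN w; last by apply/permP => p /=; lia.
      by rewrite (sgn_cat_swap y' (d :: c :: z')) 1?eq_sym // sw' 1?eq_sym // opprK.
    rewrite -/sg E0; apply: tens_eqP => v; rewrite !coefwE.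
    ring: E1 E2 E3 E4.
Qed.

End Transfer.

(** * Recovering a submodule from its contractions *)

Section Averaging.
Variables (F : fieldType) (e : F).
Hypothesis ee : e * e = 1.
Local Notation tens := (tens F).
Local Notation lt a := (@wd F [:: (a : nat)]).
Local Notation D := (D e).
Local Notation om := (om e).

(** An even letter stands for the hyperbolic pair that it begins, so the entries of s stand for
    disjoint pairs of letters not below K. *)
Definition evens K (s : seq nat) : bool := uniq s && all (fun z => ~~ odd z && (K <= z)%N) s.
Definition pairs (s : seq nat) := flatten [seq [:: f; f.+1] | f <- s].
Definition high K (q : seq nat) := [seq z <- q | (K <= z)%N].

Lemma evens_cons K x s : evens K (x :: s) = [&& x \notin s, ~~ odd x, (K <= x)%N & evens K s].
Proof. by rewrite /evens /=; case: (x \in s); case: (odd x); case: (K <= x)%N; case: (uniq s). Qed.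

Lemma evens_cat K s t : evens K (s ++ t) -> evens K s /\ evens K t.
Proof.
by rewrite /evens cat_uniq all_cat => /andP[/and3P[-> _ ->] /andP[-> ->]].
Qed.

Lemma evens_sub K L s : (K <= L)%N -> evens L s -> evens K s.
Proof.
move=> KL /andP[us h]; rewrite /evens us /=; apply: sub_all h => z /andP[-> /=].
exact: leq_trans.
Qed.

Lemma mem_pairs s z : all (fun z => ~~ odd z) s -> (z \in pairs s) = (if odd z then z.-1 \in s else z \in s).
Proof.
elim: s => [|f s IH] /=; first by case: ifP.
move=> /andP[of_ os]; rewrite !inE IH //; case: ifP => oz.
  have -> : (z == f) = false by apply/eqP => zf; move: of_; rewrite -zf oz.
  by rewrite /=; congr (_ || _); apply/eqP/eqP; lia.
have -> : (z == f.+1) = false by apply/eqP => zf; move: oz; rewrite zf /= of_.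
by [].
Qed.

Lemma combo_sum_ord n (P : seq nat -> Prop) (f : 'I_n -> tens) :
  (forall i, combo P (f i)) -> combo P (\sum_(i < n) f i).
Proof. by move=> h; apply: subsp_sum; [exact: combo_subsp|]. Qed.

Lemma high_cat K u v : high K (u ++ v) = high K u ++ high K v.
Proof. exact: filter_cat. Qed.
Lemma high_cons K z u : high K (z :: u) = if (K <= z)%N then z :: high K u else high K u.
Proof. by []. Qed.
#[global] Arguments high : simpl never.

Lemma nbelow_high K u v x z : (K <= x)%N -> (z < K)%N ->
  (nbelow K (u ++ x :: v)).+1 = nbelow K (u ++ z :: v) /\
  perm_eq (high K (u ++ x :: v)) (x :: high K (u ++ z :: v)).
Proof.
move=> Kx zK; rewrite !nbelow_cat !nbelow_cons zK ltnNge Kx add0n add1n addnS; split=> //.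
rewrite !high_cat !high_cons Kx [(K <= z)%N]leqNgt zK /=.
by rewrite -cat1s -[x :: _ ++ _]cat1s perm_catCA.
Qed.

(* Acting by [D x a] with [x] fresh replaces one old letter by [x]. *)
Lemma D_raise K x a q : ~~ odd K -> (K <= x)%N -> (a < K)%N -> prt x \notin q ->
  combo (fun v => (nbelow K v).+1 = nbelow K q /\ perm_eq (high K v) (x :: high K q)) (D x a (wd q)).
Proof.
move=> oK Kx aK xq; apply: combo_sub (D_combo e x a q) => v [u1 [u2 [z [E [[zE ->]|[zE _]]]]]].
  by rewrite E; apply: nbelow_high => //; rewrite zE; apply: prt_lt.
by move: xq; rewrite E mem_cat inE zE eqxx orbT.
Qed.

(** Up to the scalar [om (prt u) u], u and [prt u] run through dual bases of the span of the letters
    below K; this makes the sum commute with the action of these letters ([Cas_D]). *)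
Definition Cas K f (t : tens) : tens := \sum_(u < K) om (prt u) u *: D f.+1 u (D f (prt u) t).

Lemma Cas_linear K f : linear (Cas K f).
Proof.
move=> a x y; rewrite /Cas scaler_sumr -big_split; apply: eq_bigr => u _.
rewrite /= !(DD, DZ); apply: tens_eqP => w; rewrite !coefwE; ring.
Qed.

Lemma om_prtl u : om (prt u) u * om (prt u) u = 1.
Proof. by rewrite /om prtK eqxx; case: ifP; rewrite ?ee ?mulr1. Qed.

Lemma om_prt2 u : om (prt u) u * om u (prt u) = e.
Proof. by rewrite (om_sym ee u) mulrCA om_prtl mulr1. Qed.

Lemma sum_om (M : lmodType F) K b (f : nat -> M) : ~~ odd K -> (b < K)%N ->
  \sum_(u < K) om b u *: f u = om b (prt b) *: f (prt b).
Proof.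
move=> oK bK; rewrite (bigD1 (Ordinal (prt_lt oK bK))) //= big1 ?addr0 // => u ub.
rewrite om_neq0 ?scale0r //; apply: contra ub => /eqP uE; exact/eqP/val_inj.
Qed.

Lemma sum_om_prt (M : lmodType F) K b (f : nat -> M) : ~~ odd K -> (b < K)%N ->
  \sum_(u < K) om b (prt u) *: f u = om b (prt b) *: f b.
Proof.
move=> oK bK; rewrite (bigD1 (Ordinal bK)) //= big1 ?addr0 // => u ub.
rewrite om_neq0 ?scale0r //; apply: contra ub => /eqP /prt_inj uE; exact/eqP/val_inj.
Qed.

(** Commuting [D a b] past the two factors gives four sums against dual bases. [sum_om] and
    [sum_om_prt] collapse each to a single term, and these cancel in pairs. *)
Lemma Cas_D K f a b t : ~~ odd K -> (K <= f)%N -> (a < K)%N -> (b < K)%N ->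
  D a b (Cas K f t) = Cas K f (D a b t).
Proof.
move=> oK Kf aK bK; apply/eqP; rewrite -subr_eq0 /Cas raddf_sum /= -sumrB; apply/eqP.
have far c z : (c < K)%N -> (K <= z)%N -> om c z = 0.
  by move=> cK Kz; apply: om_neq0; apply/eqP => zE; have := prt_lt oK cK; lia.
have step g h s : (K <= g)%N -> D a b (D g h s) =
    D g h (D a b s) + (om b h *: D g a s - (e * om a h) *: D g b s).
  move=> Kg; have := D_comm ee a b g h s.
  rewrite (far b g) // (far a g) // mulr0 !scale0r subrr add0r => <-.
  by rewrite addrC subrK.
have E (u : 'I_K) : D a b (om (prt u) u *: D f.+1 u (D f (prt u) t))
    - om (prt u) u *: D f.+1 u (D f (prt u) (D a b t)) =
  om b u *: (om (prt u) u *: D f.+1 a (D f (prt u) t))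
  - om a u *: ((e * om (prt u) u) *: D f.+1 b (D f (prt u) t))
  + (om b (prt u) *: (om (prt u) u *: D f.+1 u (D f a t))
  - om a (prt u) *: ((e * om (prt u) u) *: D f.+1 u (D f b t))).
  rewrite DZ step ?(leqW Kf) // (step f) // !DD DN !DZ.
  by apply: tens_eqP => w; rewrite !coefwE; ring.
under eq_bigr => u _ do rewrite E.
rewrite big_split !sumrB /=.
rewrite (sum_om (fun u => om (prt u) u *: D f.+1 a (D f (prt u) t))) //.
rewrite (sum_om (fun u => (e * om (prt u) u) *: D f.+1 b (D f (prt u) t))) //.
rewrite (sum_om_prt (fun u => om (prt u) u *: D f.+1 u (D f a t))) //.
rewrite (sum_om_prt (fun u => (e * om (prt u) u) *: D f.+1 u (D f b t))) //.
rewrite !scalerA !prtK ![om _ _ * (e * _)]mulrCA -!expr2 !expr2.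
have omo c : om c (prt c) * om c (prt c) = 1 by have := om_prtl (prt c); rewrite prtK.
rewrite !omo ![om _ (prt _) * om (prt _) _]mulrC !om_prt2 ee mulr1.
by apply: tens_eqP => w; rewrite !coefwE coefw0; ring.
Qed.

(* The Casimir-type operator [Cas] trades two old letters for a fresh pair,
   up to the scalar by which it counts old letters. *)
Lemma Cas_raise K f q : ~~ odd K -> (K <= f)%N -> ~~ odd f -> f \notin q -> f.+1 \notin q ->
  combo (fun v => (nbelow K v).+2 = nbelow K q /\ perm_eq (high K v) [:: f, f.+1 & high K q])
    (Cas K f (wd q) + (nbelow K q)%:R *: wd q).
Proof.
move=> oK Kf of_; have pf : prt f = f.+1 by rewrite /prt (negbTE of_).
have pf1 : prt f.+1 = f by rewrite -pf prtK.
have far c z : (c < K)%N -> (K <= z)%N -> om c z = 0.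
  by move=> cK Kz; apply: om_neq0; apply/eqP => zE; have := prt_lt oK cK; lia.
elim: q => [|z q IH] fq f1q.
  rewrite /nbelow /= scale0r addr0 /Cas big1; first by apply: subsp0; exact: combo_subsp.
  by move=> u _; rewrite !D_nil linear0 scaler0.
move: fq f1q; rewrite !inE !negb_or => /andP[fz fq] /andP[f1z f1q].
have {}IH := IH fq f1q.
(* For z below K: in [X1] both operators hit z, which becomes f and then an old letter again; the
   sum over u is [- wd (z :: q)], one unit of the scalar for each old letter. In [X2] and [X3] one
   operator hits z and the other hits q, so two old letters are raised. *)
pose X1 := \sum_(u < K) om (prt u) u *: (D f.+1 u (D f (prt u) (lt z)) * wd q).
pose X2 := \sum_(u < K) om (prt u) u *: (D f (prt u) (lt z) * D f.+1 u (wd q)).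
pose X3 := \sum_(u < K) om (prt u) u *: (D f.+1 u (lt z) * D f (prt u) (wd q)).
rewrite (_ : Cas K f (wd (z :: q)) = X1 + X2 + (X3 + lt z * Cas K f (wd q))); last first.
  rewrite /Cas mulr_sumr -!big_split; apply: eq_bigr => u _ /=.
  by rewrite wd_cons D_mul DD !D_mul -scalerAr !scalerDr.
set P := fun v => _ /\ _.
have hP := @combo_subsp F P.
have [Kz|zK] := leqP K z.
  have Z u : D f (prt (u : 'I_K)) (lt z) = 0.
    by rewrite D_lt; apply: act_prt; [apply: far => //; apply: prt_lt|apply: om_neq0; rewrite pf eq_sym].
  have Z' (u : 'I_K) : D f.+1 u (lt z) = 0.
    by rewrite D_lt; apply: act_prt; [apply: far|apply: om_neq0; rewrite pf1 eq_sym].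
  have -> : X1 = 0 by apply: big1 => u _; rewrite Z linear0 mul0r scaler0.
  have -> : X2 = 0 by apply: big1 => u _; rewrite Z mul0r scaler0.
  have -> : X3 = 0 by apply: big1 => u _; rewrite Z' mul0r scaler0.
  have -> : nbelow K (z :: q) = nbelow K q by rewrite nbelow_cons ltnNge Kz.
  rewrite !add0r [wd (z :: q)]wd_cons scalerAr -mulrDr; apply: combo_mull IH => v [v1 v2].
  rewrite /P !nbelow_cons !high_cons ltnNge Kz !add0n; split=> //.
  rewrite -(perm_cons z) in v2; apply: perm_trans v2 _.
  by apply/permP => p /=; lia.
have omf c : (c < K)%N -> om f c = 0 by move=> cK; rewrite (om_sym ee) far ?mulr0.
have omf1 c : (c < K)%N -> om f.+1 c = 0.
  by move=> cK; rewrite (om_sym ee) far ?mulr0 // leqW.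
have nz : nbelow K (z :: q) = (nbelow K q).+1 by rewrite nbelow_cons zK.
have hz : high K (z :: q) = high K q by rewrite high_cons leqNgt zK.
have Z (u : 'I_K) : D f (prt u) (lt z) = om (prt u) z *: lt f.
  by rewrite D_lt actE (omf z) // mulr0 scale0r subr0.
have Z' (u : 'I_K) : D f.+1 u (lt z) = om u z *: lt f.+1.
  by rewrite D_lt actE (omf1 z) // mulr0 scale0r subr0.
have -> : X1 = - wd (z :: q).
  pose g u : tens := (e * om (prt u) u) *: - wd (u :: q).
  transitivity (\sum_(u < K) om z (prt u) *: g u).
    apply: eq_bigr => u _; rewrite Z DZ D_lt actE (far u f) // scale0r sub0r.
    have -> : om f.+1 f = e by rewrite /om pf1 eqxx /= of_.
    rewrite ee scale1r (om_sym ee (prt u) z) /g.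
    rewrite -scalerAl mulNr -wd_cons; apply: tens_eqP => w; rewrite !coefwE; ring.
  rewrite sum_om_prt // /g scalerA mulrCA [om z _ * _]mulrC om_prt2 ee scale1r //.
have c2 : combo P X2.
  apply: combo_sum_ord => u; rewrite Z -scalerAl.
  do 2 (apply: subspZ => //); apply: combo_mull (@D_raise K _ _ _ _ _ _ _) => //; last by rewrite pf1.
    move=> v [v1 v2]; rewrite /P nz hz nbelow_cons high_cons Kf ltnNge Kf add0n -v1; split=> //.
    by rewrite perm_cons.
  exact: leqW.
have c3 : combo P X3.
  apply: combo_sum_ord => u; rewrite Z' -scalerAl.
  do 2 (apply: subspZ => //); apply: combo_mull (@D_raise K _ _ _ _ _ _ _) => //; first last.
  - by rewrite pf.
  - exact: prt_lt.
  move=> v [v1 v2]; rewrite /P nz hz nbelow_cons high_cons (leqW Kf) ltnNge (leqW Kf) add0n -v1.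
  split=> //; rewrite -(perm_cons f.+1) in v2; apply: perm_trans v2 _.
  by apply/permP => p /=; lia.
have c4 : combo P (lt z * (Cas K f (wd q) + (nbelow K q)%:R *: wd q)).
  apply: combo_mull IH => v [v1 v2]; rewrite /P nz hz nbelow_cons high_cons zK leqNgt zK.
  by rewrite -v1.
rewrite [X in combo P X](_ : _ = X2 + X3 + lt z * (Cas K f (wd q) + (nbelow K q)%:R *: wd q)).
  by do 2 (apply: subspD => //).
rewrite nz [in RHS]mulrDr -scalerAr -wd_cons -natr1 scalerDl scale1r.
by apply: tens_eqP => w; rewrite !coefwE; ring.
Qed.

End Averaging.

Section Reconstruction.
Variables (F : fieldType) (e : F).
Hypothesis ee : e * e = 1.
Hypothesis charF0 : [pchar F] =i pred0.
Local Notation tens := (tens F).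
Local Notation D := (D e).
Local Notation Cas := (Cas e).

(* [Pc d K fs (Ops xs y t)] commutes with the action of the letters below [K] and,
   if [y t] has few enough letters, has none of them left: the scalars in [Pc]
   are chosen to cancel the words on which a [Cas] does not raise two letters. *)
Fixpoint Ops (xs y : seq nat) (t : tens) : tens :=
  match xs, y with x :: xs', a :: y' => D x a (Ops xs' y' t) | _, _ => t end.

Fixpoint Pc d K (fs : seq nat) (t : tens) : tens :=
  if fs is f :: fs' then Cas K f (Pc d K fs' t) + (d - size fs')%:R *: Pc d K fs' t else t.

Lemma Ops_linear xs y : linear (Ops xs y).
Proof.
elim: xs y => [|x xs IH] [|a y] //= c s t; by rewrite IH linearP.
Qed.

Lemma Pc_linear d K fs : linear (Pc d K fs).
Proof.
elim: fs => [|f fs IH] //= c s t; rewrite IH Cas_linear.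
by rewrite !scalerDr !scalerA [_ * c]mulrC addrACA.
Qed.

(* The words whose letters from [K] on are [xs] and some pairs from [fs], and which
   have less than [d] letters below [K]. *)
Definition Fil K (xs fs : seq nat) d (q : seq nat) : Prop :=
  (nbelow K q < d)%N /\ exists2 S, subseq S fs & perm_eq (high K q) (xs ++ pairs S).

Lemma Fil_notin K xs fs d q z : ~~ odd K -> evens K (xs ++ fs) -> Fil K xs fs d q -> (K <= z)%N ->
  (if odd z then z.-1 else z) \notin xs ++ fs -> z \notin q.
Proof.
move=> oK hxf [_ [S sS pq]] Kz; apply: contra => zq.
have : z \in high K q by rewrite mem_filter Kz.
rewrite (perm_mem pq) mem_cat.
have [/andP[_ hx] /andP[_ hf]] := evens_cat hxf.
have hS : all (fun z => ~~ odd z) S.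
  by apply/allP => w /(mem_subseq sS) /(allP hf) /andP[].
rewrite mem_pairs // mem_cat => /orP[zx|].
  by have /andP[/negbTE -> _] := allP hx _ zx; rewrite zx.
by case: ifP => _ /(mem_subseq sS) ->; rewrite orbT.
Qed.

(** Each [D x a] raises one old letter to x, or kills the word. With d = 0 the conclusion cannot
    hold for any word, so words with fewer letters than xs are sent to zero. *)
Lemma Ops_Fil K xs y d q : ~~ odd K -> evens K xs -> below K y -> size y = size xs ->
  below K q -> (size q < d + size xs)%N -> combo (Fil K xs [::] d) (Ops xs y (wd q)).
Proof.
move=> oK; elim: xs y d => [|x xs IH] [|a y] d // hx hy yx hq qd.
  apply: combo_wd; split; first by apply: leq_ltn_trans (count_size _ _) _; rewrite addn0 in qd.
  exists [::] => //; rewrite (_ : high K q = [::]) //; apply/eqP; rewrite -size_eq0 size_filter.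
  by rewrite -leqn0 leqNgt -has_count -all_predC; apply: sub_all hq => z /=; rewrite ltnNge.
move: hx hy yx; rewrite evens_cons /= => /and4P[xxs ox Kx hx] /andP[aK hy] [yx].
have {}IH := IH y d.+1 hx hy yx hq; rewrite addSnnS in IH.
move: (IH qd); apply: (combo_lin (D x a) (combo _)); [exact: linearP|exact: combo_subsp|].
move=> v hv; have [v1 [S sS v2]] := hv.
have pv : prt x \notin v.
  have -> : prt x = x.+1 by rewrite /prt (negbTE ox).
  apply: (Fil_notin (K := K) (xs := xs) (fs := [::]) (d := d.+1)) => //; try by rewrite cats0.
    exact: leqW.
  by rewrite /= ox cats0.
apply: combo_sub (D_raise e oK Kx aK pv) => w [w1 w2]; split; first by rewrite -ltnS w1.
exists S => //; apply: perm_trans w2 _; by rewrite perm_cons.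
Qed.

(** Before the step for f, words have at most d - |fs| old letters, where fs does not contain f. On
    words with exactly that many the added scalar completes [Cas] to the expression of [Cas_raise],
    leaving words with two fewer; all other words are already below the bound. So each step lowers
    the bound by at least one. *)
Lemma Pc_Fil d K xs fs t : ~~ odd K -> evens K (xs ++ fs) -> (size fs <= d)%N ->
  combo (Fil K xs [::] d.+1) t -> combo (Fil K xs fs (d - size fs).+1) (Pc d K fs t).
Proof.
move=> oK; elim: fs => [|f fs IH] hxf sd ht /=; first by rewrite subn0.
have hxf' : evens K (f :: xs ++ fs).
  move: hxf; rewrite /evens -(cat1s f) uniq_catCA cat1s => /andP[-> /=].
  by rewrite !all_cat /= => /and3P[-> -> ->].
move: hxf'; rewrite evens_cons => /and4P[fxf of_ Kf hxf'].
have {}IH := IH hxf' (ltnW sd) ht.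
move: IH; apply: (combo_lin (fun s => Cas K f s + (d - size fs)%:R *: s) (combo _)).
- apply: lin_add; first exact: Cas_linear.
  by move=> c s s'; rewrite scalerDr !scalerA mulrC.
- exact: combo_subsp.
move=> q hq; have [q1 [S sS q2]] := hq.
have fq : f \notin q by apply: (Fil_notin oK hxf' hq) => //; rewrite (negbTE of_).
have f1q : f.+1 \notin q by apply: (Fil_notin oK hxf' hq); rewrite ?leqW //= of_.
rewrite [X in combo _ X](_ : _ = (Cas K f (wd q) + (nbelow K q)%:R *: wd q)
    + ((d - size fs)%:R - (nbelow K q)%:R) *: wd q); last first.
  by rewrite -[in RHS]addrA -scalerDl addrCA subrr addr0.
apply: subspD; first exact: combo_subsp.
  apply: combo_sub (Cas_raise ee oK Kf of_ fq f1q) => v [v1 v2]; split; first lia.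
  exists (f :: S); first by rewrite /= eqxx.
  apply: perm_trans v2 _; rewrite -(perm_cat2l [:: f; f.+1]) in q2; apply: perm_trans q2 _.
  by apply/permP => p; rewrite /pairs /= !count_cat /=; lia.
have [qd|qd] := eqVneq (nbelow K q) (d - size fs)%N.
  by rewrite qd subrr scale0r; apply: subsp0; exact: combo_subsp.
apply: subspZ; first exact: combo_subsp.
apply: combo_wd; split; first lia.
by exists S => //; apply: subseq_trans sS (subseq_cons _ _).
Qed.

Lemma Fil0_D K xs fs a b t : ~~ odd K -> (a < K)%N -> (b < K)%N ->
  combo (Fil K xs fs 1) t -> D a b t = 0.
Proof.
move=> oK aK bK; apply: (combo_lin (D a b) (fun x => x = 0)).
- exact: linearP.
- exact: subsp_zero.
move=> q [q1 _]; apply: combo_false; apply: combo_sub (D_combo e a b q) => v [u1 [u2 [z [E h]]]].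
have zK : (z < K)%N by case: h => -[-> _]; apply: prt_lt.
by move: q1; rewrite E nbelow_cat nbelow_cons zK; lia.
Qed.

Lemma Ops_sub (W : tens -> Prop) xs y t : (forall a b t, W t -> W (D a b t)) ->
  W t -> W (Ops xs y t).
Proof. by move=> hD; elim: xs y => [|x xs IH] [|a y] //= Wt; apply: hD; apply: IH. Qed.

Lemma Cas_sub (W : tens -> Prop) K f t : subsp W -> (forall a b t, W t -> W (D a b t)) ->
  W t -> W (Cas K f t).
Proof.
move=> hW hD Wt; apply: subsp_sum => // u _; apply: subspZ => //; apply: (hD); exact: hD.
Qed.

Lemma Pc_sub (W : tens -> Prop) d K fs t : subsp W -> (forall a b t, W t -> W (D a b t)) ->
  W t -> W (Pc d K fs t).
Proof.
move=> hW hD Wt; elim: fs => [|f fs IH] //=; apply: subspD => //; first exact: Cas_sub.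
exact: subspZ.
Qed.

Definition rng l n K (u : seq nat) : Prop := [/\ below K u, (l <= size u)%N & (size u <= l + n)%N].

Lemma rng_le l n K n' K' u : (n <= n')%N -> (K <= K')%N -> rng l n K u -> rng l n' K' u.
Proof.
move=> nn KK [h1 h2 h3]; split=> //; first exact: sub_below h1.
by rewrite (leq_trans h3) // leq_add2l.
Qed.

Lemma rng_ex l (I : eqType) (r : seq I) (f : I -> tens) :
  (forall i, i \in r -> exists n K, combo (rng l n K) (f i)) ->
  exists n K, combo (rng l n K) (\sum_(i <- r) f i).
Proof.
elim: r => [|i r IH] h.
  by exists 0%N, 0%N; rewrite big_nil; apply: subsp0; exact: combo_subsp.
have [|n [K h1]] := IH; first by move=> j jr; apply: h; rewrite inE jr orbT.
have [n' [K' h2]] := h i (mem_head _ _).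
exists (maxn n n'), (maxn K K'); rewrite big_cons; apply: subspD; first exact: combo_subsp.
  by apply: combo_sub h2 => u; apply: rng_le; rewrite leq_maxr.
by apply: combo_sub h1 => u; apply: rng_le; rewrite leq_maxl.
Qed.

Lemma tens_rng (t : tens) : exists n K, combo (rng 0 n K) t.
Proof.
have [s [_ ->]] := combo_all t; apply: rng_ex => x _.
have [K h] := ex_below x.2; exists (size x.2), K.
by apply: subspZ; [exact: combo_subsp|apply: combo_wd].
Qed.

Lemma wd_mul_rng y n K (t : tens) : combo (rng 0 n K) t -> exists K', combo (rng (size y) n K') (wd y * t).
Proof.
move=> ht; have [K' h] := ex_below y; exists (maxn K K').
move: ht; apply: (combo_lin (fun t => wd y * t) (combo _) (mull_linear _) combo_subsp).
move=> u [u1 _ u3]; rewrite -wd_cat; apply: combo_wd; split; rewrite ?size_cat ?leq_addr ?leq_add2l //.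
rewrite /below all_cat; apply/andP; split; first by apply: sub_below h; rewrite leq_maxr.
by apply: sub_below u1; rewrite leq_maxl.
Qed.

Lemma ctx_rng (W : tens -> Prop) l k : ctx W l k -> exists n K, combo (rng l n K) k.
Proof.
move=> [s [hs ->]]; apply: rng_ex => x /hs [<- _].
have [n [K h]] := tens_rng x.2; have [K' h'] := wd_mul_rng x.1 h.
by exists n, K'.
Qed.

(* [w0] is recovered from its averages [Pc (Ops xs y w0)]: by downward
   induction on the number of raised letters, each [Cas] is absorbed. *)
Lemma recon (W : tens -> Prop) w0 : subsp W -> (forall a b t, W t -> W (D a b t)) ->
  (forall y, exists d K, forall xs fs, size xs = size y -> size fs = d ->
     evens K (xs ++ fs) -> W (Pc d K fs (Ops xs y w0))) ->
  W w0.
Proof.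
move=> hW hD hP; have [n [K0 hw]] := tens_rng w0.
(* m counts the letters still to be added to y. At m = 0 more letters are to be raised than any word
   of w0 has, so [Ops] kills w0. *)
suff C m y : (m <= n.+1)%N -> (size y + m = n.+1)%N -> exists M, forall xs, size xs = size y ->
    evens M xs -> W (Ops xs y w0).
  have [|M h] := C n.+1 [::] (leqnn _); first by [].
  by apply: (h [::]).
elim: m y => [|m IH] y mn ym.
  have [K1 hy] := ex_below y; set K := (K0 + K1).*2; exists K => xs xy hx.
  have {hw} : combo (rng 0 n K0) w0 by [].
  apply: (combo_lin (Ops xs y) W); [exact: Ops_linear|by []|] => u [u1 _ u3].
  have : combo (Fil K xs [::] 0) (Ops xs y (wd u)).
    apply: Ops_Fil => //; rewrite /K ?odd_double //.
    - by apply: sub_below hy; lia.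
    - by apply: sub_below u1; lia.
    - by rewrite xy; lia.
  move=> h; rewrite (_ : Ops _ _ _ = 0); first exact: subsp0.
  by apply: combo_false; apply: combo_sub h => v [].
have [d [K hPy]] := hP y.
(* The bound supplied by the induction depends on the letter added to y; only the finitely many
   letters below K occur, so a maximum serves them all. *)
have [M hM] : exists M, forall u xs, (u < K)%N -> size xs = (size y).+1 -> evens M xs ->
    W (Ops xs (prt u :: y) w0).
  elim: K {hPy} => [|k [M hM]]; first by exists 0%N.
  have [|M' hM'] := IH (prt k :: y) (ltnW mn); first by rewrite /= addSnnS.
  exists (maxn M M') => u xs; rewrite ltnS leq_eqVlt => /orP[/eqP ->|uk] xy hx.
    by apply: hM' => //; apply: evens_sub hx; rewrite leq_maxr.
  by apply: hM => //; apply: evens_sub hx; rewrite leq_maxl.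
exists (maxn K M) => xs xy hx.
have [L hL] := ex_below xs.
pose fs := [seq (L + K + M + i).*2 | i <- iota 0 d].
have sfs : size fs = d by rewrite size_map size_iota.
have hf : evens (maxn K M) (xs ++ fs).
  have /andP[ux ax] := hx; rewrite /evens cat_uniq ux all_cat ax /=; apply/andP; split.
    apply/andP; split; last by rewrite map_inj_uniq ?iota_uniq // => i j; lia.
    apply/hasPn => z /mapP[i _ ->]; apply/negP => /(allP hL); lia.
  by apply/allP => z /mapP[i _ ->]; rewrite odd_double /=; lia.
set B := Ops xs y w0.
(* The inner [D f (prt u)] of [Cas] raises one more letter, so the induction hypothesis places every
   summand in W. *)
have CB f : f \in fs -> W (Cas K f B).
  move=> ff; apply: subsp_sum => // u _; apply: subspZ => //; apply: hD.
  apply: (hM u (f :: xs)) => //=; first by rewrite xy.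
  have /andP[] := hf; rewrite cat_uniq all_cat => /and3P[ux h _] /andP[ax af].
  rewrite evens_cons; apply/and4P; split.
  - by have := hasPn h _ ff.
  - by have /andP[] := allP af _ ff.
  - by have /andP[_] := allP af _ ff; apply: leq_trans; rewrite leq_maxr.
  - by rewrite /evens ux; apply: sub_all ax => z /andP[-> /=]; apply: leq_trans; rewrite leq_maxr.
(* As [Cas] sends B into W, [Pc] acts on B modulo W as the product d (d-1) ... 1 of its scalars;
   this is s, and it is nonzero in characteristic 0. *)
have [s s0 hs] : exists2 s : F, s != 0 & W (Pc d K fs B - s *: B).
  have : (size fs <= d)%N by rewrite sfs.
  have : {subset fs <= fs} by [].
  elim: {1 3 4}fs => [|f gs IHg] /= fg gd.
    by exists 1; rewrite ?oner_eq0 // scale1r subrr; apply: subsp0.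
  have [|s s0 Ws] := IHg _ (ltnW gd); first by move=> z zg; apply: fg; rewrite inE zg orbT.
  exists ((d - size gs)%:R * s).
    by rewrite mulf_neq0 // ((pcharf0P F).1 charF0) -lt0n subn_gt0.
  rewrite (_ : _ - _ = Cas K f (Pc d K gs B - s *: B) + s *: Cas K f B
     + (d - size gs)%:R *: (Pc d K gs B - s *: B)).
    apply: subspD => //; last exact: subspZ.
    apply: subspD => //; first exact: Cas_sub.
    by apply: subspZ => //; apply: CB; apply: fg; rewrite mem_head.
  have -> : Cas K f (Pc d K gs B - s *: B) = - s *: Cas K f B + Cas K f (Pc d K gs B).
    by rewrite -Cas_linear addrC scaleNr.
  by apply: tens_eqP => w; rewrite !coefwE; ring.
have WP : W (Pc d K fs B) by apply: hPy => //; apply: evens_sub hf; rewrite leq_maxl.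
have : W (s *: B) by rewrite -[s *: B](subKr (Pc d K fs B)); apply: subspB.
by move=> /(subspZ hW s^-1); rewrite scalerA mulVf // scale1r.
Qed.

End Reconstruction.

Section DoubleCommutant.
Variables (F : fieldType) (e : F).
Hypothesis ee : e * e = 1.
Hypothesis charF0 : [pchar F] =i pred0.
Local Notation tens := (tens F).
Local Notation lt a := (@wd F [:: (a : nat)]).
Local Notation D := (D e).
Local Notation ev := (ev e).
Local Notation om := (om e).
Local Notation Ops := (Ops e).
Local Notation Pc := (Pc e).

Definition Omx xs : {linear tens -> tens} :=
  lext (fun u => Ops xs (take (size xs) u) (wd (drop (size xs) u))).

Lemma Omx_nil t : Omx [::] t = t.
Proof.
revert t; refine (@tens_ind F _ _ _) => [|u]; last by rewrite lext_wd /= drop0.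
by apply: subsp_eq; first exact: linearP.
Qed.

Lemma Omx_cons x xs a t : Omx (x :: xs) (lt a * t) = D x a (Omx xs t).
Proof.
revert t; refine (@tens_ind F _ _ _) => [|u]; last by rewrite -wd_cons !lext_wd.
apply: (@subsp_eq _ _ _ (fun t => Omx (x :: xs) (lt a * t))).
  by apply: (lin_comp (f := Omx _)); [exact: linearP|exact: mull_linear].
by apply: (lin_comp (f := D x a)); exact: linearP.
Qed.

Lemma Omx_wd xs y t : size y = size xs -> Omx xs (wd y * t) = Ops xs y t.
Proof.
elim: xs y => [|x xs IH] [|a y] //=; first by rewrite Omx_nil wd_nil mul1r.
by move=> [yx]; rewrite wd_cons -mulrA Omx_cons IH.
Qed.

Lemma Omx_D K xs a b u : ~~ odd K -> evens K xs -> (a < K)%N -> (b < K)%N ->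
  (size xs <= size u)%N -> Omx xs (D a b (wd u)) = D a b (Omx xs (wd u)).
Proof.
move=> oK + aK bK; elim: xs u => [|x xs IH] [|c u]; rewrite ?Omx_nil //.
rewrite evens_cons => /and4P[_ _ Kx hx] xu.
have far d : (d < K)%N -> om d x = 0.
  by move=> dK; apply: om_neq0; apply/eqP => zE; have := prt_lt oK dK; lia.
rewrite wd_cons D_cons actE mulrBl -!scalerAl linearD linearB /= !linearZ /= !Omx_cons IH //.
have /eqP := D_comm ee a b x c (Omx xs (wd u)).
rewrite (far a) // (far b) // mulr0 !scale0r subrr add0r subr_eq => /eqP ->.
by rewrite scalerN.
Qed.

(** For d and K large, G = [Pc] after [Omx] kills the image of the action of the letters below K,
    since it commutes with this action and its values involve none of these letters. By
    [invariant_ev] it then depends on contractions only, so G (y w0) = G k for a combination k of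
    words y' times elements of W. As G k lies in W, so do the averages of w0, and [recon]
    applies. *)
Lemma double_commutant (W : tens -> Prop) w0 : subsp W -> (forall a b t, W t -> W (D a b t)) ->
  (forall y, evctx e W (size y) (ev (wd y * w0))) -> W w0.
Proof.
move=> hW hD h; apply: (recon charF0 hW hD) => y.
have [k ck Ek] := h y; have [n1 [K1 hk]] := ctx_rng ck.
have [n2 [K2 hw]] := tens_rng w0; have [K3 hyw] := wd_mul_rng y hw.
pose d := maxn n1 n2; pose K0 := maxn K1 K3; pose l := size y.
pose K := (K0 + (l + d)).*2; exists d, K => xs fs xy fd hxf.
have [hx hf] := evens_cat hxf.
have oK : ~~ odd K by rewrite odd_double.
pose G t := Pc d K fs (Omx xs t).
have Gl : linear G by apply: lin_comp; [exact: Pc_linear|exact: linearP].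
have GD u a b : below K u -> (l <= size u)%N -> (size u <= l + d)%N -> (a < K)%N -> (b < K)%N ->
    G (D a b (wd u)) = 0.
  move=> uK lu ul aK bK; rewrite /G (Omx_D oK) ?xy //.
  have -> t : Pc d K fs (D a b t) = D a b (Pc d K fs t).
    have : evens K fs by [].
    elim: fs {fd hxf hf G Gl} => [|f gs IH] //=; rewrite evens_cons => /and4P[_ _ Kf hg].
    by rewrite IH // DD DZ Cas_D.
  have tu : size (take l u) = size xs by rewrite size_take_min xy; apply/minn_idPl.
  rewrite -(cat_take_drop l u) wd_cat Omx_wd //.
  apply: (@Fil0_D F e K xs fs) => //.
  have := @Pc_Fil F e ee d K xs fs (Ops xs (take l u) (wd (drop l u))) oK hxf.
  rewrite fd leqnn subnn; apply=> //; apply: Ops_Fil => //.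
  - by apply/allP => z /mem_take; apply: (allP uK).
  - by apply/allP => z /mem_drop; apply: (allP uK).
  - by rewrite size_drop xy -/l; lia.
have GE t : combo (rng l d K0) t -> G t = lext (code_val K G) (ev t).
  apply: (combo_ind (fun t => G t = _)).
    by apply: subsp_eq => //; apply: lin_comp; exact: linearP.
  move=> u [u1 u2 u3]; apply: (@invariant_ev _ _ ee _ G (size u) K K0) => //.
    by rewrite /K; lia.
  by move=> a b v aK bK vK vu; apply: GD => //; rewrite vu.
have Gk : G (wd y * w0) = G k.
  rewrite !GE ?Ek //.
    by apply: combo_sub hk => u; apply: rng_le; rewrite leq_maxl.
  by apply: combo_sub hyw => u; apply: rng_le; rewrite leq_maxr.
rewrite -Omx_wd // -/(G _) Gk.
move: k ck {Ek hk Gk}; apply: (ctx_ind (S := fun k => W (G k))); first exact: subsp_pre.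
move=> y' w yl Ww; rewrite /G Omx_wd ?yl ?xy //.
by apply: Pc_sub => //; apply: Ops_sub.
Qed.

End DoubleCommutant.

(** * Multilinear elements and the sign operator *)

Section Multilinear.
Variables (F : fieldType).
Local Notation tens := (tens F).
Local Notation lt a := (@wd F [:: (a : nat)]).

(* Multilinear words in which the parity of the number of letters from each
   pair {2j, 2j+1} is prescribed. *)
Definition multilin (A : seq nat) (chi : nat -> bool) (u : seq nat) : Prop :=
  [/\ uniq u, {subset u <= A} & forall t, odd (nbelow t.*2 u) = chi t].

Definition hom A (q : tens) : Prop := exists chi, combo (multilin A chi) q.

Lemma Dspec_fresh a Y u v : ~~ odd Y -> Y \notin u -> Dspec a Y.+1 u v ->
  exists u1 u2, u = u1 ++ prt a :: u2 /\ v = u1 ++ Y.+1 :: u2.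
Proof.
move=> oY Yu [u1 [u2 [z [E [[zE _]|[zE vE]]]]]]; last by exists u1, u2; rewrite -zE.
by move: Yu; rewrite E mem_cat inE zE /prt /= oY eqxx orbT.
Qed.

Section Conflict.
Variables (e : F) (M : lmodType F) (S : M -> Prop) (f : tens -> M) (Q : seq nat -> tens -> Prop).
Variable l : nat.
Hypothesis ee : e * e = 1.
Hypothesis hS : subsp S.
Hypothesis fl : linear f.
Hypothesis fD : forall a b t, f (D e a b t) = 0.
Hypothesis Qstep : forall A q a Y, Q A q -> ~~ odd Y -> below Y A -> (a < Y)%N ->
  Q (Y.+1 :: A) (D e a Y.+1 q).
Hypothesis Quse : forall (A : seq nat) q (y : seq nat), Q A q -> uniq y -> {in y, forall z, z \notin A} -> size y = l ->
  S (f (wd y * q)).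

(* Letters of [y] colliding with the rest are made fresh one at a time. *)
Lemma conflict A q y : Q A q -> size y = l -> S (f (wd y * q)).
Proof.
move=> hq yl.
suff H n (y1 y2 A' : seq nat) q' : size y2 = n -> (size y1 + n)%N = l -> uniq y1 ->
    {in y1, forall z, z \notin y2} -> {in y1, forall z, z \notin A'} -> Q A' q' ->
    S (f (wd (y1 ++ y2) * q')) by apply: (H (size y) [::] y A).
have fB x x' : f (x + x') = f x + f x' by rewrite -[x]scale1r fl !scale1r.
have fZ c x : f (c *: x) = c *: f x.
  have f0 : f 0 = 0 by have := fl (-1) 0 0; rewrite scaler0 addr0 => ->; rewrite scaleN1r addNr.
  by rewrite -[c *: x]addr0 fl f0 addr0.
elim: n y1 y2 A' q' => [|n IH] y1 y2 A' q'.
  move=> /size0nil -> ; rewrite addn0 cats0 => y1l u1 _ hA Qq; exact: Quse Qq _ _ _.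
case: y2 => // a y3 [y3n] sl u1 h12 hA Qq.
have [K0 hK] := ex_below (a :: y1 ++ y3 ++ A').
set Y := K0.*2; have oY : ~~ odd Y by rewrite odd_double.
have {hK} : below Y (a :: y1 ++ y3 ++ A') by apply: sub_below hK; rewrite /Y; lia.
rewrite /= /below !all_cat => /and4P[aY y1Y y3Y AY].
have nY s z : below Y s -> (Y <= z)%N -> z \notin s := @mem_below Y s z.
have h13 z : z \in y1 -> z \notin y3.
  by move=> /h12; rewrite inE negb_or => /andP[].
(* Invariance under [D a Y.+1] with the fresh Y put in place of a: hitting Y returns e times the
   original word, and the other three terms hit [y1], [y3] or [q']. In these Y joins the treated
   prefix, and a partner of a becomes the fresh Y.+1. *)
have := fD a Y.+1 (wd y1 * (lt Y * (wd y3 * q'))).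
rewrite !D_mul D_lt actE (@om_neq0 _ _ a Y); last first.
  apply/eqP => E; have := prtK a; rewrite -E /prt (negbTE oY); lia.
have -> : om e Y.+1 Y = e by rewrite /om /prt /= oY eqxx.
rewrite mulr0 scale0r subr0 !mulrDr !fB => /eqP.
have J s1 s2 t : wd s1 * (lt Y * (wd s2 * t)) = wd (rcons s1 Y ++ s2) * t.
  by rewrite cat_rcons wd_cat [wd (Y :: s2)]wd_cons !mulrA.
have lin2 s1 s2 (g : tens -> tens) : linear g -> linear (fun t => f (s1 * (s2 * g t))).
  move=> gl; apply: (lin_comp (f := f)) => //; apply: lin_comp; first exact: mull_linear.
  by apply: lin_comp => //; exact: mull_linear.
have YY : (Y <= Y.+1)%N by [].
have t1 : S (f (D e a Y.+1 (wd y1) * (lt Y * (wd y3 * q')))).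
  apply: (combo_lin (fun t => f (t * _)) S _ hS _ _ (D_combo e a Y.+1 y1)).
    by apply: (lin_comp (f := f)) => //; exact: mulr_linear.
  move=> v /(Dspec_fresh oY (nY _ _ y1Y (leqnn _))) [w1 [w2 [E1 E2]]].
  have mv z : z \in rcons v Y -> [\/ z = Y, z = Y.+1 | z \in y1].
    rewrite mem_rcons inE E2 E1 !mem_cat !inE => /or3P[/eqP->|->|/orP[/eqP->|->]]; rewrite ?orbT.
    - by constructor 1.
    - by constructor 3.
    - by constructor 2.
    - by constructor 3.
  rewrite J; apply: (IH _ _ A') => //.
  - by rewrite size_rcons -sl E2 E1 !size_cat /= !addnS.
  - have uv : uniq (w1 ++ w2) by move: u1; rewrite E1 uniq_mid => /andP[].
    have Yw z : (Y <= z)%N -> z \notin w1 ++ w2.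
      move=> Yz; apply: contra (nY _ _ y1Y Yz).
      by rewrite E1 !mem_cat inE => /orP[->|->]; rewrite ?orbT.
    rewrite rcons_uniq E2 uniq_mid uv Yw // andbT.
    by rewrite mem_cat inE orbCA -mem_cat negb_or Yw // andbT neq_ltn ltnSn.
  - by move=> z /mv[->|->|/h13 //]; apply: (nY _ _ y3Y).
  - by move=> z /mv[->|->|/hA //]; apply: (nY _ _ AY).
have uYy : uniq (rcons y1 Y) by rewrite rcons_uniq u1 (nY _ _ y1Y).
have t3 : S (f (wd y1 * (lt Y * (D e a Y.+1 (wd y3) * q')))).
  apply: (combo_lin (fun t => f (wd y1 * (lt Y * (t * q')))) S _ hS _ _ (D_combo e a Y.+1 y3)).
    by apply: lin2; exact: mulr_linear.
  move=> v /(Dspec_fresh oY (nY _ _ y3Y (leqnn _))) [w1 [w2 [E1 E2]]].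
  rewrite J; apply: (IH _ _ A') => //.
  - by rewrite -y3n E2 E1 !size_cat /= !addnS.
  - by rewrite size_rcons addSnnS.
  - move=> z; rewrite mem_rcons inE => zz.
    have z3 : z \notin y3 by case/orP: zz => [/eqP->|/h13 //]; apply: (nY _ _ y3Y).
    have zY : z != Y.+1.
      by case/orP: zz => [/eqP->|/(allP y1Y)]; rewrite neq_ltn; [rewrite ltnSn|move=> /leqW ->].
    apply: contra z3; rewrite E2 E1 !mem_cat !inE (negbTE zY) => /orP[->|/= ->]; rewrite ?orbT //.
  - by move=> z; rewrite mem_rcons inE => /orP[/eqP->|/hA //]; apply: (nY _ _ AY).
have t4 : S (f (wd y1 * (lt Y * (wd y3 * D e a Y.+1 q')))).
  rewrite J; apply: (IH _ _ (Y.+1 :: A')) => //.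
  - by rewrite size_rcons addSnnS.
  - by move=> z; rewrite mem_rcons inE => /orP[/eqP->|/h13 //]; apply: (nY _ _ y3Y).
  - move=> z; rewrite mem_rcons !inE => zz; rewrite negb_or.
    have -> : z != Y.+1.
      by case/orP: zz => [/eqP->|/(allP y1Y)]; rewrite neq_ltn; [rewrite ltnSn|move=> /leqW ->].
    by case/orP: zz => [/eqP->|/hA //]; apply: (nY _ _ AY).
  - exact: Qstep.
have -> : wd (y1 ++ a :: y3) * q' = wd y1 * (lt a * (wd y3 * q')).
  by rewrite wd_cat [wd (a :: y3)]wd_cons !mulrA.
rewrite -scalerAl -scalerAr fZ addrCA addr_eq0 => /eqP E.
rewrite -[f _]scale1r -ee -scalerA E; apply: subspZ => //; apply: subspN => //.
by do 2 (apply: subspD => //).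
Qed.

End Conflict.

Section Sign.
Variables (A : seq nat) (chi : nat -> bool).

Definition join_sign (y : seq nat) : F := (-1) ^+ (ninv y + sumn [seq nat_of_bool (chi (uphalf b)) | b <- y]).

(** The inversions between y and u are the sum of [nbelow b u] over b in y. As b is not in u,
    rounding b up to the even number [(uphalf b).*2] does not change this count, and [chi] gives its
    parity. So the sign of y u splits off a factor that does not depend on u. *)
Lemma sgn_join y u : multilin A chi u -> {in y, forall z, z \notin A} ->
  sgn F (y ++ u) = join_sign y * sgn F u.
Proof.
move=> [uu uA uchi] yA; rewrite /sgn /join_sign -exprD; apply: sign_eq.
rewrite ninv_cat !oddD -!addbA [odd (ninv u) (+) _]addbC; congr (_ (+) (_ (+) _)).
elim: y yA => //= b y IH yA; rewrite !oddD IH; last first.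
  by move=> z zy; apply: yA; rewrite inE zy orbT.
congr (_ (+) _); rewrite oddb -uchi.
have bu : b \notin u by apply: contra (yA b (mem_head _ _)); apply: uA.
congr odd; apply: eq_in_count => z zu; have zb : z != b by apply: contraNneq bu => <-.
by rewrite uphalf_half; have := odd_double_half b; case: (odd b) => /=; lia.
Qed.

Lemma join_signK y : join_sign y * join_sign y = 1.
Proof. by rewrite -expr2 sqrr_sign. Qed.

Lemma tw_ev_theta e y q : combo (multilin A chi) q -> uniq y -> {in y, forall z, z \notin A} ->
  e * e = 1 -> tw F (ev (- e) (wd y * theta F q)) = join_sign y *: ev e (wd y * q).
Proof.
move=> hq uy yA ee; move: q hq.
apply: (combo_ind (fun q => tw F (ev (- e) (wd y * theta F q)) = join_sign y *: ev e (wd y * q))).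
  apply: (@subsp_eq _ _ _ (fun q => tw F (ev (- e) (wd y * theta F q)))).
    by apply: (lin_comp (f := fun t => tw F (ev (- e) (wd y * t)))); [exact: twev_linear|exact: linearP].
  move=> c x x'; apply: tens_eqP => w; rewrite mulrDr -scalerAr (linearP (ev e)) !coefwE; ring.
move=> u hu; rewrite theta_wd -scalerAr -wd_cat !linearZ /= tw_ev //.
  by rewrite scalerA (sgn_join hu) // mulrCA sgnK mulr1.
have [uu uA _] := hu; rewrite cat_uniq uy uu andbT; apply/hasPn => z /uA zA.
by apply: contraL zA; apply: yA.
Qed.

(** The ratio [(-1) ^+ odd a] of the two forms, times the parity of [nbelow (prt a) u] for words u
    containing [prt a]. For even a the count below a + 2 includes [prt a] itself, hence the
    negation. *)
Definition step_sign a : F :=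
  (-1) ^+ (odd a + (if odd a then chi a./2 else ~~ chi a./2.+1)).

(** The action replaces [prt a] by a letter above all others. By [ninv_mid] the sign of the word
    changes by the parities of its length and of [nbelow (prt a) u]; the position drops out, and
    [chi] fixes both parities. So [theta] intertwines the two actions up to one scalar. *)
Lemma D_theta e a Y q : combo (multilin A chi) q -> ~~ odd Y -> below Y A -> (a < Y)%N ->
  D (- e) a Y.+1 (theta F q) = (step_sign a * (-1) ^+ chi Y./2) *: theta F (D e a Y.+1 q).
Proof.
move=> hq oY AY aY; move: q hq.
apply: (combo_ind (fun q => _ = _ *: theta F (D e a Y.+1 q))).
  apply: subsp_eq; first by apply: (lin_comp (f := D (- e) a Y.+1)); exact: linearP.
  by move=> c x x'; apply: tens_eqP => w; rewrite (linearP (D e a Y.+1)) (linearP (theta F)) !coefwE; ring.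
move=> u [uu uA uchi]; rewrite theta_wd DZ.
have Yu : prt Y.+1 \notin u.
  rewrite /prt /= oY /=; apply: contraL (leqnn Y) => /uA /(allP AY); by rewrite ltnNge.
rewrite !D_fresh // (linearN (theta F)) (linearZ_LR (theta F)) (raddf_sum (theta F)) !scalerN; congr (- _).
rewrite !scaler_sumr; apply: eq_bigr => i _ /=.
rewrite (linearZ_LR (theta F)) theta_wd !scalerA; congr (_ *: _).
move: (nat_of_ord i) (ltn_ord i) => {}i iu.
rewrite om_opp; have [->|ui] := om_case e a (nth 0%N u i); first by rewrite !(mulr0, mul0r).
rewrite ui; have Eu := rmn_cat iu; rewrite ui in Eu.
set r := rmn i u; have br : prt a \notin r /\ uniq r.
  by move: uu; rewrite -Eu uniq_mid => /andP[].
have rY : below Y r.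
  apply: below_rmn; apply/allP => z /uA; exact: (allP AY).
have su : sgn F u = (-1) ^+ (i + nbelow (prt a) u) * sgn F r.
  rewrite -{1 2}Eu nbelow_cat nbelow_cons ltnn add0n -nbelow_cat.
  rewrite /sgn -exprD; apply: sign_eq; rewrite ninv_mid ?size_take ?iu //.
  by case: br => + _; rewrite mem_cat => /norP[].
have sr : sgn F (ins i Y.+1 r) = (-1) ^+ (i + size r) * sgn F r.
  rewrite /sgn -exprD; apply: sign_eq; rewrite /ins ninv_mid; last first.
    by apply: contra (mem_below rY (leqnSn Y)); apply: mem_take.
  rewrite cat_take_drop size_take.
  have ir : (i <= size r)%N by rewrite size_rmn // -ltnS prednK // (leq_ltn_trans _ iu).
  have -> : (if (i < size r)%N then i else size r) = i by case: ltngtP ir => // ->.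
  congr (odd (_ + _ + _)); apply/eqP; rewrite -all_count.
  by apply: sub_all rY => z /leqW.
have sz : odd (size r) = ~~ chi Y./2.
  rewrite -uchi; have -> : Y./2.*2 = Y by rewrite even_halfK.
  have -> : nbelow Y u = size u.
    by apply/eqP; rewrite -all_count; apply/allP => z /uA; exact: (allP AY).
  by rewrite size_rmn //; case: (size u) iu => //= n _; rewrite negbK.
have bu : prt a \in u by rewrite -ui mem_nth.
have sb : odd (nbelow (prt a) u) = (if odd a then chi a./2 else ~~ chi a./2.+1).
  rewrite -!uchi; case: ifP => oa.
    by congr (odd (nbelow _ _)); rewrite /prt oa -[in LHS](odd_double_half a) oa.
  have -> : a./2.+1.*2 = (prt a).+1 by rewrite doubleS even_halfK ?oa // /prt oa.
  have E n : nbelow n.+1 u = (count_mem n u + nbelow n u)%N.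
    have := count_predUI (pred1 n) (fun z => z < n)%N u.
    rewrite (@eq_count _ (predI _ _) pred0); last by move=> z /=; case: eqVneq => // ->; rewrite ltnn.
    rewrite count_pred0 addn0 => <-; apply: eq_count => z /=; by rewrite ltnS leq_eqVlt.
  by rewrite E count_uniq_mem // bu /= negbK.
rewrite su sr /step_sign !exprD -[in LHS](signr_odd _ (nbelow _ _)) sb.
rewrite -(signr_odd _ (size r)) sz.
case: (odd a); case: (chi Y./2); case: (chi _) => /=; ring.
Qed.

End Sign.
End Multilinear.

(** * The transfer is an involution *)

Section Involution.
Variables (F : fieldType) (e : F).
Hypothesis ee : e * e = 1.
Hypothesis charF0 : [pchar F] =i pred0.
Local Notation tens := (tens F).

Lemma hom_D A (q : tens) a Y : hom A q -> ~~ odd Y -> below Y A -> (a < Y)%N ->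
  hom (Y.+1 :: A) (D e a Y.+1 q).
Proof.
move=> [chi hq] oY AY aY.
exists (fun t => chi t (+) (prt a < t.*2)%N (+) (Y.+1 < t.*2)%N).
move: hq; apply: (combo_lin (D e a Y.+1) (combo _)); [exact: linearP|exact: combo_subsp|].
move=> u [uu uA uchi]; apply: combo_sub (D_combo e a Y.+1 u) => v.
have nYu z : (Y <= z)%N -> z \notin u.
  by move=> Yz; apply: contraL Yz => /uA /(allP AY); rewrite ltnNge.
move=> /(Dspec_fresh oY (nYu _ (leqnn _))) [u1 [u2 [E ->]]].
have sub12 : {subset u1 ++ u2 <= u}.
  by move=> z; rewrite E !mem_cat inE => /orP[->|->]; rewrite ?orbT.
split.
- rewrite uniq_mid; apply/andP; split; last by move: uu; rewrite E uniq_mid => /andP[].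
  by apply: contra (nYu _ (leqnSn Y)); apply: sub12.
- move=> z; rewrite mem_cat inE orbCA -mem_cat inE => /orP[->//|/sub12 /uA ->].
  by rewrite orbT.
- move=> t; rewrite -uchi E !nbelow_cat !nbelow_cons !oddD !oddb.
  by case: (odd _); case: (odd _); case: (prt a < _)%N; case: (Y.+1 < _)%N.
Qed.

Section Submodule.
Variable W : tens -> Prop.
Hypothesis hW : subsp W.
Hypothesis hD : forall a b t, W t -> W (D e a b t).
Let ee' := ee' ee.

(** Against test words without letters from A this is [tw_ev_theta]. [conflict] lifts the
    restriction: it applies the action to [theta F q], which by [D_theta] remains a multiple of
    [theta] of an element of W. *)
Lemma theta_Psi A q : W q -> hom A q -> Psi e W (theta F q).
Proof.
move=> Wq hq y.
pose Q B q' := exists c q0, [/\ W q0, hom B q0 & q' = c *: theta F q0].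
apply: (@conflict F (- e) tens (evctx e W (size y)) (fun t => tw F (ev (- e) t)) Q (size y)
  ee' _ _ _ _ _ A) => //.
- exact: evctx_subsp.
- by apply: (lin_comp (f := tw F)); exact: linearP.
- by move=> a b t; rewrite ev_D // linear0.
- move=> B _ a Y [c [q0 [Wq0 hq0 ->]]] oY BY aY; have [chi h0] := hq0.
  rewrite DZ (D_theta e h0) // scalerA; eexists _, (D e a Y.+1 q0).
  by split; [exact: hD|exact: hom_D|].
- move=> B _ y' [c [q0 [Wq0 [chi h0] ->]]] uy yB <-.
  have := twev_linear (- e) y' c (theta F q0) 0.
  rewrite addr0 mulr0 !linear0 addr0 => ->.
  apply: subspZ; first exact: evctx_subsp.
  rewrite (tw_ev_theta h0) //; apply: subspZ; first exact: evctx_subsp.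
  exact: evctx_gen.
- by exists 1, q; rewrite scale1r.
Qed.

(** For y without letters from A, the twisted contraction of y q for e is up to sign the contraction
    of y and [theta F q] for -e, and [theta F q] lies in [Psi e W]. The other y follow by
    [conflict]. *)
Lemma hom_Psi_Psi A q : W q -> hom A q -> Psi (- e) (Psi e W) q.
Proof.
move=> Wq hq y; have hP : subsp (Psi e W) by exact: Psi_subsp.
pose Q B q' := W q' /\ hom B q'.
apply: (@conflict F e tens (evctx (- e) (Psi e W) (size y)) (fun t => tw F (ev (- - e) t)) Q (size y)
  ee _ _ _ _ _ A) => //.
- exact: evctx_subsp.
- by apply: (lin_comp (f := tw F)); exact: linearP.
- by move=> a b t; rewrite opprK ev_D // linear0.
- by move=> B q0 a Y [Wq0 hq0] oY BY aY; split; [exact: hD|exact: hom_D].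
- move=> B q0 y' [Wq0 hq0] uy yB <-; rewrite opprK; have [chi h0] := hq0.
  have E : tw F (ev e (wd y' * q0)) = join_sign F chi y' *: ev (- e) (wd y' * theta F q0).
    by rewrite -[ev (- e) _]twK (tw_ev_theta h0) // linearZ /= scalerA join_signK scale1r.
  rewrite E; apply: subspZ; first exact: evctx_subsp.
  by apply: evctx_gen; apply: theta_Psi hq0.
Qed.

(** No letter below K is left, and the fresh ones are distinct. Letters from fs come in whole pairs,
    which lie on one side of every even threshold, so all these words have the parities of xs. *)
Lemma evens_multilin K xs fs v : evens K (xs ++ fs) -> Fil K xs fs 1 v ->
  multilin (xs ++ pairs fs) (fun t => odd (nbelow t.*2 xs)) v.
Proof.
move=> hxf [v0 [S sS pv]].
have [/andP[ux ax] /andP[uf af]] := evens_cat hxf.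
have hv : high K v = v.
  apply/all_filterP; rewrite -[v]filter_predT; move: v0; rewrite ltnS leqn0 => /eqP v0.
  rewrite filter_predT; apply/allP => z zv; rewrite leqNgt; apply/negP => zK.
  by move: v0 => /eqP; rewrite /nbelow -leqn0 leqNgt -has_count => /hasPn /(_ _ zv); rewrite zK.
rewrite hv in pv; have uS : uniq S by apply: subseq_uniq uf.
have hf : all (fun z => ~~ odd z) fs by apply: sub_all af => z /andP[].
have hS : all (fun z => ~~ odd z) S by apply/allP => z /(mem_subseq sS) /(allP hf).
have upairs T : uniq T -> all (fun z => ~~ odd z) T -> uniq (pairs T).
  elim: T => //= f T IH /andP[fT uT] /andP[of_ oT].
  rewrite /= !inE !mem_pairs // (negbTE of_) /= of_ (negbTE fT) orbF IH // andbT.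
  by rewrite neq_ltn ltnSn.
split.
- rewrite (perm_uniq pv) cat_uniq ux upairs // andbT /=; apply/hasPn => z.
  rewrite mem_pairs //; case: ifP => [oz _|oz zS].
    by apply: contraTN oz => /(allP ax) /andP[].
  move: hxf; rewrite /evens cat_uniq => /andP[/and3P[_ h _] _].
  exact: (hasPn h _ (mem_subseq sS zS)).
- move=> z; rewrite (perm_mem pv) !mem_cat => /orP[->//|].
  by rewrite !mem_pairs //; case: ifP => _ /(mem_subseq sS) ->; rewrite orbT.
- move=> t; have -> : nbelow t.*2 v = nbelow t.*2 (xs ++ pairs S).
    by move/permP: pv; apply.
  rewrite nbelow_cat oddD; have -> : odd (nbelow t.*2 (pairs S)) = false; last by rewrite addbF.
  elim: (S) hS => //= f T IH /andP[of_ oT].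
  rewrite -[pairs _]/([:: f; f.+1] ++ pairs T) nbelow_cat oddD IH // !nbelow_cons !oddD !oddb.
  have -> : (f.+1 < t.*2)%N = (f < t.*2)%N by lia.
  by case: (f < _)%N.
Qed.

(** [Psi (- e) (Psi e W)] is a subspace stable under the action, so by [recon] it suffices that it
    contains the averages of w. These are homogeneous by [evens_multilin], and [hom_Psi_Psi]
    applies. *)
Lemma sub_Psi_Psi w : W w -> Psi (- e) (Psi e W) w.
Proof.
move=> Ww; have hP : subsp (Psi e W) by exact: Psi_subsp.
have [n [K0 hw]] := tens_rng w.
apply: (@recon F e charF0) => //.
- exact: Psi_subsp.
- by move=> a b t /(@Psi_D F (- e) ee' _ a b _ hP); rewrite opprK.
move=> y; have [K1 hy] := ex_below y.
exists n, (K0 + K1).*2 => xs fs xy fn hxf; have [hx _] := evens_cat hxf.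
have oK : ~~ odd (K0 + K1).*2 by rewrite odd_double.
apply: (@hom_Psi_Psi (xs ++ pairs fs)).
  by apply: Pc_sub => //; apply: Ops_sub.
exists (fun t => odd (nbelow t.*2 xs)).
set K := (K0 + K1).*2 in hxf oK *.
have : combo (Fil K xs fs 1) (Pc e n K fs (Ops e xs y w)).
  have := @Pc_Fil F e ee n K xs fs (Ops e xs y w) oK hxf; rewrite fn leqnn subnn; apply=> //.
  move: hw; apply: (combo_lin (Ops e xs y) (combo _)); [exact: Ops_linear|exact: combo_subsp|].
  move=> u [u1 _ u3]; apply: Ops_Fil => //.
  - by apply: sub_below hy; rewrite /K; lia.
  - by apply: sub_below u1; rewrite /K; lia.
  - by rewrite addSn ltnS (leq_trans u3) // leq_addr.
by apply: combo_sub => v; apply: evens_multilin.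
Qed.

(** By [double_commutant] contractions decide. Those of w are twists of contractions of sums of y'
    w' with w' in [Psi e W], which the definition of [Psi] places in [evctx e W]; the two twists
    cancel by [twK]. *)
Lemma Psi_Psi_sub w : Psi (- e) (Psi e W) w -> W w.
Proof.
move=> Pw; apply: (@double_commutant F e ee charF0 W w hW hD) => y.
have [k ck E] := Pw y; rewrite opprK in E.
rewrite -[ev e _]twK E.
move: k ck {E}; apply: (ctx_ind (S := fun k => evctx e W (size y) (tw F (ev (- e) k)))).
  apply: subsp_pre; last exact: evctx_subsp.
  by apply: (lin_comp (f := tw F)); exact: linearP.
by move=> y' w' <- Pw'; apply: Pw'.
Qed.

End Submodule.

Lemma Psi_mono (W W' : tens -> Prop) : (forall t, W t -> W' t) -> forall t, Psi e W t -> Psi e W' t.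
Proof.
move=> h t Pt y; have [k [s [hs ->]] E] := Pt y.
exists (\sum_(x <- s) wd x.1 * x.2) => //; exists s; split=> // x /hs [-> /h].
by [].
Qed.

End Involution.

(** * Ideals of the enveloping algebra as spaces of words *)

Section GoodRight.
Variables (F : fieldType) (e : F).
Local Notation tens := (tens F).
Local Notation lt a := (@wd F [:: (a : nat)]).
Local Notation D := (D e).

Lemma word_ind2 (P : seq nat -> Prop) : P [::] -> (forall a, P [:: a]) ->
  (forall a b u, P u -> P [:: a, b & u]) -> forall u, P u.
Proof.
move=> h0 h1 h2 u; have [n un] := ubnP (size u); elim: n u un => // n IH [|a [|b u]] //= un.
by apply/h2/IH; move: un => /=; lia.
Qed.

Lemma wd_cons2 a b u : wd [:: a, b & u] = wd [:: a; b] * wd u :> tens.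
Proof. by rewrite -wd_cat. Qed.

Section Good.
Variable W : tens -> Prop.
Hypothesis gW : good e W.
Let hW := good_sub gW.

Lemma good_odd_D a b c : W (D a b (lt c)).
Proof.
by rewrite D_lt actE; apply: subspB => //; apply: subspZ => //; apply: (good_odd gW).
Qed.

(** [rel2] gives the commutator with E_ab on two letters; both the commutator and [D a b] are
    derivations, which settles longer words two letters at a time. Right stability of W follows. *)
Lemma good_comm a b t : W (wd [:: a; b] * t - t * wd [:: a; b] - D a b t).
Proof.
move: t; apply: tens_ind.
  apply: (subsp_pre (f := fun t => wd [:: a; b] * t - t * wd [:: a; b] - D a b t) (S := W)) => //.
  move=> c x y; rewrite mulrDr mulrDl -scalerAl -scalerAr (linearP (D a b)).
  by apply: tens_eqP => w; rewrite !coefwE; ring.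
apply: word_ind2 => [|c|c d u IH].
- by rewrite wd_nil mulr1 mul1r subrr sub0r -wd_nil D_nil oppr0; apply: subsp0.
- apply: subspB => //; last exact: good_odd_D.
  by rewrite -!wd_cat; apply: subspB => //; apply: (good_odd gW).
have -> : wd [:: a; b] * wd [:: c, d & u] - wd [:: c, d & u] * wd [:: a; b] - D a b (wd [:: c, d & u])
  = rel2 e [:: a; b; c; d] * wd u + wd [:: c; d] * (wd [:: a; b] * wd u - wd u * wd [:: a; b] - D a b (wd u)).
  rewrite /rel2 (wd_cons2 c d u) D_mul (wd_cons2 a b [:: c; d]) (wd_cons2 c d [:: a; b]).
  rewrite !mulrBl !mulrBr !mulrA.
  by apply: tens_eqP => w; rewrite !coefwE; ring.
by apply: subspD => //; [apply: (good_rel2 gW)|apply: (good_left gW)].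
Qed.

Lemma good_right a b t : W t -> W (t * wd [:: a; b]).
Proof.
move=> Wt; have h := good_comm a b t.
have -> : t * wd [:: a; b] = wd [:: a; b] * t - D a b t - (wd [:: a; b] * t - t * wd [:: a; b] - D a b t).
  by apply: tens_eqP => w; rewrite !coefwE; ring.
apply: subspB => //; apply: subspB => //; first exact: (good_left gW).
exact: (good_D gW).
Qed.

Lemma good_left_even u t : ~~ odd (size u) -> W t -> W (wd u * t).
Proof.
move: u; apply: word_ind2 => [|a|a b u IH] //=; first by rewrite wd_nil mul1r.
rewrite negbK => su Wt; rewrite wd_cons2 -mulrA; apply: (good_left gW); exact: IH.
Qed.

Lemma good_right_even u t : ~~ odd (size u) -> W t -> W (t * wd u).
Proof.
move=> + Wt; move: u t Wt; apply: word_ind2 => [|a|a b u IH] //= t Wt; first by rewrite wd_nil mulr1.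
by rewrite negbK => su; rewrite wd_cons2 mulrA; apply: IH => //; apply: good_right.
Qed.

End Good.
End GoodRight.

Section PushPull.
Variables (F : fieldType) (e : F) (U : algType F) (g : nat -> nat -> U).
Hypothesis ee : e * e = 1.
Local Notation tens := (tens F).
Local Notation D := (D e).
Local Notation om := (om e).

Hypothesis g_sym : forall a b, g a b + e *: g b a = 0.
Hypothesis g_comm : forall a b c d, g a b * g c d - g c d * g a b =
  om b c *: g a d - (e * om a c) *: g b d + (om b d *: g c a - (e * om a d) *: g c b).

Fixpoint pw (u : seq nat) : U :=
  match u with a :: b :: v => g a b * pw v | [::] => 1 | _ => 0 end.
Definition pi : {linear tens -> U} := lext pw.

Lemma pi_wd u : pi (wd u) = pw u. Proof. exact: lext_wd. Qed.

Lemma pi1 : pi 1 = 1. Proof. by rewrite -wd_nil pi_wd. Qed.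

Lemma pi_mul2 a b t : pi (wd [:: a; b] * t) = g a b * pi t.
Proof.
move: t; apply: tens_ind => [|u]; last by rewrite -wd_cons2 !pi_wd.
apply: (subsp_eq (f := fun t => pi (wd [:: a; b] * t)) (g := fun t => g a b * pi t)).
  by apply: (lin_comp (f := pi)); [exact: linearP|exact: mull_linear].
by apply: (lin_comp (f := fun x => g a b * x)); [exact: mull_linear|exact: linearP].
Qed.

Lemma pw_odd u : odd (size u) -> pw u = 0.
Proof.
by move: u; apply: word_ind2 => [|a|a b u IH] //=; rewrite negbK => /IH ->; rewrite mulr0.
Qed.

Lemma pi_even_mul u t : ~~ odd (size u) -> pi (wd u * t) = pi (wd u) * pi t.
Proof.
move: u; apply: word_ind2 => [|a|a b u IH] //=; first by rewrite wd_nil mul1r pi1 mul1r.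
by rewrite negbK => /IH h; rewrite wd_cons2 -mulrA !pi_mul2 h mulrA.
Qed.

Lemma pi_mul_even u t : ~~ odd (size u) -> pi (t * wd u) = pi t * pi (wd u).
Proof.
move=> su; move: t; apply: tens_ind => [|v].
  apply: (subsp_eq (f := fun t => pi (t * wd u)) (g := fun t => pi t * pi (wd u))).
    by apply: (lin_comp (f := pi)); [exact: linearP|exact: mulr_linear].
  by apply: (lin_comp (f := fun x => x * pi (wd u))); [exact: mulr_linear|exact: linearP].
have [sv|sv] := boolP (odd (size v)); last exact: pi_even_mul.
by rewrite -wd_cat !pi_wd (pw_odd sv) mul0r pw_odd // size_cat oddD sv (negbTE su).
Qed.

Lemma pi_D2 a b c d : pi (D a b (wd [:: c; d])) = g a b * g c d - g c d * g a b.
Proof.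
rewrite D2 g_comm !(linearD, linearN, linearZ) /= !pi_wd /= !mulr1.
by rewrite !scalerN.
Qed.

Lemma pi_D_mul2 a b c d t : pi (D a b (wd [:: c; d]) * t) = pi (D a b (wd [:: c; d])) * pi t.
Proof.
have : combo (fun u => size u = 2%N) (D a b (@wd F [:: c; d])).
  by apply: D_size_eq; apply: combo_wd.
apply: (combo_ind (fun s => pi (s * t) = pi s * pi t)).
  apply: (subsp_eq (f := fun s => pi (s * t)) (g := fun s => pi s * pi t)).
    by apply: (lin_comp (f := pi)); [exact: linearP|exact: mulr_linear].
  by apply: (lin_comp (f := fun x => x * pi t)); [exact: mulr_linear|exact: linearP].
by move=> u u2; apply: pi_even_mul; rewrite u2.
Qed.

Lemma pi_D a b t : pi (D a b t) = g a b * pi t - pi t * g a b.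
Proof.
move: t; apply: tens_ind.
  apply: (subsp_eq (f := fun t => pi (D a b t)) (g := fun t => g a b * pi t - pi t * g a b)).
    by apply: (lin_comp (f := pi)); exact: linearP.
  move=> c x y; rewrite (linearP pi) mulrDr mulrDl -!scalerAl -!scalerAr scalerBr opprD.
  by rewrite addrACA.
apply: word_ind2 => [|c|c d u IH].
- by rewrite D_nil linear0 wd_nil pi1 mulr1 mul1r subrr.
- rewrite D_lt actE linearB /= !linearZ /= !pi_wd /= mulr0 mul0r subrr.
  by rewrite ?oppr0 !scaler0 addr0.
rewrite wd_cons2 D_mul linearD /= pi_D_mul2 pi_D2 !pi_mul2 IH.
by rewrite mulrBl mulrBr !mulrA addrA subrK.
Qed.

Definition pull (I : ideal2 U) (t : tens) : Prop := ideal2_set I (pi t).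

Lemma ideal2_subsp (I : ideal2 U) : subsp (ideal2_set I).
Proof.
have [I0 ID Il Ir] := ideal2P I; split=> // a x y Ix Iy; apply: ID => //.
by rewrite -mulr_algl; apply: Il.
Qed.

Lemma pull_good I : good e (pull I).
Proof.
have [I0 ID Il Ir] := ideal2P I; have hI := ideal2_subsp I.
split.
- by apply: subsp_pre; [exact: linearP|].
- by move=> a b t It; rewrite /pull pi_mul2; apply: Il.
- by move=> a b t It; rewrite /pull pi_D; apply: subspB => //; [apply: Il|apply: Ir].
- by move=> u ou; rewrite /pull pi_wd pw_odd.
- move=> [|a [|b []]] // z _; rewrite /pull /rel1 mulrDl -scalerAl linearD linearZ /=.
  by rewrite !pi_mul2 scalerAl -mulrDl g_sym mul0r.
- move=> [|a [|b [|c [|d []]]]] // z _; rewrite /pull /rel2 !mulrBl 2!linearB /= pi_D_mul2 pi_D2.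
  rewrite (wd_cons2 F a b [:: c; d]) (wd_cons2 F c d [:: a; b]) -!mulrA !pi_mul2.
  by rewrite mulrBl !mulrA subrr.
Qed.

Hypothesis pi_surj : forall u, exists t, u = pi t.

Lemma push_two_sided (W : tens -> Prop) : good e W ->
  two_sided [set u | exists2 t, W t & u = pi t]%classic.
Proof.
move=> gW; have hW := good_sub gW.
have hP : subsp (fun u => exists2 t, W t & u = pi t).
  split; first by exists 0; [apply: subsp0|rewrite linear0].
  move=> a _ _ [t Wt ->] [t' Wt' ->]; exists (a *: t + t'); last by rewrite linearP.
  exact: hW.2.
split=> /=.
- exact: hP.1.
- exact: (subspD hP).
- move=> u _ [t Wt ->]; have [s ->] := pi_surj u; move: s.
  apply: tens_ind => [|v].
    apply: (subsp_pre (f := fun s => pi s * pi t)) hP.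
    by apply: (lin_comp (f := fun x => x * pi t)); [exact: mulr_linear|exact: linearP].
  have [sv|sv] := boolP (odd (size v)).
    by exists 0; [apply: subsp0|rewrite pi_wd pw_odd // mul0r linear0].
  by exists (wd v * t); [apply: (good_left_even gW)|rewrite pi_even_mul].
- move=> u _ [t Wt ->]; have [s ->] := pi_surj u; move: s.
  apply: tens_ind => [|v].
    apply: (subsp_pre (f := fun s => pi t * pi s)) hP.
    by apply: (lin_comp (f := fun x => pi t * x)); [exact: mull_linear|exact: linearP].
  have [sv|sv] := boolP (odd (size v)).
    by exists 0; [apply: subsp0|rewrite pi_wd pw_odd // mulr0 linear0].
  by exists (t * wd v); [apply: (good_right_even gW)|rewrite pi_mul_even].
Qed.

Definition push W (gW : good e W) : ideal2 U := Ideal2 (push_two_sided gW).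

Hypothesis pi_ker : forall W, good e W -> forall t, pi t = 0 -> W t.

Lemma pull_push W (gW : good e W) t : pull (push gW) t <-> W t.
Proof.
split=> [[t' Wt' E]|Wt]; last by exists t.
rewrite -[t](subrK t'); apply: subspD => //; first exact: good_sub gW.
by apply: (pi_ker gW); rewrite linearB /= E subrr.
Qed.

End PushPull.

(** * Realizations of a Lie algebra by letters, and the kernel of the map from words *)

Lemma lin_sum (F : fieldType) (M N : lmodType F) (f : M -> N) : linear f ->
  forall (I : Type) (r : seq I) (c : I -> F) (h : I -> M),
  f (\sum_(i <- r) c i *: h i) = \sum_(i <- r) c i *: f (h i).
Proof.
move=> fl I r c h; elim: r => [|i r IH]; last by rewrite !big_cons fl IH.
by rewrite !big_nil; have := fl (-1) 0 0; rewrite scaler0 addr0 => ->; rewrite scaleN1r addNr.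
Qed.

(* [rE a b] is the endomorphism [act e a b] of the natural representation, and
   [rs] lifts elements of L to antisymmetrized words of length two. *)
Record realization (F : fieldType) (e : F) (L : lieAlgType F) := Realization {
  rE : nat -> nat -> L;
  rE_sym : forall a b, rE a b + e *: rE b a = 0;
  rE_lie : forall a b c d, lie (rE a b) (rE c d) =
    om e b c *: rE a d - (e * om e a c) *: rE b d + (om e b d *: rE c a - (e * om e a d) *: rE c b);
  rs : {linear L -> tens F};
  rs_E : forall a b, rs (rE a b) = 2%:R^-1 *: (wd [:: a; b] - e *: wd [:: b; a]);
  rs_span : forall x, exists s : seq (F * (nat * nat)),
    rs x = \sum_(p <- s) p.1 *: wd [:: p.2.1; p.2.2] /\ x = \sum_(p <- s) p.1 *: rE p.2.1 p.2.2
}.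

Section Kernel.
Variables (F : fieldType) (e : F) (L : lieAlgType F) (r : realization e L).
Hypothesis char2 : 2%:R != 0 :> F.
Local Notation tens := (tens F).
Local Notation TL := {malg F[{fmonom L}]}.
Local Notation UL := (Uenv L : algType F).

Definition rg a b : UL := Uinj (rE r a b).

Lemma UinjZ (c : F) (x : L) : Uinj (c *: x) = c *: Uinj x :> UL.
Proof. exact: linearZ_LR. Qed.
Lemma UinjD (x y : L) : Uinj (x + y) = Uinj x + Uinj y :> UL. Proof. exact: linearD. Qed.
Lemma UinjN (x : L) : Uinj (- x) = - Uinj x :> UL. Proof. exact: linearN. Qed.
Lemma Uinj0 : Uinj 0 = 0 :> UL. Proof. exact: linear0. Qed.

Lemma rg_sym a b : rg a b + e *: rg b a = 0.
Proof. by rewrite /rg -UinjZ -UinjD rE_sym Uinj0. Qed.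

Lemma rg_comm a b c d : rg a b * rg c d - rg c d * rg a b =
  om e b c *: rg a d - (e * om e a c) *: rg b d + (om e b d *: rg c a - (e * om e a d) *: rg c b).
Proof. by rewrite /rg -Uinj_lie rE_lie !(UinjD, UinjN, UinjZ). Qed.

Local Notation pi := (pi rg).

Lemma pi_rs x t : pi (rs r x * t) = Uinj x * pi t.
Proof.
have [s [-> E]] := rs_span r x; rewrite E linear_sum !mulr_suml linear_sum.
by apply: eq_bigr => p _; rewrite -scalerAl !linearZ /= pi_mul2 -scalerAl.
Qed.

(** Lifts the presentation of U(L) on the free algebra over L to words ([pi_lam]). *)
Definition lam : TL -> tens := free_ext (rs r).

Lemma malg_ind (S : TL -> Prop) :
  (forall c (x y : TL), S x -> S y -> S (c *: x + y)) -> S 0 ->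
  (forall s : seq L, S (\prod_(x <- s) gen F x)) -> forall t, S t.
Proof.
move=> hS h0 hw t; rewrite (monalgE t).
elim: (finmap.enum_fset _) => [|k s IH]; first by rewrite big_nil.
rewrite big_cons.
have -> : << t@_k *g k >> = t@_k *: \prod_(x <- fmonom_val k) gen F x.
  rewrite -malg_word; apply/malgP => m.
  by rewrite [RHS]mcoeffZ [in RHS]mcoeffU [LHS]mcoeffU mulr_natr.
exact: hS.
Qed.

Lemma lam_lin c x y : lam (c *: x + y) = c *: lam x + lam y.
Proof. by rewrite /lam free_extD free_ext_scalable. Qed.
Lemma lam0 : lam 0 = 0. Proof. exact: raddf0. Qed.
Lemma lam1 : lam 1 = 1. Proof. exact: rmorph1. Qed.
Lemma lamM x y : lam (x * y) = lam x * lam y. Proof. exact: free_extM. Qed.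
Lemma lam_gen x : lam (gen F x) = rs r x. Proof. exact: free_ext_gen. Qed.

Lemma pi_lam t : pi (lam t) = Upi t.
Proof.
move: t; apply: malg_ind.
- move=> c x y hx hy; rewrite lam_lin linearP hx hy.
  by rewrite -Upi_scalable -raddfD.
- by rewrite lam0 linear0 raddf0.
elim=> [|x s IH]; first by rewrite big_nil lam1 pi1 rmorph1.
by rewrite big_cons lamM lam_gen pi_rs IH rmorphM.
Qed.

Lemma pi_surj u : exists t, u = pi t.
Proof. by have [x ->] := Upi_surj u; exists (lam x); rewrite pi_lam. Qed.

Section Good.
Variable W : tens -> Prop.
Hypothesis gW : good e W.
Let hW := good_sub gW.

Lemma good_rs_l x t : W t -> W (rs r x * t).
Proof.
move=> Wt; have [s [-> _]] := rs_span r x; rewrite mulr_suml; apply: subsp_sum => // p _.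
by rewrite -scalerAl; apply: subspZ => //; apply: (good_left gW).
Qed.

Lemma good_rs_r x t : W t -> W (t * rs r x).
Proof.
move=> Wt; have [s [-> _]] := rs_span r x; rewrite mulr_sumr; apply: subsp_sum => // p _.
by rewrite -scalerAr; apply: subspZ => //; apply: (good_right gW).
Qed.

Lemma good_lam_l x t : W t -> W (lam x * t).
Proof.
move=> Wt; move: x; apply: malg_ind.
- move=> c x y hx hy; rewrite lam_lin mulrDl -scalerAl; exact: (hW.2).
- by rewrite lam0 mul0r; apply: subsp0.
elim=> [|x s IH]; first by rewrite big_nil lam1 mul1r.
by rewrite big_cons lamM lam_gen -mulrA; apply: good_rs_l.
Qed.

Lemma good_lam_r x t : W t -> W (t * lam x).
Proof.
move=> Wt; move: x; apply: malg_ind.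
- move=> c x y hx hy; rewrite lam_lin mulrDr -scalerAr; exact: hW.2.
- by rewrite lam0 mulr0; apply: subsp0.
move=> s; elim: s t Wt => [|x s IH] t' Wt'; first by rewrite big_nil lam1 mulr1.
by rewrite big_cons lamM lam_gen mulrA; apply: IH; apply: good_rs_r.
Qed.

Lemma good_rel1_1 a b : W (wd [:: a; b] + e *: wd [:: b; a]).
Proof. by have := @good_rel1 F e W gW [:: a; b] [::] erefl; rewrite wd_nil mulr1. Qed.

Lemma good_rs_E a b : W (rs r (rE r a b) - wd [:: a; b]).
Proof.
rewrite rs_E (_ : _ - _ = - 2%:R^-1 *: (wd [:: a; b] + e *: wd [:: b; a])).
  by apply: subspZ => //; apply: good_rel1_1.
by apply: tens_eqP => w; rewrite !coefwE; field.
Qed.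

Lemma rsD x y : rs r (x + y) = rs r x + rs r y. Proof. exact: linearD. Qed.
Lemma rsN x : rs r (- x) = - rs r x. Proof. exact: linearN. Qed.
Lemma rsZ c x : rs r (c *: x) = c *: rs r x. Proof. exact: linearZ_LR. Qed.

(** By [rs_span] generators suffice. There it is [rel2], up to the differences between
    [rs r (rE r a b)] and [wd [:: a; b]], which are multiples of the antisymmetry relation. *)
Lemma good_rs_lie x y : W (rs r x * rs r y - rs r y * rs r x - rs r (lie x y)).
Proof.
have rsl : linear (rs r) by exact: linearP.
have [s [Er Ex]] := rs_span r x; have [s' [Er' Ey]] := rs_span r y.
rewrite [lie x y](_ : _ = \sum_(p <- s) p.1 *: lie (rE r p.2.1 p.2.2) y); last first.
  by rewrite {1}Ex (lin_sum (f := fun x => lie x y)) //; apply: lie_linearl.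
rewrite (lin_sum rsl) Er mulr_suml mulr_sumr -!sumrB; apply: subsp_sum => // p _.
rewrite -scalerAl -scalerAr -!scalerBr; apply: subspZ => //.
rewrite [X in lie _ X]Ey (lin_sum (lie_linearr _)) (lin_sum rsl) Er' mulr_suml mulr_sumr -!sumrB.
apply: subsp_sum => // q _; rewrite -scalerAl -scalerAr -!scalerBr; apply: subspZ => //.
case: p q => [_ [a b]] [_ [c d]] /=; rewrite rE_lie.
have := @good_rel2 F e W gW [:: a; b; c; d] [::] erefl; rewrite wd_nil mulr1 /rel2 D2 -!wd_cat /= => h1.
rewrite !(rsD, rsN, rsZ).
set x1 := wd [:: a, b, c, d & _] in h1 *; set x2 := wd [:: c, d, a, b & _] in h1 *.
set z := (X in W X) in h1; rewrite [X in W X](_ : _ = z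
  - (om e b c *: (rs r (rE r a d) - wd [:: a; d])
    - (e * om e a c) *: (rs r (rE r b d) - wd [:: b; d])
    + (om e b d *: (rs r (rE r c a) - wd [:: c; a])
    - (e * om e a d) *: (rs r (rE r c b) - wd [:: c; b])))).
  apply: (subspB hW) => //; apply: (subspD hW); apply: (subspB hW); apply: (subspZ hW);
  exact: good_rs_E.
by rewrite /z; apply: tens_eqP => w; rewrite !coefwE; ring.
Qed.

Lemma good_lam_env t : env_ideal t -> W (lam t).
Proof.
have hI : two_sided [set t : TL | W (lam t)]%classic.
  split=> /=.
  - by rewrite lam0; apply: subsp0.
  - by move=> x y Wx Wy; rewrite /lam free_extD; apply: subspD.
  - by move=> a x Wx; rewrite lamM; apply: good_lam_l.
  - by move=> a x Wx; rewrite lamM; apply: good_lam_r.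
move=> /asboolP /(_ (Ideal2 hI)); apply=> _ [[a [x [y ->]]]|[x [y ->]]] /=.
  by rewrite /lam free_ext_linear_rel linearP subrr; apply: subsp0.
by rewrite /lam free_ext_commutator_rel; apply: good_rs_lie.
Qed.

(** Modulo W every t equals [lam x] for some x that represents [pi t]. If [pi t] is zero, x lies in
    the ideal of relations of U(L), which [lam] maps into W. *)
Lemma pi_ker t : pi t = 0 -> W t.
Proof.
have [x [Ex Wx]] : exists x, Upi x = pi t /\ W (lam x - t).
  move: t; apply: tens_ind.
    split; first by exists 0; rewrite raddf0 linear0 lam0 subrr; split=> //; apply: subsp0.
    move=> c t t' [x [Ex Wx]] [x' [Ex' Wx']]; exists (c *: x + x').
    split; first by rewrite (linearP pi) -Ex -Ex' -Upi_scalable -raddfD.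
    by rewrite lam_lin opprD addrACA -scalerBr; apply: hW.2.
  apply: word_ind2 => [|a|a b u [x [Ex Wx]]].
  - exists 1; rewrite lam1 wd_nil pi1 rmorph1 subrr; split=> //; exact: subsp0.
  - exists 0; rewrite lam0 raddf0 pi_wd sub0r; split=> //; apply: subspN => //.
    exact: (good_odd gW).
  exists (gen F (rE r a b) * x); rewrite rmorphM /= Ex wd_cons2 pi_mul2; split=> //.
  rewrite lamM lam_gen.
  rewrite (_ : _ - _ = rs r (rE r a b) * (lam x - wd u) + (rs r (rE r a b) - wd [:: a; b]) * wd u).
    apply: subspD => //; first exact: good_rs_l.
    rewrite rs_E (_ : _ - _ = - 2%:R^-1 *: rel1 e [:: a; b]); last first.
      by apply: tens_eqP => w; rewrite !coefwE; field.
    by rewrite -scalerAl; apply: subspZ => //; apply: (good_rel1 gW).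
  by rewrite mulrBr mulrBl addrA subrK.
move=> t0; rewrite -[t](subKr (lam x)); apply: subspB => //; apply: good_lam_env.
have := (Upi_eq x 0).1; rewrite subr0; apply.
by rewrite raddf0 Ex.
Qed.

End Good.
End Kernel.

(** * Matrix realizations *)

Section Sums.
Variable F : fieldType.

Lemma sum_widen (V : lmodType F) n N (f : nat -> V) : (n <= N)%N ->
  (forall k, (n <= k)%N -> f k = 0) -> \sum_(k < N) f k = \sum_(k < n) f k.
Proof.
move=> nN f0; rewrite [RHS](big_ord_widen N f nN) [RHS]big_mkcond /=.
by apply: eq_bigr => k _; case: ltnP => // /f0.
Qed.

Lemma sum_delta (V : lmodType F) n a (f : nat -> V) : (a < n)%N ->
  \sum_(k < n) (a == k)%:R *: f k = f a.
Proof.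
move=> an; rewrite (bigD1 (Ordinal an)) //= eqxx scale1r big1 ?addr0 // => k ka.
have -> : (a == k) = false; last by rewrite scale0r.
by apply/negbTE; apply: contra ka => /eqP E; apply/eqP/val_inj.
Qed.

Lemma sum_delta1 n a (f : nat -> F) : (a < n)%N -> \sum_(k < n) (a == k)%:R * f k = f a.
Proof. exact: (@sum_delta F^o). Qed.

Lemma sum_prt (V : lmodType F) N (f : nat -> V) :
  \sum_(k < N.*2) f (prt k) = \sum_(k < N.*2) f k.
Proof.
elim: N => [|N IH]; first by rewrite !big_ord0.
rewrite doubleS !big_ord_recr /= IH -!addrA; congr (_ + _).
have -> : prt N.*2 = N.*2.+1 by rewrite /prt odd_double.
have -> : prt N.*2.+1 = N.*2 by rewrite /prt /= odd_double.
by rewrite addrC.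
Qed.

Lemma imul_fin n (X Y : imx F) i j : (forall k, (n <= k)%N -> X i k = 0) ->
  imul X Y i j = \sum_(k < n) X i k * Y k j.
Proof.
move=> X0; rewrite /imul -(fsbig_widen [set k | (k < n)%N]%classic) //=; last first.
  by move=> k [_ /= /negP]; rewrite -leqNgt => nk; rewrite X0 // mul0r.
by rewrite -fsbig_ord.
Qed.

End Sums.

(* The letter a is the vector with coordinates [h a i] in the standard basis, in
   which the form is [b]; [g] is the inverse transpose of [h]. *)
Section Data.
Variables (F : fieldType) (e : F) (C : mx_chain F) (b h g : nat -> nat -> F).
Hypothesis ee : e * e = 1.
Hypothesis char2 : 2%:R != 0 :> F.
Local Notation om := (om e).
Local Notation tens := (tens F).

Hypothesis h_block : forall a i, a./2 != i./2 -> h a i = 0.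
Hypothesis g_block : forall a i, a./2 != i./2 -> g a i = 0.
Hypothesis gh : forall N a c, (a < N.*2)%N -> (c < N.*2)%N ->
  \sum_(i < N.*2) g a i * h c i = (a == c)%:R.
Hypothesis hg : forall N i j, (i < N.*2)%N -> (j < N.*2)%N ->
  \sum_(a < N.*2) h a i * g a j = (i == j)%:R.
Hypothesis b_sym : forall i j, b i j = e * b j i.

(** The functional [om a] in standard coordinates ([bet_h]): [prt a] is the only letter on which it
    does not vanish, and [g] is the basis dual to [h]. *)
Definition bet a j := om a (prt a) * g (prt a) j.
Hypothesis hb : forall N a j, (a < N.*2)%N -> (j < N.*2)%N ->
  \sum_(k < N.*2) h a k * b k j = bet a j.

Definition supported n (X : imx F) := forall i j, ((n <= i) || (n <= j))%N -> X i j = 0.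
Definition skew N (X : imx F) := supported N.*2 X /\
  forall i j, (i < N.*2)%N -> (j < N.*2)%N ->
    \sum_(k < N.*2) X k i * b k j + \sum_(k < N.*2) b i k * X k j = 0.

Hypothesis C_skew : forall N X, skew N X -> in_chain_union C X.
Hypothesis skew_C : forall X, in_chain_union C X -> exists N, skew N X.

Definition Emx a c : imx F := fun i j => h a i * bet c j - e * (h c i * bet a j).

Lemma lt_half a i N : (a < N.*2)%N -> (N.*2 <= i)%N -> a./2 != i./2.
Proof.
move=> aN Ni; apply/eqP => E; have := odd_double_half a; have := odd_double_half i.
by rewrite E; case: (odd a); case: (odd i) => /=; lia.
Qed.

Lemma h_right0 a i N : (a < N.*2)%N -> (N.*2 <= i)%N -> h a i = 0.
Proof. by move=> aN Ni; apply: h_block; apply: lt_half aN Ni. Qed.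

Lemma even_double N : ~~ odd N.*2. Proof. by rewrite odd_double. Qed.

Lemma bet_right0 a i N : (a < N.*2)%N -> (N.*2 <= i)%N -> bet a i = 0.
Proof.
move=> aN Ni; rewrite /bet g_block ?mulr0 //.
by apply: (lt_half (N := N)) => //; apply: prt_lt => //; exact: even_double.
Qed.

Lemma bet_h N a c : (a < N.*2)%N -> (c < N.*2)%N -> \sum_(j < N.*2) bet a j * h c j = om a c.
Proof.
move=> aN cN; under eq_bigr => j _ do rewrite /bet -mulrA.
rewrite -mulr_sumr gh //; last by apply: prt_lt => //; exact: even_double.
by have [<-|ne] := eqVneq (prt a) c; rewrite ?mulr1 // mulr0 om_neq0 // eq_sym.
Qed.

Lemma Emx_supported N a c : (a < N.*2)%N -> (c < N.*2)%N -> supported N.*2 (Emx a c).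
Proof.
move=> aN cN i j /orP[Ni|Nj]; rewrite /Emx.
  by rewrite !(h_right0 _ Ni) // !mul0r mulr0 subrr.
by rewrite !(bet_right0 _ Nj) // !mulr0 subrr.
Qed.

Lemma Emx_skew N a c : (a < N.*2)%N -> (c < N.*2)%N -> skew N (Emx a c).
Proof.
move=> aN cN; split; first exact: Emx_supported.
move=> i j iN jN.
have S1 x y : (x < N.*2)%N -> \sum_(k < N.*2) h x k * bet y i * b k j = bet y i * bet x j.
  by move=> xN; rewrite -(hb xN jN) mulr_sumr; apply: eq_bigr => k _; ring.
have S2 x y : (x < N.*2)%N -> \sum_(k < N.*2) b i k * (h x k * bet y j) = e * bet x i * bet y j.
  move=> xN; rewrite -(hb xN iN) mulr_sumr mulr_suml; apply: eq_bigr => k _.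
  by rewrite (b_sym i k); ring.
have -> : \sum_(k < N.*2) Emx a c k i * b k j = bet c i * bet a j - e * (bet a i * bet c j).
  rewrite -!S1 // mulr_sumr -sumrB; apply: eq_bigr => k _; rewrite /Emx; ring.
have -> : \sum_(k < N.*2) b i k * Emx a c k j = e * bet a i * bet c j - e * (e * bet c i * bet a j).
  rewrite -!S2 // mulr_sumr -sumrB; apply: eq_bigr => k _; rewrite /Emx; ring.
by ring: ee.
Qed.

Lemma ex_bound2 a c : exists N, (a < N.*2)%N /\ (c < N.*2)%N.
Proof. by exists (a + c).+1; lia. Qed.

Lemma Emx_in a c : in_chain_union C (Emx a c).
Proof. by have [N [aN cN]] := ex_bound2 a c; apply: C_skew (Emx_skew aN cN). Qed.

Definition cE a c : chain_union C := ChainUnion (Emx_in a c).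

Lemma cE_sym a c : cE a c + e *: cE c a = 0.
Proof.
apply: val_inj; apply/funext => i; apply/funext => j.
rewrite -[LHS]/(Emx a c i j + e * Emx c a i j) -[RHS]/(0 : F) /Emx.
by ring: ee.
Qed.

Lemma imul_Emx a c a' c' i j : imul (Emx a c) (Emx a' c') i j =
  om c a' * h a i * bet c' j - e * om c c' * h a i * bet a' j
  - e * om a a' * h c i * bet c' j + om a c' * h c i * bet a' j.
Proof.
pose N := (a + c + a' + c').+1.
have aN : (a < N.*2)%N by rewrite /N; lia.
have cN : (c < N.*2)%N by rewrite /N; lia.
have aN' : (a' < N.*2)%N by rewrite /N; lia.
have cN' : (c' < N.*2)%N by rewrite /N; lia.
rewrite (@imul_fin _ N.*2); last by move=> k Nk; apply: (Emx_supported aN cN); rewrite Nk orbT.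
rewrite -(bet_h cN aN') -(bet_h cN cN') -(bet_h aN aN') -(bet_h aN cN').
rewrite !(mulr_suml, mulr_sumr) -!sumrB -big_split; apply: eq_bigr => k _ /=.
by rewrite /Emx; ring: ee.
Qed.

Lemma cE_lie a c a' c' : lie (cE a c) (cE a' c') =
    om c a' *: cE a c' - (e * om a a') *: cE c c' + (om c c' *: cE a' a - (e * om a c') *: cE a' c).
Proof.
apply: val_inj; apply/funext => i; apply/funext => j.
rewrite -[LHS]/(imul (Emx a c) (Emx a' c') i j - imul (Emx a' c') (Emx a c) i j).
rewrite -[RHS]/(om c a' * Emx a c' i j - (e * om a a') * Emx c c' i j + (om c c' * Emx a' a i j - (e * om a c') * Emx a' c i j)).
rewrite !imul_Emx (om_sym ee c' a) (om_sym ee c' c) (om_sym ee a' a) (om_sym ee a' c) /Emx.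
by ring: ee.
Qed.

(* The matrix of X in the basis of letters. *)
Definition coord N (X : imx F) a u : F :=
  \sum_(i < N.*2) \sum_(j < N.*2) g a i * X i j * h u j.

Lemma coord_widen N N' X a u : supported N.*2 X -> (N <= N')%N -> coord N' X a u = coord N X a u.
Proof.
move=> X0 NN; rewrite /coord.
rewrite (@sum_widen F F^o N.*2 N'.*2 (fun i => \sum_(j < N'.*2) g a i * X i j * h u j)) ?leq_double //.
  apply: eq_bigr => i _.
  rewrite (@sum_widen F F^o N.*2 N'.*2 (fun j => g a i * X i j * h u j)) ?leq_double //.
  by move=> k Nk; rewrite X0 ?Nk ?orbT // mulr0 mul0r.
by move=> k Nk; apply: big1 => j _; rewrite X0 ?Nk // mulr0 mul0r.
Qed.

Lemma g_left0 a i N : (i < N.*2)%N -> (N.*2 <= a)%N -> g a i = 0.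
Proof. by move=> iN Na; apply: g_block; rewrite eq_sym; apply: lt_half iN Na. Qed.
Lemma h_left0 a i N : (i < N.*2)%N -> (N.*2 <= a)%N -> h a i = 0.
Proof. by move=> iN Na; apply: h_block; rewrite eq_sym; apply: lt_half iN Na. Qed.

Lemma coord0 N X a u : ((N.*2 <= a) || (N.*2 <= u))%N -> coord N X a u = 0.
Proof.
move=> h1; apply: big1 => i _; apply: big1 => j _; case/orP: h1 => h1.
  by rewrite (g_left0 _ h1) ?mul0r.
by rewrite (h_left0 _ h1) ?mulr0.
Qed.

(** X is the sum of its coordinates times the endomorphisms that send a letter u to a and kill the
    other letters. The functional dual to u is [om (prt u) u] times [bet (prt u)], so such an
    endomorphism becomes a multiple of the word a [prt u]. The factor 1/2 compensates the
    antisymmetrization in [Emx]. *)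
Definition cs N (X : imx F) : tens :=
  2%:R^-1 *: \sum_(a < N.*2) \sum_(u < N.*2)
    (coord N X a u * om (prt u) u) *: wd [:: nat_of_ord a; prt u].

Lemma cs_widen N N' X : supported N.*2 X -> (N <= N')%N -> cs N' X = cs N X.
Proof.
move=> X0 NN; rewrite /cs; congr (_ *: _).
rewrite (@sum_widen F tens N.*2 N'.*2 (fun a => \sum_(u < N'.*2)
  (coord N' X a u * om (prt u) u) *: wd [:: a; prt u])) ?leq_double //.
  apply: eq_bigr => a _.
  rewrite (@sum_widen F tens N.*2 N'.*2 (fun u =>
    (coord N' X a u * om (prt u) u) *: wd [:: nat_of_ord a; prt u])) ?leq_double //.
    by apply: eq_bigr => u _; rewrite (coord_widen _ _ X0).
  by move=> u Nu; rewrite (coord_widen _ _ X0) // coord0 ?Nu ?orbT // mul0r scale0r.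
move=> a Na; apply: big1 => u _; rewrite (coord_widen _ _ X0) // coord0 ?Na //.
by rewrite mul0r scale0r.
Qed.

Lemma ex_N (x : chain_union C) : exists N, `[< skew N (val x) >].
Proof. by have [N h1] := skew_C (valP x); exists N; apply/asboolP. Qed.

Definition cN x := ex_minn (ex_N x).
Lemma cNP x : skew (cN x) (val x).
Proof. by rewrite /cN; case: ex_minnP => N /asboolP. Qed.

Definition crs (x : chain_union C) : tens := cs (cN x) (val x).

Lemma crsE N x : supported N.*2 (val x) -> crs x = cs N (val x).
Proof.
move=> xN; have [xN' _] := cNP x; rewrite /crs.
by rewrite -(cs_widen (N' := maxn N (cN x)) xN) ?leq_maxl // -(cs_widen (N' := maxn N (cN x)) xN') // leq_maxr.
Qed.

Lemma supported_le N N' X : (N <= N')%N -> supported N X -> supported N' X.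
Proof.
by move=> NN h1 i j h2; apply: h1; case/orP: h2 => /(leq_trans NN) ->; rewrite ?orbT.
Qed.

Lemma imx_linE c (X Y : imx F) i j : (c *: X + Y) i j = c * (X i j : F) + (Y i j : F) :> F.
Proof. exact: erefl. Qed.

Lemma crs_linear : linear crs.
Proof.
move=> c x y; pose N := maxn (cN x) (cN y).
have sx : supported N.*2 (val x).
  by apply: supported_le (cNP x).1; rewrite leq_double leq_maxl.
have sy : supported N.*2 (val y).
  by apply: supported_le (cNP y).1; rewrite leq_double leq_maxr.
have sxy : supported N.*2 (val (c *: x + y)).
  by move=> i j ij; rewrite valP_linear imx_linE (sx i j ij) (sy i j ij) mulr0 addr0.
rewrite (crsE sx) (crsE sy) (crsE sxy) /cs scalerA mulrC -scalerA -scalerDr; congr (_ *: _).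
rewrite scaler_sumr -big_split; apply: eq_bigr => a _ /=.
rewrite scaler_sumr -big_split; apply: eq_bigr => u _ /=.
rewrite scalerA -scalerDl mulrA -mulrDl; congr (_ * _ *: _).
rewrite /coord mulr_sumr -big_split; apply: eq_bigr => i _ /=.
rewrite mulr_sumr -big_split; apply: eq_bigr => j _ /=.
by rewrite imx_linE; ring.
Qed.

HB.instance Definition _ := GRing.isLinear.Build F (chain_union C) tens *:%R crs crs_linear.

Lemma coord_Emx N a c x u : (a < N.*2)%N -> (c < N.*2)%N -> (x < N.*2)%N -> (u < N.*2)%N ->
  coord N (Emx a c) x u = (a == x)%:R * om c u - e * (c == x)%:R * om a u.
Proof.
move=> aN cN xN uN; rewrite ![_ == x]eq_sym -(bet_h cN uN) -(bet_h aN uN) -(gh xN aN) -(gh xN cN).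
rewrite -mulrA !big_distrlr mulr_sumr -sumrB; apply: eq_bigr => i _ /=.
by rewrite mulr_sumr -sumrB; apply: eq_bigr => j _; rewrite /Emx; ring.
Qed.

Lemma cs_Emx N a c : (a < N.*2)%N -> (c < N.*2)%N ->
  cs N (Emx a c) = 2%:R^-1 *: (wd [:: a; c] - e *: wd [:: c; a]).
Proof.
move=> aN cN; rewrite /cs; congr (_ *: _).
have S x y : (y < N.*2)%N ->
    \sum_(u < N.*2) (om y u * om (prt u) u) *: wd [:: x; prt u] = wd [:: x; y] :> tens.
  move=> yN; under eq_bigr => u _ do rewrite -scalerA.
  rewrite (@sum_om F e tens N.*2 y (fun u => om (prt u) u *: wd [:: x; prt u])) ?odd_double //.
  by have := om_prtl ee (prt y); rewrite scalerA !prtK => ->; rewrite scale1r.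
transitivity (\sum_(x < N.*2) ((a == x)%:R *: wd [:: nat_of_ord x; c] -
    (c == x)%:R *: (e *: wd [:: nat_of_ord x; a])) : tens).
  apply: eq_bigr => x _; rewrite -(S x c) // -(S x a) // !scaler_sumr -sumrB.
  apply: eq_bigr => u _; rewrite coord_Emx // !scalerA -scalerBl; congr (_ *: _); ring.
rewrite sumrB (@sum_delta F tens N.*2 a (fun x => wd [:: x; c])) //.
by rewrite (@sum_delta F tens N.*2 c (fun x => e *: wd [:: x; a])).
Qed.

Lemma crs_cE a c : crs (cE a c) = 2%:R^-1 *: (wd [:: a; c] - e *: wd [:: c; a]).
Proof.
have [N [aN cN]] := ex_bound2 a c; rewrite (@crsE N) ?cs_Emx //; exact: Emx_supported.
Qed.

Lemma coordK N X i j : (i < N.*2)%N -> (j < N.*2)%N ->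
  \sum_(a < N.*2) \sum_(u < N.*2) coord N X a u * (h a i * g u j) = X i j.
Proof.
move=> iN jN; pose hs i j : F := \sum_(a < N.*2) h a i * g a j.
transitivity (\sum_(k < N.*2) \sum_(l < N.*2) hs i k * (X k l * hs l j)); last first.
  transitivity (\sum_(k < N.*2) (i == k)%:R * (X k j : F)).
    apply: eq_bigr => k _; rewrite -mulr_sumr /hs hg //; congr (_ * _).
    rewrite -(@sum_delta1 F N.*2 j (fun l => X k l)) //; apply: eq_bigr => l _.
    by rewrite hg // mulrC eq_sym.
  by rewrite (@sum_delta1 F N.*2 i (fun k => X k j)).
under eq_bigr => a _ do under eq_bigr => u _ do
  (rewrite /coord mulr_suml; under eq_bigr => k _ do rewrite mulr_suml).
under eq_bigr => a _ do rewrite exchange_big.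
rewrite exchange_big; apply: eq_bigr => k _ /=.
under eq_bigr => a _ do rewrite exchange_big.
rewrite exchange_big; apply: eq_bigr => l _ /=.
rewrite /hs mulr_suml; apply: eq_bigr => a _; rewrite !mulr_sumr; apply: eq_bigr => u _; ring.
Qed.

Lemma coord_skew N X u v : skew N X -> (u < N.*2)%N -> (v < N.*2)%N ->
  e * om v (prt v) * coord N X (prt v) u + om u (prt u) * coord N X (prt u) v = 0.
Proof.
move=> [_ hX] uN vN.
have S1 : e * om v (prt v) * coord N X (prt v) u =
    \sum_(i < N.*2) \sum_(j < N.*2) (\sum_(k < N.*2) X k i * b k j) * (h u i * h v j).
  transitivity (\sum_(k < N.*2) \sum_(i < N.*2) e * bet v k * X k i * h u i).
    rewrite /coord mulr_sumr; apply: eq_bigr => k _; rewrite mulr_sumr; apply: eq_bigr => i _.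
    by rewrite /bet; ring.
  rewrite exchange_big; apply: eq_bigr => i _ /=.
  under [RHS]eq_bigr => j _ do rewrite mulr_suml.
  rewrite [RHS]exchange_big; apply: eq_bigr => k _ /=.
  rewrite -(hb vN (ltn_ord k)) mulr_sumr !mulr_suml; apply: eq_bigr => j _.
  by rewrite (b_sym k j); ring.
have S2 : om u (prt u) * coord N X (prt u) v =
    \sum_(i < N.*2) \sum_(j < N.*2) (\sum_(k < N.*2) b i k * X k j) * (h u i * h v j).
  transitivity (\sum_(k < N.*2) \sum_(j < N.*2) bet u k * X k j * h v j).
    rewrite /coord mulr_sumr; apply: eq_bigr => k _; rewrite mulr_sumr; apply: eq_bigr => i _.
    by rewrite /bet; ring.
  rewrite exchange_big [RHS]exchange_big; apply: eq_bigr => j _ /=.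
  under [RHS]eq_bigr => i _ do rewrite mulr_suml.
  rewrite [RHS]exchange_big; apply: eq_bigr => k _ /=.
  by rewrite -(hb uN (ltn_ord k)) !mulr_suml; apply: eq_bigr => i _; ring.
rewrite S1 S2 -big_split big1 // => i _; rewrite -big_split big1 // => j _ /=.
by rewrite -mulrDl hX // mul0r.
Qed.

Lemma val_sumE (I : Type) (r : seq I) (c : I -> F) (y : I -> chain_union C) i j :
  val (\sum_(p <- r) c p *: y p) i j = \sum_(p <- r) c p * (val (y p) i j : F).
Proof.
elim: r => [|p r IH]; first by rewrite !big_nil.
by rewrite !big_cons -IH -[RHS]imx_linE.
Qed.

Lemma sum_iota2 (V : lmodType F) n (f : nat -> nat -> V) :
  \sum_(p <- [seq (a, u) | a <- iota 0 n, u <- iota 0 n]) f p.1 p.2 =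
  \sum_(a < n) \sum_(u < n) f a u.
Proof.
rewrite big_allpairs_dep -(big_mkord xpredT (fun a => \sum_(u < n) f a u)) /index_iota subn0.
by apply: eq_bigr => a _; rewrite -(big_mkord xpredT (f a)) /index_iota subn0.
Qed.

Lemma coord_expand N X : skew N X -> X = (fun i j => \sum_(a < N.*2) \sum_(u < N.*2)
  2%:R^-1 * (coord N X a u * om (prt u) u) * Emx a (prt u) i j).
Proof.
move=> sX; apply/funext => i; apply/funext => j; have [X0 _] := sX.
have pN u : (u < N.*2)%N -> (prt u < N.*2)%N by apply: prt_lt; rewrite odd_double.
have [ij|/norP[]] := boolP ((N.*2 <= i) || (N.*2 <= j))%N.
  rewrite X0 // big1 // => a _; rewrite big1 // => u _.
  by rewrite (Emx_supported (N := N)) ?mulr0 ?pN.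
rewrite -!ltnNge => iN jN.
have om2 u : om u (prt u) * om u (prt u) = 1 by have := om_prtl ee (prt u); rewrite prtK.
(* The two halves of [Emx] sum to X separately: the first by [coordK], the second by [coord_skew]
   after renaming letters to their partners. This accounts for the factor 1/2. *)
have E2 : \sum_(a < N.*2) \sum_(u < N.*2) - e * (coord N X a u * om (prt u) u *
    (h (prt u) i * (om a (prt a) * g (prt a) j))) = X i j.
  rewrite -(coordK X iN jN) [RHS]exchange_big.
  rewrite -(@sum_prt F F^o N (fun a => \sum_(u < N.*2) coord N X u a * (h u i * g a j))).
  apply: eq_bigr => a _.
  rewrite -(@sum_prt F F^o N (fun u => coord N X u (prt a) * (h u i * g (prt a) j))).
  apply: eq_bigr => u _.
  have := coord_skew sX (pN _ (ltn_ord a)) (ltn_ord u).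
  rewrite prtK (om_sym ee (prt a) a) (om_sym ee (prt u) u) => /(congr1 (fun z => om u (prt u) * z)).
  rewrite mulr0 => h1.
  have -> : coord N X (prt u) (prt a) = - om a (prt a) * om u (prt u) * coord N X a u.
    apply/eqP; rewrite -subr_eq0; apply/eqP.
    transitivity (e * 0); last by rewrite mulr0.
    by rewrite -h1; ring: (om2 u) ee.
  by ring: ee.
have -> : X i j = 2%:R^-1 * (X i j + X i j) by field.
rewrite -{1}(coordK X iN jN) -{1}E2 -big_split mulr_sumr; apply: eq_bigr => a _ /=.
rewrite -big_split mulr_sumr; apply: eq_bigr => u _ /=.
by rewrite /Emx /bet prtK; ring: (om_prtl ee u).
Qed.

Lemma crs_span x : exists s : seq (F * (nat * nat)),
  crs x = \sum_(p <- s) p.1 *: wd [:: p.2.1; p.2.2] /\ x = \sum_(p <- s) p.1 *: cE p.2.1 p.2.2.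
Proof.
pose N := cN x; pose co a u := 2%:R^-1 * (coord N (val x) a u * om (prt u) u).
exists [seq (co p.1 p.2, (p.1, prt p.2)) | p <- [seq (a, u) | a <- iota 0 N.*2, u <- iota 0 N.*2]].
rewrite !big_map; split.
  rewrite (@sum_iota2 tens N.*2 (fun a u => co a u *: wd [:: a; prt u])) /crs /cs scaler_sumr.
  by apply: eq_bigr => a _; rewrite scaler_sumr; apply: eq_bigr => u _; rewrite scalerA.
apply: val_inj; rewrite {1}(coord_expand (cNP x)); apply/funext => i; apply/funext => j.
rewrite val_sumE.
by rewrite (@sum_iota2 F^o N.*2 (fun a u => co a u * (Emx a (prt u) i j : F))).
Qed.

Definition chain_realization : realization e (chain_union C) :=
  @Realization F e (chain_union C) cE cE_sym cE_lie crs crs_cE crs_span.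

End Data.

(** * The symplectic and the orthogonal Lie algebra as realizations *)

Section FormSkew.
Variables (F : fieldType) (b : nat -> nat -> F).
Local Notation gram N := (\matrix_(i < N.*2, j < N.*2) b i j).

Lemma skew_form N X : skew b N X ->
  exists2 M : 'M[F]_(N.*2), M \in form_lie (gram N) & X = ext_mx M.
Proof.
move=> [X0 hX]; exists (\matrix_(i, j) (X i j : F)).
  rewrite inE; apply/eqP/matrixP => i j; rewrite !mxE -[RHS](hX i j) //.
  by congr (_ + _); apply: eq_bigr => k _; rewrite !mxE.
apply/esym/ext_mxP => i j; first by rewrite mxE.
  by move=> Ni; rewrite X0 ?Ni.
by move=> Nj; rewrite X0 ?Nj ?orbT.
Qed.

Lemma form_skew N (M : 'M[F]_(N.*2)) : M \in form_lie (gram N) -> skew b N (ext_mx M).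
Proof.
rewrite inE => /eqP/matrixP hM; split=> [i j /orP[]|i j iN jN].
- exact: ext_mx_outl.
- exact: ext_mx_outr.
have := hM (Ordinal iN) (Ordinal jN); rewrite !mxE => E; rewrite -[RHS]E.
by congr (_ + _); apply: eq_bigr => k _; rewrite !mxE -ext_mxE.
Qed.

End FormSkew.

Section Symplectic.
Variable F : fieldType.
Hypothesis char2 : 2%:R != 0 :> F.

Definition delta (i j : nat) : F := (i == j)%:R.

(** The standard basis is already hyperbolic for [symp_entry], with the same numbering of pairs, so
    letters are standard basis vectors. *)
Lemma symp_realization : realization (-1) (sp_inf F).
Proof.
apply: (@chain_realization F (-1) (symp_chain F) (@symp_entry F) delta delta) => //.
- by rewrite mulrNN mulr1.
- by move=> a i; rewrite /delta; case: (eqVneq a i) => // ->; rewrite eqxx.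
- by move=> a i; rewrite /delta; case: (eqVneq a i) => // ->; rewrite eqxx.
- by move=> N a c aN cN; rewrite (@sum_delta1 F N.*2 a (delta c)) // /delta eq_sym.
- move=> N i j iN jN; rewrite /delta -(@sum_delta1 F N.*2 i (fun a => (a == j)%:R)) //.
  by apply: eq_bigr => a _; rewrite [i == _]eq_sym.
- move=> i j; rewrite /symp_entry mulN1r.
  have : ~~ ((~~ odd i && (j == i.+1)) && (~~ odd j && (i == j.+1))) by lia.
  by case: (~~ odd i && _); case: (~~ odd j && _); rewrite ?opprK ?oppr0.
- move=> N a j aN jN; rewrite (@sum_delta1 F N.*2 a (fun k => symp_entry F k j)) //.
  rewrite /bet /om eqxx /delta /symp_entry /prt.
  case: (boolP (odd a)) => oa /=.
    have -> : ~~ odd j && (a == j.+1) = (a.-1 == j) by lia.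
    by case: eqP; rewrite ?mulr1 ?mulr0.
  have -> : ~~ odd j && (a == j.+1) = false by lia.
  by rewrite eq_sym mul1r; case: eqP.
- move=> N X /skew_form [M hM ->]; apply/asboolP; exists N, M; split=> //.
- move=> X /asboolP [N [M [hM ->]]]; exists N; exact: form_skew.
Qed.

End Symplectic.

Section Orthogonal.
Variables (F : fieldType) (I : F).
Hypothesis char2 : 2%:R != 0 :> F.
Hypothesis II : I * I = -1.

Lemma sum_block N (f : nat -> F) a : (a < N.*2)%N ->
  (forall i, a./2 != i./2 -> f i = 0) -> \sum_(i < N.*2) f i = f a + f (prt a).
Proof.
elim: N => [//|N IH] aN f0; rewrite doubleS !big_ord_recr /=.
have [E|ne] := eqVneq a./2 N; last first.
  rewrite IH //; last by lia.
  rewrite !(f0 N.*2) ?(f0 N.*2.+1) ?addr0 //; lia.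
rewrite big1 ?add0r => [|i _]; last by apply: f0; case: i => i /= iN; lia.
rewrite /prt; case: ifP => oa.
  have -> : a = N.*2.+1 by lia.
  by rewrite addrC.
by have -> : a = N.*2 by lia.
Qed.

(* Row [a] is the letter [a] in the standard orthonormal basis: the letters
   2k and 2k+1 are the isotropic vectors v + I w and (v - I w) / 2 for the k-th
   pair (v, w) of basis vectors. *)
Definition hyp (a i : nat) : F :=
  if a./2 == i./2 then
    (if odd a then (if odd i then - I / 2%:R else 2%:R^-1)
     else (if odd i then I else 1))
  else 0.

Lemma half_prt a : (prt a)./2 = a./2.
Proof. by rewrite /prt; case: ifP; lia. Qed.

Lemma hyp_block a i : a./2 != i./2 -> hyp a i = 0.
Proof. by rewrite /hyp => /negbTE ->. Qed.

Lemma hyp_gram N a c : (a < N.*2)%N -> (c < N.*2)%N ->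
  \sum_(i < N.*2) hyp (prt a) i * hyp c i = (a == c)%:R.
Proof.
move=> aN cN; rewrite (@sum_block N (fun i => hyp (prt a) i * hyp c i) a) //; last first.
  by move=> i ai; rewrite hyp_block ?mul0r // half_prt.
rewrite /hyp !half_prt !odd_prt eqxx.
case: (eqVneq c./2 a./2) => E; last first.
  by rewrite !mulr0 addr0; case: eqVneq => // h1; rewrite h1 eqxx in E.
have -> : (a == c) = (odd a == odd c) by apply/eqP/eqP => [-> //|]; lia.
by case: (odd a); case: (odd c) => /=; field: II; rewrite ?char2.
Qed.

Lemma hyp_gram' N i j : (i < N.*2)%N -> (j < N.*2)%N ->
  \sum_(a < N.*2) hyp a i * hyp (prt a) j = (i == j)%:R.
Proof.
move=> aN cN; rewrite (@sum_block N (fun a => hyp a i * hyp (prt a) j) i) //; last first.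
  by move=> a ai; rewrite hyp_block ?mul0r // eq_sym.
rewrite prtK /hyp !half_prt !odd_prt eqxx.
case: (eqVneq i./2 j./2) => E; last first.
  by rewrite !mulr0 addr0; case: eqVneq => // h1; rewrite h1 eqxx in E.
have -> : (i == j) = (odd i == odd j) by apply/eqP/eqP => [-> //|]; lia.
by case: (odd i); case: (odd j) => /=; field: II; rewrite ?char2.
Qed.

Lemma orth_realization : realization 1 (o_inf F).
Proof.
have E N : 1%:M = \matrix_(i < N.*2, j < N.*2) (delta F i j).
  by apply/matrixP => i j; rewrite !mxE.
(* The form is the standard dot product, for which the basis dual to a hyperbolic basis consists of
   the partners. *)
apply: (@chain_realization F 1 (orth_chain F) (delta F) hyp (fun a => hyp (prt a))) => //.
- by rewrite mulr1.
- exact: hyp_block.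
- by move=> a i ai; rewrite hyp_block ?half_prt.
- exact: hyp_gram.
- exact: hyp_gram'.
- by move=> i j; rewrite mul1r /delta eq_sym.
- move=> N a j aN jN; rewrite /bet prtK /om eqxx if_same mul1r.
  rewrite -[RHS](@sum_delta1 F N.*2 j (hyp a)) //; apply: eq_bigr => k _.
  by rewrite mulrC /delta eq_sym.
- move=> N X /skew_form [M hM ->]; apply/asboolP; exists N.*2, M; split=> //.
  by rewrite -E in hM.
- move=> X /asboolP [n [M [hM ->]]].
  (* Letters come in pairs, so a matrix of possibly odd size n is enlarged to size 2n. *)
  have n2 : (n <= n.*2)%N by lia.
  have [M' hM' ->] := @chain_union_corner F (orth_chain F) _ _ M n2 hM.
  by exists n; apply: form_skew; rewrite -E.
Qed.

End Orthogonal.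

(** * The lattice isomorphism *)

Section IdealTransfer.
Variable F : fieldType.
Hypothesis charF0 : [pchar F] =i pred0.

Let char2 : 2%:R != 0 :> F.
Proof. by rewrite (pcharf0P F).1. Qed.

Section Realized.
Variables (e : F) (L : lieAlgType F) (r : realization e L).

Definition rpull (I : ideal2 (Uenv L)) : tens F -> Prop := @pull F (Uenv L : algType F) (rg r) I.

Lemma rpull_good I : good e (rpull I).
Proof. exact: (pull_good (rg_sym r) (rg_comm r)). Qed.

Definition rpush W (gW : good e W) : ideal2 (Uenv L) := push (pi_surj r) gW.

Lemma rpull_push W (gW : good e W) t : rpull (rpush gW) t <-> W t.
Proof. exact: (pull_push _ (pi_ker char2)). Qed.

Lemma rpull_le I J : (I <= J)%O <-> forall t, rpull I t -> rpull J t.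
Proof.
split=> [/ideal2_leP h t|h]; first exact: h.
by apply/ideal2_leP => u; have [t ->] := pi_surj r u; apply: h.
Qed.

End Realized.

Lemma rpull_inj (e : F) (L : lieAlgType F) (r : realization e L) I J :
  (forall t, rpull r I t <-> rpull r J t) -> I = J.
Proof. by move=> h; apply/le_anti/andP; split; apply/(rpull_le r) => t /h. Qed.

Section Maps.
Variables (e e' : F) (L L' : lieAlgType F).
Variables (r : realization e L) (r' : realization e' L').
Hypotheses (ee : e * e = 1) (E : e' = - e).

Lemma Psi_good' W : good e W -> good e' (Psi e W).
Proof. by move=> gW; rewrite E; apply: (Psi_good ee). Qed.

Definition transfer (I : ideal2 (Uenv L)) : ideal2 (Uenv L') :=
  rpush r' (Psi_good' (rpull_good r I)).

Lemma rpull_transfer I t : rpull r' (transfer I) t <-> Psi e (rpull r I) t.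
Proof. exact: rpull_push. Qed.

Lemma transfer_homo I J : (I <= J)%O -> (transfer I <= transfer J)%O.
Proof.
move=> /(rpull_le r) IJ; apply/(rpull_le r') => t /rpull_transfer h.
by apply/rpull_transfer; apply: (Psi_mono IJ) h.
Qed.

End Maps.

Lemma transferK (e e' : F) (L L' : lieAlgType F) (r : realization e L)
    (r' : realization e' L') (ee : e * e = 1) (ee' : e' * e' = 1) (E : e' = - e) (E' : e = - e') :
  cancel (transfer r r' ee E) (transfer r' r ee' E').
Proof.
move=> I; apply: (@rpull_inj _ _ r) => t; rewrite rpull_transfer.
have gI := rpull_good r I.
split=> [h|h].
  apply: (Psi_Psi_sub ee charF0 (good_sub gI) (good_D gI)); rewrite -E.
  by apply: (Psi_mono _ h) => s /rpull_transfer.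
have := sub_Psi_Psi ee charF0 (good_sub gI) (good_D gI) h; rewrite -E.
by apply: Psi_mono => s hs; apply/rpull_transfer.
Qed.

End IdealTransfer.

Lemma order_iso_lmorphism d d' (T : latticeType d) (T' : latticeType d')
    (f : T -> T') (g : T' -> T) : {homo f : x y / (x <= y)%O} -> {homo g : x y / (x <= y)%O} ->
  cancel f g -> cancel g f -> exists h : {lmorphism T -> T'}, bijective h.
Proof.
move=> fh gh fK gK.
have fm x y : (f x <= y)%O = (x <= g y)%O.
  by apply/idP/idP => [/gh|/fh]; rewrite ?fK ?gK.
have gm x y : (y <= f x)%O = (g y <= x)%O.
  by apply/idP/idP => [/gh|/fh]; rewrite ?fK ?gK.
have fI : Order.meet_morphism f.
  by move=> x y; apply/eqP; rewrite eq_le lexI !fh ?leIl ?leIr //= gm lexI -!gm leIl leIr.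
have fU : Order.join_morphism f.
  by move=> x y; apply/eqP; rewrite eq_le leUx !fh ?leUl ?leUr ?andbT //= fm leUx -!fm leUl leUr.
pose m1 := Order.isOrderMorphism.Build d T d' T' f fh.
pose m2 := Order.isMeetLatticeMorphism.Build d T d' T' f fI.
pose m3 := Order.isJoinLatticeMorphism.Build d T d' T' f fU.
by exists (HB.pack f m1 m2 m3 : {lmorphism T -> T'}); exists g.
Qed.

Theorem theorem4p9 (F : closedFieldType) (charF0 : [pchar F] =i pred0) :
  exists f : {lmorphism ideal2 (Uenv (o_inf F)) -> ideal2 (Uenv (sp_inf F))},
    bijective f.
Proof.
have char2 : 2%:R != 0 :> F by rewrite (pcharf0P F).1.
have [I II] : exists I : F, I * I = -1.
  (* A square root of -1 provides the isotropic vectors of [hyp]. *)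
  have [I] := @solve_monicpoly F 2%N (fun i => if i == 0%N then -1 else 0) isT.
  by rewrite !big_ord_recr big_ord0 /= mul0r add0r addr0 mulr1 expr2; exists I.
have r := orth_realization char2 II.
have r' := symp_realization char2.
have ee : 1 * 1 = 1 :> F by rewrite mulr1.
have ee' : -1 * -1 = 1 :> F by rewrite mulrNN.
have E' : 1 = - -1 :> F by rewrite opprK.
apply: (@order_iso_lmorphism _ _ _ _ (transfer r r' ee erefl) (transfer r' r ee' E')).
- exact: transfer_homo.
- exact: transfer_homo.
- exact: transferK.
- exact: transferK.
Qed.
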